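(* Let $K$ be a compact Hausdorff space, let $X$ be a (real or complex) Banach space, and let $m : C(K) \rightarrow L(X)$ be an injective bounded unital algebra homomorphism such that $m(C(K))$ is closed in $L(X)$ in the weak operator topology. Assume that $X$ is a finitely generated Banach $C(K)$-module. Let $\mathcal{B}$ denote the Boolean algebra of all idempotents in $C(K)$. The following conditions are all equivalent. \begin{enumerate} \item[(1)] $K$ is totally disconnected, $X$ is a Veksler module, and no cyclic subspace of $X$ contains a copy of $\ell^\infty$. \item[(2)] $K$ is Stonian, $X$ is a Kaplansky module, and no cyclic subspace of $X$ contains a copy of $\ell^\infty$. \item[(3)] Each cyclic subspace of $X$, when represented as a Banach lattice, has order continuous norm. \item[(4)] $K$ is Stonian and $\mathcal{B}$ is a Bade-complete Boolean algebra of projections on $X$. \item[(5)] $K$ is hyperstonian and the map $m$ is ($w^\star$, weak-operator)-continuous. \item[(1A)] $K$ is totally disconnected, $X$ is a Veksler module, and $X$ does not contain a copy of $\ell^\infty$. \item[(2A)] $K$ is Stonian, $X$ is a Kaplansky module, and $X$ does not contain a copy of $\ell^\infty$. \end{enumerate}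
   Context: $C(K)$ is the Banach algebra of all continuous scalar-valued functions on $K$ (scalars $\mathbb{R}$ or $\mathbb{C}$, the same as for $X$), and $L(X)$ is the algebra of bounded linear operators on $X$. Given a bounded unital algebra homomorphism $m: C(K)\to L(X)$, $X$ is called a Banach $C(K)$-module; we write $ax$ for $m(a)x$. Order in $C(K)$ is pointwise. Cyclic subspaces: for $x\in X$, $X(x)=\mathrm{cl}\{m(a)x : a\in C(K)\}$ (norm closure) is the cyclic subspace generated by $x$. The module $X$ is finitely generated if there are $x_1,\dots,x_n\in X$ such that the linear span of the cyclic subspaces $X(x_i)$, $i=1,\dots,n$, is dense in $X$. Representation as a Banach lattice: $X(x)$, with the equivalent norm $\|y\|'=\sup\{\|m(a)y\| : a\in C(K), \|a\|\le 1\}$ and with positive cone equal to the closure of $\{m(a)x : a\in C(K), a\ge 0\}$, is a (real or complex) Banach lattice having $x$ as a quasi-interior point. This is what is meant by $X(x)$ represented as a Banach lattice. Veksler module: let $K$ be totally disconnected and $\mathcal{B}$ the Boolean algebra of idempotents of $C(K)$ (characteristic functions of clopen sets). An idempotent $e_x\in\mathcal{B}$ is the carrier projection of $x\in X$ if $m(e_x)x=x$ and, for every $e\in\mathcal{B}$, $m(e)x=x$ implies $e_x\le e$. $X$ is a Veksler module if every $x\in X\setminus\{0\}$ has a carrier projection in $\mathcal{B}$. Stonian means extremally disconnected (compact Hausdorff), equivalently $C(K)$ is Dedekind complete. $K$ is hyperstonian if it is Stonian and $C(K)$ is a dual Banach space; $w^\star$ denotes the weak-star topology on $C(K)$ given by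 its (unique) predual. ''($w^\star$, weak-operator)-continuous'' means continuous from $C(K)$ with the $w^\star$-topology to $L(X)$ with the weak operator topology. Kaplansky module: $K$ is Stonian and, for every $x\in X$ and every set $\{a_\alpha\}$ of non-negative elements of $C(K)$ bounded above in $C(K)$, if $a_\alpha x=0$ for all $\alpha$ then $ax=0$, where $a=\sup_\alpha a_\alpha$ in $C(K)$. Bade-complete: for $K$ Stonian, $\mathcal{B}$ is a Bade-complete Boolean algebra of projections on $X$ if for every increasing net $\{e_\alpha\}$ in $\mathcal{B}$ and every $x\in X$, $\|(e-e_\alpha)x\|\to 0$, where $e=\sup e_\alpha$. A Banach space contains a copy of $\ell^\infty$ if it has a closed subspace linearly homeomorphic to $\ell^\infty$. *)

(* Defs.v *)
From HB Require Import structures.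
From mathcomp Require Import all_boot all_order all_algebra.
From mathcomp Require Import complex.
From mathcomp Require Import all_classical all_reals all_analysis.

Set Implicit Arguments.
Unset Strict Implicit.
Unset Printing Implicit Defensive.

Import Order.TTheory GRing.Theory Num.Theory.
Import numFieldNormedType.Exports.

Local Open Scope classical_set_scope.
Local Open Scope ring_scope.

Variant scalar_kind := RealScalars | ComplexScalars.

Definition scalars (R : realType) (k : scalar_kind) : numFieldType :=
  match k with
  | RealScalars => R
  | ComplexScalars => R[i]
  end.

(* Norms take their values in the scalar field, also when it is R[i] (with its
   partial order 0 <= z iff z is a nonnegative real). A nonempty bounded set of
   nonnegative elements of R[i] has the same supremum there as in R. *)
Definition fsup (F : numFieldType) (A : set F) : F := supremum 0 A.

Definition supnorm (F : numFieldType) (T : Type) (f : T -> F) : F :=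
  fsup (range (fun t => `|f t|)).

Section ContinuousFunctions.
Context (K : topologicalType) (F : numFieldType).

Definition cts : {pred K -> F^o} := mem [set f : K -> F^o | continuous f].

Record cfun := Cfun { cfun_val :> K -> F^o; _ : cfun_val \in cts }.

HB.instance Definition _ := [isSub for cfun_val].
HB.instance Definition _ := [Choice of cfun by <:].

Lemma cts_subring : subring_closed cts.
Proof.
split=> [|f g|f g]; rewrite !inE /=.
- by move=> x; exact: cvg_cst.
- by move=> cf cg x; apply: cvgB; [exact: cf | exact: cg].
- by move=> cf cg x; apply: cvgM; [exact: cf | exact: cg].
Qed.

Lemma cts_subsemimod : subsemimod_closed cts.
Proof.
split=> [|c f].
  split=> [|f g]; rewrite !inE /=.
    by move=> x; exact: cvg_cst.
  by move=> cf cg x; apply: cvgD; [exact: cf | exact: cg].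
rewrite !inE /= => cf x.
by apply: cvgZl_tmp; exact: cf.
Qed.

HB.instance Definition _ :=
  GRing.SubChoice_isSubComPzRing.Build _ _ cfun cts_subring.
HB.instance Definition _ :=
  GRing.SubZmodule_isSubLmodule.Build _ _ _ cfun cts_subsemimod.
HB.instance Definition _ := [SubChoice_isSubPOrder of cfun by <: with FunOrder.fun_display].

End ContinuousFunctions.

Section BoundedOperators.
Context (F : numFieldType) (V W : normedModType F).

Definition blin : {pred V -> W} :=
  mem [set f : V -> W | linear f /\ continuous f].

Record bop := Bop { bop_val :> V -> W; _ : bop_val \in blin }.

HB.instance Definition _ := [isSub for bop_val].
HB.instance Definition _ := [Choice of bop by <:].

Lemma blin_subsemimod : subsemimod_closed blin.
Proof.
split=> [|c f].
  split=> [|f g]; rewrite !inE /=.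
    split=> [c x y|x]; last exact: cvg_cst.
    by rewrite scaler0 addr0.
  move=> [lf cf] [lg cg]; split=> [c x y|x].
    by rewrite !fctE lf lg scalerDr addrACA.
  by apply: cvgD; [exact: cf | exact: cg].
rewrite !inE /= => -[lf cf]; split=> [d x y|x].
  by rewrite !fctE lf scalerDr !scalerA mulrC.
by apply: cvgZl_tmp; exact: cf.
Qed.

HB.instance Definition _ :=
  GRing.SubChoice_isSubLmodule.Build _ _ _ bop blin_subsemimod.

End BoundedOperators.
Lemma scalars_fsup (R : realType) (k : scalar_kind) (A : set (scalars R k)) :
  A !=set0 -> (forall a, A a -> 0 <= a) -> has_ubound A -> supremums A (fsup A).
Proof.
move=> A0 Age0 [M AM].
suff [s sA] : exists s, supremums A s.
  rewrite /fsup /supremum ifF; last exact/negbTE/set0P.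
  by case: xgetP => [x _ //|/(_ s)].
case: k A A0 Age0 M AM => /= A A0 Age0 M AM.
  have supA : has_sup A by split => //; exists M.
  exists (sup A); split; first exact: sup_upper_bound.
  by move=> b Ab; exact: ge_sup.
have ReA a : A a -> a = (complex.Re a)%:C%C.
  move=> Aa; have := Age0 _ Aa; rewrite lecE /= => /andP[/eqP im0 _].
  by case: a im0 {Aa} => x y /= ->.
pose B := [set complex.Re a | a in A].
have B0 : B !=set0 by case: A0 => a Aa; exists (complex.Re a), a.
have supB : has_sup B.
  split=> //; exists (complex.Re M) => _ [a Aa <-].
  by have := AM _ Aa; rewrite lecE => /andP[].
exists (sup B)%:C%C; split.
  move=> a Aa; rewrite (ReA a Aa) lecR.
  by apply: sup_upper_bound => //; exists a.
move=> b Ab; case: A0 => a Aa.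
have := Ab _ Aa; rewrite {1}(ReA a Aa) lecE /= => /andP[imb _].
rewrite lecE /= imb /=; apply: ge_sup => // _ [c Ac <-].
by have := Ab _ Ac; rewrite lecE => /andP[].
Qed.

Section BoundedSequences.
Context (R : realType) (k : scalar_kind).
Let F := scalars R k.

Definition bddseq : {pred nat -> F^o} :=
  mem [set s : nat -> F^o | has_ubound (range (fun n => `|s n|))].

Record linfty := Linfty { linfty_val :> nat -> F^o; _ : linfty_val \in bddseq }.

HB.instance Definition _ := [isSub for linfty_val].
HB.instance Definition _ := [Choice of linfty by <:].

Lemma bddseq_subsemimod : subsemimod_closed bddseq.
Proof.
split=> [|c f].
  split=> [|f g]; rewrite !inE /=.
    by exists 0 => _ [n _ <-]; rewrite normr0.
  move=> [M fM] [N gN]; exists (M + N) => _ [n _ <-].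
  by rewrite (le_trans (ler_normD _ _))// lerD//; [apply: fM|apply: gN]; exists n.
rewrite !inE /= => -[M fM]; exists (`|c| * M) => _ [n _ <-].
by rewrite normrM ler_wpM2l//; apply: fM; exists n.
Qed.

HB.instance Definition _ :=
  GRing.SubChoice_isSubLmodule.Build _ _ _ linfty bddseq_subsemimod.

Lemma supnorm_linfty (s : linfty) :
  supremums (range (fun n => `|s n|)) (supnorm s).
Proof.
apply: scalars_fsup.
- by exists `|s 0%N|, 0%N.
- by move=> _ [n _ <-].
- by case: s => s /=; rewrite inE.
Qed.

Lemma supnorm_linfty_ge (s : linfty) n : `|s n| <= supnorm s.
Proof. by apply: (supnorm_linfty s).1; exists n. Qed.

Lemma supnorm_linfty_le (s : linfty) M :
  (forall n, `|s n| <= M) -> supnorm s <= M.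
Proof. by move=> sM; apply: (supnorm_linfty s).2 => _ [n _ <-]. Qed.

Lemma supnorm_linftyD (s t : linfty) : supnorm (s + t) <= supnorm s + supnorm t.
Proof.
apply: supnorm_linfty_le => n.
by rewrite (le_trans (ler_normD _ _))// lerD// supnorm_linfty_ge.
Qed.

Lemma supnorm_linftyZ (c : F) (s : linfty) :
  supnorm (c *: s) = `|c| * supnorm s.
Proof.
have leZ d (t : linfty) : supnorm (d *: t) <= `|d| * supnorm t.
  apply: supnorm_linfty_le => n.
  by rewrite normrM ler_wpM2l// supnorm_linfty_ge.
apply/eqP; rewrite eq_le leZ /=.
have [->|c0] := eqVneq c 0.
  by rewrite normr0 mul0r (le_trans _ (supnorm_linfty_ge (0 *: s) 0%N)).
have := leZ c^-1 (c *: s).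
by rewrite scalerA mulVf// scale1r normfV ler_pdivlMl// normr_gt0.
Qed.

Lemma supnorm_linfty_eq0 (s : linfty) : supnorm s = 0 -> s = 0.
Proof.
move=> s0; apply/val_inj/funext => n; apply/eqP.
by rewrite -normr_le0 -s0 supnorm_linfty_ge.
Qed.

HB.instance Definition _ := Lmodule_isNormed.Build F linfty
  supnorm_linftyD supnorm_linftyZ supnorm_linfty_eq0.

End BoundedSequences.

Section OperatorTopologies.
Context (F : numFieldType).

Definition opnorm (V W : normedModType F) (T : bop V W) : F :=
  fsup [set `|T x| | x in [set x : V | `|x| <= 1]].

Definition dual (V : normedModType F) := bop V F^o.

HB.instance Definition _ (V : normedModType F) := GRing.Lmodule.on (dual V).

Definition wot (X : normedModType F) :=
  @initial_topology (bop X X) {ptws (X * dual X) -> F^o}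
    (fun T p => p.2 (T p.1)).

HB.instance Definition _ (X : normedModType F) := Topological.on (wot X).

End OperatorTopologies.

Section Preduals.
Context (K : topologicalType) (F : numFieldType).

Record predual := Predual {
  predual_space : completeNormedModType F;
  predual_map : cfun K F -> dual predual_space;
  predual_linear : linear predual_map;
  predual_isometry : forall a, opnorm (predual_map a) = supnorm a;
  predual_surj : forall phi, exists a, predual_map a = phi }.

(* For Stonian K the predual of C(K), when it exists, is unique up to isometry,
   so that the topology below does not depend on P. *)
Definition wstar (P : predual) :=
  @initial_topology (cfun K F) {ptws (predual_space P) -> F^o}
    (fun a y => predual_map P a y).

HB.instance Definition _ (P : predual) := Topological.on (wstar P).

End Preduals.

Definition stonian (K : topologicalType) : Prop :=
  [/\ compact [set: K], hausdorff_space K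
    & forall U : set K, open U -> open (closure U)].

Definition hyperstonian (K : topologicalType) (F : numFieldType) : Prop :=
  stonian K /\ inhabited (predual K F).

Record directed (I : Type) (le : I -> I -> Prop) : Prop := Directed {
  directed_inhabited : inhabited I;
  directed_refl : forall i, le i i;
  directed_trans : forall i j k, le i j -> le j k -> le i k;
  directed_ub : forall i j, exists k, le i k /\ le j k }.

Definition tails (I : Type) (le : I -> I -> Prop) : set_system I :=
  filter_from setT (fun i => [set j | le i j]).

Section BanachModules.
Context (F : numFieldType) (K : topologicalType) (X : normedModType F).
Variable m : cfun K F -> bop X X.

Record banach_module : Prop := BanachModule {
  module_linear : linear m;
  module_mul : forall a b x, m (a * b) x = m a (m b x);
  module_unit : forall x, m 1 x = x;
  module_bounded : exists M : F, forall a, opnorm (m a) <= M * supnorm a }.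

Definition cyclic_subspace (x : X) : set X := closure [set m a x | a in setT].

Definition lin_span (A : set X) : set X :=
  [set v | exists n (c : 'I_n -> F) (u : 'I_n -> X),
     (forall i, A (u i)) /\ v = \sum_(i < n) c i *: u i].

Definition finitely_generated : Prop :=
  exists n (x : 'I_n -> X),
    dense (lin_span (\bigcup_(i in [set: 'I_n]) cyclic_subspace (x i))).

Definition cyclic_norm (y : X) : F :=
  fsup [set `|m a y| | a in [set a : cfun K F | supnorm a <= 1]].

Definition cyclic_cone (x : X) : set X :=
  closure [set m a x | a in [set a : cfun K F | ((0 : cfun K F) <= a)%O]].

(* Decreasing nets in X(x) with infimum 0, for the order u <= v iff v - u lies
   in the cone. Over complex scalars this is order continuity on the real part
   of X(x): a lower bound z of such a net is a difference of two elements of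
   the cone. *)
Definition order_continuous_norm (x : X) : Prop :=
  forall (I : Type) (le : I -> I -> Prop) (y : I -> X),
    directed le ->
    (forall i, cyclic_subspace x (y i)) ->
    (forall i j, le i j -> cyclic_cone x (y i - y j)) ->
    (forall i, cyclic_cone x (y i)) ->
    (forall z, cyclic_subspace x z ->
      (forall i, cyclic_cone x (y i - z)) -> cyclic_cone x (0 - z)) ->
    cyclic_norm (y i) @[i --> tails le] --> (0 : F^o).

Definition idempotents : set (cfun K F) := [set e | e * e = e].

Definition carrier_projection (x : X) (e : cfun K F) : Prop :=
  [/\ idempotents e, m e x = x
    & forall e', idempotents e' -> m e' x = x -> (e <= e')%O].

Definition veksler : Prop :=
  totally_disconnected [set: K] /\
  forall x, x != 0 -> exists e, carrier_projection x e.

Definition kaplansky : Prop :=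
  stonian K /\
  forall (x : X) (A : set (cfun K F)) (a : cfun K F),
    (forall b, A b -> ((0 : cfun K F) <= b)%O) -> has_ubound A -> supremums A a ->
    (forall b, A b -> m b x = 0) -> m a x = 0.

Definition bade_complete : Prop :=
  forall (I : Type) (le : I -> I -> Prop) (e_ : I -> cfun K F) (e : cfun K F),
    directed le ->
    (forall i, idempotents (e_ i)) ->
    (forall i j, le i j -> (e_ i <= e_ j)%O) ->
    idempotents e ->
    (forall i, (e_ i <= e)%O) ->
    (forall f, idempotents f -> (forall i, (e_ i <= f)%O) -> (e <= f)%O) ->
    forall x : X, `|m (e - e_ i) x| @[i --> tails le] --> (0 : F^o).

Definition wstar_wot_continuous (P : predual K F) : Prop :=
  continuous (m : wstar P -> wot X).

End BanachModules.

Definition contains_linfty (R : realType) (k : scalar_kind)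
    (X : normedModType (scalars R k)) (E : set X) : Prop :=
  exists (T : linfty R k -> X) (S : X -> linfty R k),
    [/\ linear T, cancel T S, continuous T, closed (range T)
      & {within range T, continuous S}] /\ range T `<=` E.

(* Main.v *)
(* Call the module normal if, for every vector x and every open U, the functions of
   the unit ball that vanish on a suitable clopen subset of U and off the closure of
   U move x by as little as we please. Each condition is compared with "K is
   Stonian and the module is normal".

   In a Veksler module whose cyclic subspaces contain no l^oo, disjoint clopen
   pieces of a vector tend to 0: otherwise bounded sequences, read as continuous
   functions that are constant on the pieces, embed l^oo. Hence the characteristic
   functions of the clopen subsets of U form a strongly Cauchy net, and since m(C(K))
   is closed in the weak operator topology its limit is an element of C(K), namely
   the characteristic function of the closure of U; order continuity of the norm
   yields Cauchy nets as well. Conversely a decreasing net in a cyclic subspace of a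
   normal module is norm Cauchy.

   For a normal module the predual is the Banach space of normal functionals on
   C(K). A functional psi on it is evaluation at an element of C(K): for positive f,
   compare A -> psi(1_A f) with A -> f(1_A); by a Radon-Nikodym argument on clopen
   sets, carried out for all positive f at once, the first has a continuous density
   with respect to the second that does not depend on f. Conversely, weak-star
   compactness of the unit ball gives carriers, and it excludes l^oo from a finitely
   generated X because extended coordinate functionals would have to converge along
   subsequences. *)

Require Import Defs.
From HB Require Import structures.
From mathcomp Require Import all_boot all_order all_algebra.
From mathcomp Require Import complex.
From mathcomp Require Import all_classical all_reals all_analysis.
From mathcomp Require Import lra ring.

Set Implicit Arguments.
Unset Strict Implicit.
Unset Printing Implicit Defensive.

Import Order.TTheory GRing.Theory Num.Theory.
Import numFieldNormedType.Exports.

Local Open Scope classical_set_scope.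
Local Open Scope ring_scope.

(** Estimates for functions pass to vectors by a division. If |c| <= |d|, then c is uniformly close
    to g d with |g| <= 1, so |c x| <= M |d x|, where M bounds [m]. This takes the place of a lattice
    norm and puts powers of M into the constants. Normality provides one clopen set A for all
    functions considered. As A is compact, an increasing net of open sets covering U swallows A at
    some index; after that index only a remainder as in the definition of normality is left.
    Monotone convergence thus becomes a matter of finitely many sets. Measures are replaced by
    finitely additive functions of clopen sets, with normality in the role of countable additivity.
    The obstacle in representing functionals is that no single positive f need charge every clopen
    set, so densities with respect to different f have to be reconciled. On a clopen subset of its
    carrier, f has a density with respect to f + g that is nonzero on a dense open set; there g is,
    up to a small piece, a multiple of f, and signs pass from f to g. *)

Lemma fmap_ultra (S T : Type) (f : S -> T) (W : set_system S) : UltraFilter W -> UltraFilter (f @ W).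
Proof.
move=> UW; have PW : ProperFilter W by exact: ultra_proper.
split; first exact: fmap_proper_filter.
move=> G PG WG; apply/seteqP; split=> A; last exact: WG.
move=> GA; have : W (f @^-1` A) \/ W (~` (f @^-1` A)) by exact: in_ultra_setVsetC.
case=> // nA; have : G (~` A) by apply: WG.
by move=> /(filterI GA); rewrite setICr => /(@filter_not_empty _ _ PG).
Qed.

(** * Real and complex scalars *)

Section Scalars.
Context (R : realType) (k : scalar_kind).
Local Notation F := (scalars R k).

Definition rc : R -> F :=
  match k with RealScalars => fun r => r | ComplexScalars => fun r => r%:C%C end.
Definition re : F -> R :=
  match k with RealScalars => fun r => r | ComplexScalars => fun z => complex.Re z end.
Definition im : F -> R :=
  match k with RealScalars => fun r => 0 | ComplexScalars => fun z => complex.Im z end.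
(** Over the reals [im] and [iu] are both 0, so that [reim] and everything derived from it hold for
    both kinds of scalars. *)
Definition iu : F :=
  match k with RealScalars => 0 | ComplexScalars => ('i)%C end.

Lemma rcD x y : rc (x + y) = rc x + rc y.
Proof. by rewrite /rc; case: k => //; rewrite rmorphD. Qed.
Lemma rcM x y : rc (x * y) = rc x * rc y.
Proof. by rewrite /rc; case: k => //; rewrite rmorphM. Qed.
Lemma rcN x : rc (- x) = - rc x.
Proof. by rewrite /rc; case: k => //; rewrite rmorphN. Qed.
Lemma rcB x y : rc (x - y) = rc x - rc y. Proof. by rewrite rcD rcN. Qed.
Lemma rc0 : rc 0 = 0. Proof. by rewrite /rc; case: k. Qed.
Lemma rc1 : rc 1 = 1. Proof. by rewrite /rc; case: k. Qed.
Lemma rcV x : rc x^-1 = (rc x)^-1.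
Proof. by rewrite /rc; case: k => //; rewrite fmorphV. Qed.
Lemma ler_rc x y : (rc x <= rc y) = (x <= y).
Proof. by rewrite /rc; case: k => //; rewrite lecR. Qed.
Lemma ltr_rc x y : (rc x < rc y) = (x < y).
Proof. by rewrite !lt_neqAle ler_rc; congr (~~ _ && _); rewrite eq_le !ler_rc -eq_le. Qed.
Lemma rc_inj : injective rc.
Proof. by move=> x y xy; apply/eqP; rewrite eq_le -!ler_rc xy lexx. Qed.
Lemma reK x : re (rc x) = x. Proof. by rewrite /re /rc; case: k. Qed.
Lemma im_rc x : im (rc x) = 0. Proof. by rewrite /im /rc; case: k. Qed.
Lemma reD z w : re (z + w) = re z + re w.
Proof. by rewrite /re; case: k z w => //= -[a b] [c d]. Qed.
Lemma imD z w : im (z + w) = im z + im w.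
Proof. by rewrite /im; case: k z w => [z w|[a b] [c d]] //=; rewrite addr0. Qed.
Lemma reN z : re (- z) = - re z.
Proof. by rewrite /re; case: k z => //= -[a b]. Qed.
Lemma imN z : im (- z) = - im z.
Proof. by rewrite /im; case: k z => [z|[a b]] //=; rewrite oppr0. Qed.
Lemma reB z w : re (z - w) = re z - re w. Proof. by rewrite reD reN. Qed.
Lemma imB z w : im (z - w) = im z - im w. Proof. by rewrite imD imN. Qed.
Lemma reM z w : re (z * w) = re z * re w - im z * im w.
Proof. by rewrite /re /im; case: k z w => [z w|[a b] [c d]] //=; rewrite mulr0 subr0. Qed.
Lemma imM z w : im (z * w) = re z * im w + im z * re w.
Proof. by rewrite /re /im; case: k z w => [z w|[a b] [c d]] //=; rewrite mulr0 mul0r addr0. Qed.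
Lemma re0 : re 0 = 0. Proof. by rewrite -rc0 reK. Qed.
Lemma im0 : im 0 = 0. Proof. by rewrite -rc0 im_rc. Qed.
Lemma re1 : re 1 = 1. Proof. by rewrite -rc1 reK. Qed.
Lemma im1 : im 1 = 0. Proof. by rewrite -rc1 im_rc. Qed.
Lemma reim z : z = rc (re z) + iu * rc (im z).
Proof.
rewrite /re /im /rc /iu; case: k z => [z|[a b]] /=; first by rewrite mul0r addr0.
by apply/eqP; rewrite eq_complex /=; apply/andP; split; apply/eqP; rewrite /=; ring.
Qed.
Lemma re_rcM x z : re (rc x * z) = x * re z.
Proof. by rewrite reM reK im_rc mul0r subr0. Qed.
Lemma im_rcM x z : im (rc x * z) = x * im z.
Proof. by rewrite imM reK im_rc mul0r addr0. Qed.
Lemma re_iu : re iu = 0. Proof. by rewrite /re /iu; case: k. Qed.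
Lemma im_iu : im iu = match k with RealScalars => 0 | ComplexScalars => 1 end.
Proof. by rewrite /im /iu; case: k. Qed.
Lemma ge0_re z : (0 <= z) = (0 <= re z) && (im z == 0).
Proof.
rewrite /re /im; case: k z => [z|[a b]] /=; first by rewrite eqxx andbT.
by rewrite lecE /= eq_sym andbC eq_sym.
Qed.
Lemma ge0_rc z : 0 <= z -> z = rc (re z).
Proof.
by rewrite ge0_re => /andP[_ /eqP i0]; rewrite {1}(reim z) i0 rc0 mulr0 addr0.
Qed.
Lemma reim_eq z w : re z = re w -> im z = im w -> z = w.
Proof. by move=> rr ii; rewrite (reim z) (reim w) rr ii. Qed.
Lemma norm_rc x : `|rc x| = rc `|x|.
Proof.
have [x0|x0] := leP 0 x; first by rewrite !ger0_norm// -rc0 ler_rc.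
by rewrite !ltr0_norm ?rcN// -rc0 ltr_rc.
Qed.

(** The norm as a real number, so that linear arithmetic applies; [nrmE] leads back to the norm in
    the scalar field. *)
Definition nrm (V : normedModType F) (v : V) : R := re `|v|.

Lemma nrmE (V : normedModType F) (v : V) : `|v| = rc (nrm v).
Proof. exact: ge0_rc. Qed.

Section Nrm.
Context (V : normedModType F).
Implicit Types v w : V.
Lemma nrm_ge0 v : 0 <= nrm v. Proof. by rewrite -ler_rc -nrmE rc0. Qed.
Lemma nrm_le v r : (nrm v <= r) = (`|v| <= rc r). Proof. by rewrite nrmE ler_rc. Qed.
Lemma nrm_lt v r : (nrm v < r) = (`|v| < rc r). Proof. by rewrite nrmE ltr_rc. Qed.
Lemma nrmD v w : nrm (v + w) <= nrm v + nrm w.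
Proof. by rewrite nrm_le rcD -!nrmE ler_normD. Qed.
Lemma nrmN v : nrm (- v) = nrm v. Proof. by rewrite /nrm normrN. Qed.
Lemma nrmC v w : nrm (v - w) = nrm (w - v). Proof. by rewrite /nrm distrC. Qed.
Lemma nrmB v w : nrm (v - w) <= nrm v + nrm w.
Proof. by rewrite -[nrm w]nrmN nrmD. Qed.
Lemma nrm_tri (u v w : V) : nrm (v - w) <= nrm (v - u) + nrm (u - w).
Proof. by have := nrmD (v - u) (u - w); rewrite addrA subrK. Qed.
Lemma nrm_sub v w : nrm v - nrm w <= nrm (v - w).
Proof. by rewrite lerBlDr -{1}(subrK w v) nrmD. Qed.
Lemma nrm0 : nrm (0 : V) = 0. Proof. by rewrite /nrm normr0 re0. Qed.
Lemma nrm_eq0 v : (nrm v == 0) = (v == 0).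
Proof. by rewrite -[RHS]normr_eq0 nrmE -rc0 (inj_eq rc_inj). Qed.
Lemma nrm0_eq0 v : nrm v = 0 -> v = 0.
Proof. by move/eqP; rewrite nrm_eq0 => /eqP. Qed.
Lemma nrm_gt0 v : (0 < nrm v) = (v != 0).
Proof. by rewrite lt_neqAle nrm_ge0 andbT eq_sym nrm_eq0. Qed.
Lemma nrmZ (c : F) v : nrm (c *: v) = nrm (c : F^o) * nrm v.
Proof. by apply: rc_inj; rewrite rcM -!nrmE; exact: normrZ. Qed.
Lemma nrm_small v : (forall e, 0 < e -> nrm v <= e) -> v = 0.
Proof.
move=> h; apply/eqP; apply: contraT; rewrite -nrm_gt0 => v0.
have := h (nrm v / 2) ltac:(lra); lra.
Qed.
Lemma cvg_nrmP (G : set_system V) {FG : Filter G} l :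
  G --> l <-> forall e, 0 < e -> \forall v \near G, nrm (l - v) < e.
Proof.
split=> [Gl e e0|h].
  move/cvgrPdist_lt: Gl => /(_ (rc e)); rewrite -rc0 ltr_rc => /(_ e0).
  by apply: filterS => v; rewrite nrm_lt.
apply/cvgrPdist_lt => e e0; have ee := ge0_rc (ltW e0).
have := h (re e); rewrite -ltr_rc -ee rc0 => /(_ e0).
by apply: filterS => v; rewrite nrm_lt -ee.
Qed.
Lemma nbhs_nrmP (A : set V) v :
  nbhs v A <-> exists2 e, 0 < e & forall w, nrm (v - w) < e -> A w.
Proof.
split.
  move=> /nbhs_ballP[e /= e0 eA]; have ee := ge0_rc (ltW e0).
  exists (re e); first by rewrite -ltr_rc -ee rc0.
  by move=> w; rewrite nrm_lt -ee => vw; apply: eA; rewrite -ball_normE.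
move=> [e e0 eA]; apply/nbhs_ballP; exists (rc e) => /=; first by rewrite -rc0 ltr_rc.
by move=> w; rewrite -ball_normE /= -nrm_lt => /eA.
Qed.
Lemma closure_nrmP (A : set V) v :
  closure A v <-> forall e, 0 < e -> exists2 w, A w & nrm (v - w) < e.
Proof.
split=> [cA e e0|h B /nbhs_nrmP[e e0 eB]].
  have /cA[w [Aw wB]] : nbhs v [set w | nrm (v - w) < e].
    by apply/nbhs_nrmP; exists e.
  by exists w.
by have [w Aw vw] := h _ e0; exists w; split => //; exact: eB.
Qed.
End Nrm.

Lemma nrm_rc x : nrm (rc x : F^o) = `|x|. Proof. by rewrite /nrm norm_rc reK. Qed.
Lemma nrmM (c d : F) : nrm (c * d : F^o) = nrm (c : F^o) * nrm (d : F^o).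
Proof. exact: (nrmZ (V := F^o)). Qed.
Lemma nrm1 : nrm (1 : F^o) = 1. Proof. by rewrite -rc1 nrm_rc normr1. Qed.
Lemma nrmV (c : F) : nrm (c^-1 : F^o) = (nrm (c : F^o))^-1.
Proof. by apply: rc_inj; rewrite rcV -!nrmE; exact: normfV. Qed.
End Scalars.

Lemma nrm_complex (R : realType) (a b : R) :
  nrm (Complex a b : (scalars R ComplexScalars)^o) = Num.sqrt (a ^+ 2 + b ^+ 2).
Proof. by []. Qed.

Section ScalarNorms.
Context (R : realType) (k : scalar_kind).
Local Notation F := (scalars R k).

Lemma nrm_iu : nrm (iu R k : F^o) <= 1.
Proof.
rewrite /iu; case: k; first by rewrite nrm0 ler01.
by rewrite nrm_complex expr0n /= add0r expr1n sqrtr1.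
Qed.
Lemma nrm_re (z : F) : `|re z| <= nrm (z : F^o).
Proof.
rewrite /re; case: k z => [z|[a b]]; first by [].
by rewrite nrm_complex -sqrtr_sqr ler_wsqrtr// lerDl sqr_ge0.
Qed.
Lemma nrm_im (z : F) : `|im z| <= nrm (z : F^o).
Proof.
rewrite /im; case: k z => [z|[a b]]; first by rewrite normr0 nrm_ge0.
by rewrite nrm_complex -sqrtr_sqr ler_wsqrtr// lerDr sqr_ge0.
Qed.
Lemma nrm_reim (z : F) : nrm (z : F^o) <= `|re z| + `|im z|.
Proof.
rewrite {1}(reim z) (le_trans (nrmD _ _))// nrm_rc lerD2l nrmM nrm_rc.
by rewrite ler_piMl ?nrm_iu.
Qed.
Lemma ge0_nrm (z : F) : 0 <= z -> nrm (z : F^o) = re z.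
Proof. by move=> z0; rewrite {1}(ge0_rc z0) nrm_rc ger0_norm// -(ler_rc k) rc0 -ge0_rc. Qed.

(** The real and the imaginary part each converge along the ultrafilter, by compactness of the
    interval [- C, C]. *)
Lemma ultra_bounded_cvg (G : set_system F^o) (C : R) : UltraFilter G ->
  G [set z : F^o | nrm z <= C] -> exists l : F^o, G --> l.
Proof.
move=> UG GC; have FG : ProperFilter G by exact: ultra_proper.
have aux (f : F -> R) : (forall z, `|f z| <= nrm (z : F^o)) ->
    exists r : R, forall e : R, 0 < e -> G [set z | `|r - f z| < e].
  move=> fle.
  have UH : UltraFilter (f @ G) by exact: fmap_ultra.
  have HC : (f @ G) [set` `[- C, C]].
    change (G (f @^-1` [set` `[- C, C]])).
    apply: filterS GC => z /= zC; rewrite in_itv /= -ler_norml.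
    exact: le_trans zC.
  have := @segment_compact R (- C) C.
  rewrite compact_ultra => /(_ _ UH HC) [r [_ cr]].
  by exists r => e e0; move/cvgrPdist_lt: cr; exact.
have [r hr] := aux (@re R k) nrm_re; have [s hs] := aux (@im R k) nrm_im.
(* Only an inequality: over the reals the left side vanishes, whatever s is. *)
have ims z : `|im (rc k r + iu R k * rc k s - z)| <= `|s - im z|.
  rewrite imB imD imM !reK !im_rc re_iu mul0r add0r add0r im_iu /im.
  case: (k) z => [z|z] /=; last by rewrite mul1r.
  by rewrite mul0r subr0 normr0.
have rez z : re (rc k r + iu R k * rc k s - z) = r - re z.
  by rewrite reB reD reM !reK im_rc re_iu mul0r mulr0 subr0 addr0.
exists (rc k r + iu R k * rc k s); apply/cvg_nrmP => e e0.
have e2 : 0 < e / 2 by lra.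
apply: filterS2 (hr _ e2) (hs _ e2) => z /= h1 h2.
apply: le_lt_trans (nrm_reim _) _; rewrite rez.
have := ims z; lra.
Qed.

End ScalarNorms.

Section Conjugate.
Context (R : realType) (k : scalar_kind).
Local Notation F := (scalars R k).
Definition cj (z : F) : F := rc k (re z) - iu R k * rc k (im z).
Lemma re_cj z : re (cj z) = re z.
Proof. by rewrite reB reM !reK im_rc re_iu mul0r mulr0 !subr0. Qed.
Lemma im_cj z : im (cj z) = - im z.
Proof.
rewrite imB imM reK !im_rc re_iu mul0r add0r add0r im_iu /im.
by case: k z => [z|z] /=; rewrite ?mulr0 ?mul1r.
Qed.
Lemma nrm_sqr (z : F) : nrm (z : F^o) ^+ 2 = re z ^+ 2 + im z ^+ 2.
Proof.
rewrite /re /im; case: k z => [z|[a b]].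
  by rewrite expr0n /= addr0 /nrm /re real_normK ?num_real.
by rewrite nrm_complex sqr_sqrtr// addr_ge0 ?sqr_ge0.
Qed.
Lemma nrm_cj z : nrm (cj z : F^o) = nrm (z : F^o).
Proof.
by apply/eqP; rewrite -(@eqrXn2 _ 2) ?nrm_ge0// !nrm_sqr re_cj im_cj sqrrN.
Qed.
Lemma mulrcj z : z * cj z = rc k (nrm (z : F^o) ^+ 2).
Proof.
apply: reim_eq; rewrite ?reM ?imM re_cj im_cj ?reK ?im_rc ?nrm_sqr; ring.
Qed.
Lemma cj_ge0 z : 0 <= z -> cj z = z.
Proof.
rewrite ge0_re => /andP[_ /eqP i0]; apply: reim_eq; rewrite ?re_cj// im_cj i0; ring.
Qed.
Lemma cjB z w : cj (z - w) = cj z - cj w.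
Proof. by apply: reim_eq; rewrite ?(reB, imB, re_cj, im_cj)//; ring. Qed.
Lemma rc_neq0 (r : R) : r != 0 -> rc k r != 0.
Proof. by rewrite -(inj_eq (@rc_inj R k)) rc0. Qed.
Lemma rc_ge0 (r : R) : (0 <= rc k r) = (0 <= r). Proof. by rewrite -(rc0 R k) ler_rc. Qed.
End Conjugate.

(** * Compactness and the algebra C(K) *)

(** An induction principle in place of finite subcovers. If [Q A] failed, the sets B with
    [Q (A \ B)] would form a proper filter with a cluster point in A, against the local hypothesis
    at that point. *)
Lemma compact_ind (T : topologicalType) (Q : set T -> Prop) (A : set T) :
  compact A -> Q set0 -> (forall B C, Q B -> Q C -> Q (B `|` C)) ->
  (forall B C, B `<=` C -> Q C -> Q B) ->
  (forall t, A t -> exists2 W, nbhs t W & Q W) -> Q A.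
Proof.
move=> cA Q0 QU Qsub Qloc; apply: contrapT => nQ.
pose G : set_system T := [set B | Q (A `\` B)].
have FG : ProperFilter G.
  split; first by rewrite /G /= setD0.
  constructor=> [|B C QB QC|B C BC QB]; rewrite /G /=.
  - by rewrite setDT.
  - by apply: Qsub (QU _ _ QB QC) => t [At /not_andP[]]; [left|right].
  - by apply: Qsub QB => t [At nC]; split => // /BC.
have [t [At clt]] : A `&` cluster G !=set0.
  by apply: cA; rewrite /G /= setDv.
have [W tW QW] := Qloc t At.
have [|s [nW Ws]] := clt (~` W) W _ tW; last exact: nW.
by apply: Qsub QW => s [_ /contrapT].
Qed.

Section ContFun.
Context (R : realType) (k : scalar_kind) (K : topologicalType).
Local Notation F := (scalars R k).
Local Notation CK := (cfun K F).
Implicit Types (a b c d : CK) (t s : K).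

Lemma cts_nrmP (f : K -> F^o) : continuous f <->
  forall t e, 0 < e -> \forall s \near t, nrm (f t - f s) < e.
Proof.
split=> [cf t e e0|h t]; first by have /cvg_nrmP := cf t; apply.
by apply/cvg_nrmP => e e0; exact: h.
Qed.

Lemma cfun_cts a : continuous (a : K -> F^o).
Proof. by case: a => f /= ; rewrite inE. Qed.

Arguments cfun_cts a : clear implicits.

(** With the default 0 for discontinuous f, a formula can be named as an element of C(K) before its
    continuity is known. *)
Definition cf (f : K -> F^o) : CK :=
  if pselect (continuous f) is left cf then Cfun (mem_set cf) else 0.
Lemma cfE f : continuous f -> cf f = f :> (K -> F^o).
Proof. by rewrite /cf; case: pselect. Qed.
Lemma cfun_eq a b : (forall t, a t = b t) -> a = b.
Proof. by move=> ab; apply/val_inj/funext. Qed.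

Lemma cfunD a b t : (a + b) t = a t + b t. Proof. by []. Qed.
Lemma cfunN a t : (- a) t = - a t. Proof. by []. Qed.
Lemma cfunB a b t : (a - b) t = a t - b t. Proof. by []. Qed.
Lemma cfunM a b t : (a * b) t = a t * b t. Proof. by []. Qed.
Lemma cfunZ (z : F) a t : (z *: a) t = z * a t. Proof. by []. Qed.
Lemma cfun1 t : (1 : CK) t = 1. Proof. by []. Qed.
Lemma cfun0 t : (0 : CK) t = 0. Proof. by []. Qed.
Lemma cfun_sum (I : Type) (r : seq I) (P : pred I) (f : I -> CK) t :
  (\sum_(i <- r | P i) f i) t = \sum_(i <- r | P i) f i t.
Proof. by elim/big_rec2: _ => //= i x y _ <-. Qed.
Lemma cfun_leP a b : (a <= b)%O <-> forall t, a t <= b t.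
Proof. by split => [/lefP|h]; [|apply/lefP]. Qed.

Lemma continuous_nrm (f : K -> F^o) : continuous f ->
  continuous (fun t => rc k (nrm (f t)) : F^o).
Proof.
move=> /cts_nrmP h; apply/cts_nrmP => t e e0.
apply: filterS (h t e e0) => s; rewrite -rcB nrm_rc; apply: le_lt_trans.
rewrite ler_norml; have := nrm_sub (f t) (f s); have := nrm_sub (f s) (f t).
by rewrite nrmC; lra.
Qed.
Lemma continuous_cj (f : K -> F^o) : continuous f ->
  continuous (fun t => cj (f t) : F^o).
Proof.
move=> /cts_nrmP h; apply/cts_nrmP => t e e0.
by apply: filterS (h t e e0) => s; rewrite -cjB nrm_cj.
Qed.

Definition cabs a : CK := cf (fun t => rc k (nrm (a t : F^o))).
Lemma cabsE a t : cabs a t = rc k (nrm (a t : F^o)).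
Proof. by rewrite /cabs cfE//; apply: continuous_nrm; exact: cfun_cts. Qed.

(* g = c d^* / (|d|^2 + e^2) *)
Lemma cfun_div c d (e : R) : 0 < e ->
  (forall t, nrm (c t : F^o) <= nrm (d t : F^o)) ->
  exists g : CK, [/\ forall t, nrm (g t : F^o) <= 1,
    forall t, nrm (c t - g t * d t : F^o) <= e
    & (forall t, 0 <= c t) -> (forall t, 0 <= d t) -> forall t, 0 <= g t].
Proof.
move=> e0 cd.
pose q t : R := nrm (d t : F^o) ^+ 2 + e ^+ 2.
have q0 t : 0 < q t by rewrite /q ltr_wpDl ?sqr_ge0// exprn_gt0.
pose g t : F^o := c t * cj (d t) * (rc k (q t))^-1.
have cd' := cfun_cts d; have cc := cfun_cts c.
have cq : continuous (fun t => rc k (q t) : F^o).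
  rewrite (_ : (fun t => _) = fun t =>
    rc k (nrm (d t : F^o)) * rc k (nrm (d t : F^o)) + rc k (e ^+ 2)); last first.
    by apply/funext => s; rewrite -rcM -rcD.
  move=> t; apply: cvgD; last exact: cvg_cst.
  by apply: cvgM; exact: continuous_nrm.
have cg : continuous g.
  move=> t; apply: cvgM; first by apply: cvgM; [exact: cc|exact: continuous_cj].
  by apply: cvgV; [rewrite rc_neq0// gt_eqF|exact: cq].
have nq t : nrm ((rc k (q t))^-1 : F^o) = (q t)^-1.
  by rewrite nrmV nrm_rc gtr0_norm.
exists (cf g); rewrite cfE//; split=> [t|t|c0 d0 t].
- rewrite /g !nrmM nq nrm_cj ler_pdivrMr// mul1r /q.
  have := cd t; have := nrm_ge0 (c t : F^o); have := sqr_ge0 e; nra.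
(* The error is c e^2 / (|d|^2 + e^2); it is at most e because |c| <= |d| and |d| e <= |d|^2 +
   e^2. *)
- have -> : c t - g t * d t = c t * rc k (e ^+ 2) * (rc k (q t))^-1.
    have qn : rc k (q t) != 0 by rewrite rc_neq0// gt_eqF.
    apply: (mulIf qn); rewrite mulfVK// mulrBl.
    have -> : g t * d t * rc k (q t) = c t * (d t * cj (d t)).
      by rewrite /g (mulrAC (c t * _)) mulfVK// -mulrA [cj _ * _]mulrC.
    by rewrite mulrcj -mulrBr -rcB /q addrC addKr.
  rewrite !nrmM nq nrm_rc (ger0_norm (sqr_ge0 e)) ler_pdivrMr// /q.
  have := cd t; have := nrm_ge0 (c t : F^o); have := nrm_ge0 (d t : F^o).
  set x := nrm _; set y := nrm _ => x0 y0 yx.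
  have ye : y * e <= x * e by rewrite ler_pM2r.
  have : y * e <= x ^+ 2 + e ^+ 2.
    have := sqr_ge0 (x - e); have := sqr_ge0 x; have := sqr_ge0 e; nra.
  by move=> ?; rewrite expr2 mulrA [e * _]mulrC ler_pM2r.
- rewrite /g cj_ge0// mulr_ge0 ?mulr_ge0// invr_ge0 rc_ge0.
  exact: ltW.
Qed.

Lemma cfun_bounded a : compact [set: K] ->
  exists2 C : R, 0 <= C & forall t, nrm (a t : F^o) <= C.
Proof.
move=> cK.
suff [C hC] : exists C : R, forall t, setT t -> nrm (a t : F^o) <= C.
  exists (Num.max 0 C) => [|t]; first by rewrite le_max lexx.
  by rewrite le_max hC ?orbT.
apply: (compact_ind (Q := fun A => exists C : R, forall t, A t -> nrm (a t : F^o) <= C) cK).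
- by exists 0.
- move=> B D [C1 h1] [C2 h2]; exists (Num.max C1 C2) => t.
  by rewrite le_max => -[/h1->|/h2->]; rewrite ?orbT.
- by move=> B D BD [C h]; exists C => t /BD/h.
- move=> t _; have /cts_nrmP/(_ t 1 ltr01) := cfun_cts a => h.
  exists [set s | nrm (a t - a s : F^o) < 1] => //.
  exists (1 + nrm (a t : F^o)) => s /= ts.
  by have := nrm_sub (a s : F^o) (a t : F^o); rewrite nrmC; lra.
Qed.

Definition sn a : R := re (supnorm (a : K -> F)).
Section Compact.
Hypothesis cK : compact [set: K].
Lemma supnorm_sup a : [set: K] !=set0 ->
  supremums (range (fun t => `|a t|)) (supnorm (a : K -> F)).
Proof.
move=> [t0 _]; apply: scalars_fsup.
- by exists `|a t0|, t0.
- by move=> _ [t _ <-].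
- have [C C0 aC] := cfun_bounded a cK.
  by exists (rc k C) => _ [t _ <-]; rewrite -(nrm_le (a t : F^o)).
Qed.
Lemma supnorm_ge0 a : 0 <= supnorm (a : K -> F).
Proof.
have [K0|/set0P/negP/negPn/eqP K0] := pselect ([set: K] !=set0).
  have [ub _] := supnorm_sup a K0; case: K0 => t _.
  by apply: le_trans (ub `|a t| _) => //; exists t.
(* Over an empty K the supremum of the empty set takes the default value 0. *)
have -> : supnorm (a : K -> F) = fsup set0.
  by rewrite /supnorm K0 image_set0.
by rewrite /fsup supremum0.
Qed.
Lemma supnormE a : supnorm (a : K -> F) = rc k (sn a).
Proof. by rewrite /sn -ge0_rc// supnorm_ge0. Qed.
Lemma sn_ge0 a : 0 <= sn a.
Proof. by rewrite -(rc_ge0 k) -supnormE supnorm_ge0. Qed.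
Lemma sn_ub a t : nrm (a t : F^o) <= sn a.
Proof.
rewrite nrm_le -supnormE; have [ub _] := @supnorm_sup a (ex_intro _ t I).
by apply: ub; exists t.
Qed.
Lemma sn_le a r : 0 <= r -> (forall t, nrm (a t : F^o) <= r) -> sn a <= r.
Proof.
move=> r0 ar; have [K0|/set0P/negP/negPn/eqP K0] := pselect ([set: K] !=set0).
  rewrite -(ler_rc k) -supnormE; have [_ lb] := supnorm_sup a K0.
  by apply: lb => _ [t _ <-]; rewrite -(nrm_le (a t : F^o)).
by rewrite /sn /supnorm K0 image_set0 /fsup supremum0 re0.
Qed.
End Compact.

Definition ind (A : set K) : CK := cf (fun t => if t \in A then 1 else 0).
Lemma indE A t : clopen A -> ind A t = if t \in A then 1 else 0.
Proof.
move=> [oA cA]; rewrite /ind cfE// => s.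
have [sA|sA] := pselect (A s).
  apply: cvg_near_cst; near=> u; rewrite mem_set//; last by near: u; exact: (open_nbhs_nbhs (conj oA sA)).
  by rewrite mem_set.
have oCA : open (~` A) by exact: closed_openC.
apply: cvg_near_cst; near=> u; rewrite !memNset//.
by near: u; exact: (open_nbhs_nbhs (conj oCA sA)).
Unshelve. all: by end_near.
Qed.
Lemma ind_in A t : clopen A -> A t -> ind A t = 1.
Proof. by move=> cA At; rewrite indE// mem_set. Qed.
Lemma ind_out A t : clopen A -> ~ A t -> ind A t = 0.
Proof. by move=> cA At; rewrite indE// memNset. Qed.
Lemma ind_idem A : clopen A -> idempotents (ind A).
Proof.
by move=> cA; apply: cfun_eq => t; rewrite cfunM indE//; case: ifP; rewrite ?mulr1 ?mulr0.
Qed.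
Lemma ind_01 A t : clopen A -> 0 <= ind A t <= 1.
Proof. by move=> cA; rewrite indE//; case: ifP; rewrite ?lexx ?ler01. Qed.
Lemma nrm_ind A t : clopen A -> nrm (ind A t : F^o) <= 1.
Proof. by move=> cA; rewrite indE//; case: ifP; rewrite ?nrm0 ?nrm1. Qed.
Lemma idem_val (e : CK) t : idempotents e -> e t = 0 \/ e t = 1.
Proof.
move=> ee; have : e t * e t = e t by rewrite -cfunM ee.
move/eqP; rewrite -subr_eq0 -{3}[e t]mulr1 -mulrBr mulf_eq0 subr_eq0.
by case/orP => /eqP; [left|right].
Qed.
Lemma idem_clopen (e : CK) : idempotents e -> clopen [set t | e t = 1].
Proof.
move=> ee; have clv (z : F) : closed [set t | e t = z].
  have -> : [set t | e t = z] = (e : K -> F^o) @^-1` [set z] by [].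
  apply: preimage_closed; first by move=> t _; exact: cfun_cts.
  exact/accessible_closed_set1/hausdorff_accessible/norm_hausdorff.
split; last exact: clv.
have -> : [set t | e t = 1] = ~` [set t | e t = 0].
  apply/seteqP; split=> t /=; first by move=> ->; exact/eqP/oner_neq0.
  by case: (idem_val t ee).
exact/closed_openC/clv.
Qed.
Lemma idem_ind (e : CK) : idempotents e -> e = ind [set t | e t = 1].
Proof.
move=> ee; apply: cfun_eq => t; have cl := idem_clopen ee.
have [e0|e1] := idem_val t ee; last by rewrite ind_in.
by rewrite ind_out//= e0 => /esym/eqP; rewrite oner_eq0.
Qed.
Lemma ind_le A B : clopen A -> clopen B -> ((ind A <= ind B)%O <-> A `<=` B).
Proof.
move=> cA cB; split.
  move=> /cfun_leP h t At; apply: contrapT => Bt.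
  by have := h t; rewrite ind_in// ind_out// ler10.
move=> AB; apply/cfun_leP => t; have [At|At] := pselect (A t).
  by rewrite !ind_in//; exact: AB.
by rewrite ind_out//; have /andP[] := ind_01 t cB.
Qed.
Lemma ind_mul A B : clopen A -> clopen B -> ind A * ind B = ind (A `&` B).
Proof.
move=> cA cB; apply: cfun_eq => t; rewrite cfunM.
have cAB : clopen (A `&` B) by exact: clopenI.
have [At|At] := pselect (A t); have [Bt|Bt] := pselect (B t).
- by rewrite !ind_in// mulr1.
- by rewrite (ind_out cB)// (ind_out cAB) ?mulr0// => -[].
- by rewrite (ind_out cA)// (ind_out cAB) ?mul0r// => -[].
- by rewrite (ind_out cA)// (ind_out cAB) ?mul0r// => -[].
Qed.
Lemma indT : ind setT = 1.
Proof. by apply: cfun_eq => t; rewrite ind_in//; exact: clopenT. Qed.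
Lemma indC A : clopen A -> ind (~` A) = 1 - ind A.
Proof.
move=> cA; have cC : clopen (~` A) by apply: clopenC.
apply: cfun_eq => t; rewrite cfunB cfun1.
have [At|At] := pselect (A t); first by rewrite (ind_in cA)// (ind_out cC) ?subrr// => /(_ At).
by rewrite (ind_out cA)// (ind_in cC) ?subr0.
Qed.
Lemma indU A B : clopen A -> clopen B -> A `&` B = set0 -> ind (A `|` B) = ind A + ind B.
Proof.
move=> cA cB AB0; have cAB : clopen (A `|` B) by exact: clopenU.
apply: cfun_eq => t; rewrite cfunD.
have [At|At] := pselect (A t).
  rewrite (ind_in cA)// (ind_out cB) ?addr0 ?(ind_in cAB)//; first by left.
  by move=> Bt; have : (A `&` B) t by []; rewrite AB0.
have [Bt|Bt] := pselect (B t); first by rewrite (ind_in cB)// (ind_out cA)// add0r (ind_in cAB)//; right.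
by rewrite (ind_out cA)// (ind_out cB)// addr0 (ind_out cAB)// => -[].
Qed.
Definition inside (U : set K) : set CK := [set ind A | A in [set A | clopen A /\ A `<=` U]].
End ContFun.
Arguments cfun_cts {R k K} a.

(** * Bounded operators and the module action *)

Section Bop.
Context (R : realType) (k : scalar_kind).
Local Notation F := (scalars R k).
Context (V W : normedModType F).
Implicit Types (T S : bop V W) (x y : V) (c : F).

Lemma bop_linear T : linear T. Proof. by case: T => f /=; rewrite inE => -[]. Qed.
Lemma bop_cts T : continuous T. Proof. by case: T => f /=; rewrite inE => -[]. Qed.
Lemma bopD T x y : T (x + y) = T x + T y.
Proof. by have := bop_linear T 1 x y; rewrite !scale1r. Qed.
Lemma bop0 T : T 0 = 0.
Proof. by apply: (@addrI _ (T 0)); rewrite -bopD !addr0. Qed.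
Lemma bopZ T c x : T (c *: x) = c *: T x.
Proof. by have := bop_linear T c x 0; rewrite !addr0 bop0 addr0. Qed.
Lemma bopN T x : T (- x) = - T x. Proof. by rewrite -scaleN1r bopZ scaleN1r. Qed.
Lemma bopB T x y : T (x - y) = T x - T y. Proof. by rewrite bopD bopN. Qed.
Lemma bop_eq T S : (forall x, T x = S x) -> T = S.
Proof. by move=> TS; apply/val_inj/funext. Qed.

Arguments bop_cts T : clear implicits.

Lemma bop_bounded T : exists2 C : R, 0 <= C & forall x, nrm (T x) <= C * nrm x.
Proof.
have /cvg_nrmP/(_ 1 ltr01)/nbhs_nrmP[e e0 h] := bop_cts T (0 : V).
have e20 : 0 < e / 2 by lra.
exists (2 / e) => [|x]; first by rewrite divr_ge0// ltW.
have [->|x0] := eqVneq x 0; first by rewrite bop0 !nrm0 mulr0.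
have nx : 0 < nrm x by rewrite nrm_gt0.
have r0 : 0 < e / 2 / nrm x by rewrite divr_gt0.
have := h (rc k (e / 2 / nrm x) *: x).
rewrite sub0r nrmN nrmZ nrm_rc gtr0_norm// divfK ?gt_eqF// => /(_ ltac:(lra)).
rewrite /preimage /= bop0 sub0r nrmN bopZ nrmZ nrm_rc gtr0_norm// mulrC -ltr_pdivlMr// => /ltW/le_trans; apply.
have -> // : 1 / (e / 2 / nrm x) = 2 / e * nrm x by field; rewrite !gt_eqF.
Qed.

Definition mkbop (f : V -> W) : bop V W :=
  if pselect (linear f /\ continuous f) is left h then Bop (mem_set h) else 0.
Lemma mkbopE f (C : R) : linear f -> (forall x, nrm (f x) <= C * nrm x) ->
  mkbop f = f :> (V -> W).
Proof.
move=> lf fC; rewrite /mkbop; case: pselect => // -[]; split=> // x.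
have fB y z : f (y - z) = f y - f z.
  by have := lf (-1) z y; rewrite !scaleN1r => h; rewrite [y - z]addrC h addrC.
apply/cvg_nrmP => e e0.
have C0 : 0 < `|C| + 1 by rewrite ltr_wpDl.
apply/nbhs_nrmP; exists (e / (`|C| + 1)); first by rewrite divr_gt0.
move=> w; rewrite /preimage /= -fB ltr_pdivlMr// => xw.
apply: le_lt_trans (fC _) _; apply: le_lt_trans xw.
rewrite mulrC ler_wpM2l ?nrm_ge0//; have := ler_norm C; lra.
Qed.

Definition opn T : R := re (opnorm T).
Lemma opnorm_sup T :
  supremums [set `|T x| | x in [set x : V | `|x| <= 1]] (opnorm T).
Proof.
apply: scalars_fsup.
- by exists `|T 0|, 0 => //=; rewrite normr0 ler01.
- by move=> _ [x _ <-].
- have [C C0 TC] := bop_bounded T.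
  exists (rc k C) => _ [x /= x1 <-]; rewrite -nrm_le.
  apply: le_trans (TC x) _; rewrite ler_piMr// nrm_le rc1//.
Qed.
Lemma opnormE T : opnorm T = rc k (opn T).
Proof.
rewrite /opn -ge0_rc//; have [ub _] := opnorm_sup T.
by apply: le_trans (ub `|T 0| _) => //; exists 0 => //=; rewrite normr0 ler01.
Qed.
Lemma opn_ge0 T : 0 <= opn T.
Proof.
rewrite -(rc_ge0 k) -opnormE; have [ub _] := opnorm_sup T.
by apply: le_trans (ub `|T 0| _) => //; exists 0 => //=; rewrite normr0 ler01.
Qed.
Lemma opn_ub1 T x : nrm x <= 1 -> nrm (T x) <= opn T.
Proof.
rewrite nrm_le rc1 => x1; rewrite nrm_le -opnormE.
by have [ub _] := opnorm_sup T; apply: ub; exists x.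
Qed.
Lemma opn_ub T x : nrm (T x) <= opn T * nrm x.
Proof.
have [->|x0] := eqVneq x 0; first by rewrite bop0 !nrm0 mulr0.
have nx : 0 < nrm x by rewrite nrm_gt0.
have := @opn_ub1 T (rc k (nrm x)^-1 *: x).
rewrite bopZ !nrmZ nrm_rc gtr0_norm ?invr_gt0// mulVf ?gt_eqF// => /(_ (lexx _)).
by rewrite mulrC ler_pdivrMr.
Qed.
Lemma opn_le T r : 0 <= r -> (forall x, nrm x <= 1 -> nrm (T x) <= r) -> opn T <= r.
Proof.
move=> r0 h; rewrite -(ler_rc k) -opnormE; have [_ lb] := opnorm_sup T.
by apply: lb => _ [x /= x1 <-]; rewrite -nrm_le h// nrm_le rc1.
Qed.
End Bop.

Lemma initial_cvgP (S : choiceType) (T : topologicalType) (f : S -> T)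
    (G : set_system S) (s : S) : Filter G ->
  G --> (s : initial_topology f) <-> f @ G --> f s.
Proof.
move=> FG; split=> [cGs|cfs].
  move=> A /initial_continuous; exact: cGs.
move=> A /= [_ [[B Bop <-] Bfs sBfA]].
have /cfs GB : nbhs (f s) B by rewrite nbhsE; exists B.
change (G A); have GB' : G (f @^-1` B) by [].
by apply: filterS GB' => y; exact: sBfA.
Qed.

Lemma ptws_cvgP (U : Type) (V : topologicalType)
    (G : set_system {ptws U -> V}) (f : {ptws U -> V}) : Filter G ->
  G --> f <-> forall u, (fun g : {ptws U -> V} => g u) @ G --> f u.
Proof.
move=> FG; split=> [Gf u|h].
  by apply/initial_cvgP; move/cvg_sup: Gf; apply.
by apply/cvg_sup => u; apply/initial_cvgP; exact: h.
Qed.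

(** * Clopen sets in compact spaces *)

Section Topology.
Context (R : realType) (K : topologicalType).
Hypotheses (cK : compact [set: K]) (hK : hausdorff_space K).

Lemma closed_compact (A : set K) : closed A -> compact A.
Proof. by move=> cA; apply: subclosed_compact cA cK _. Qed.

Lemma clopen_compl_closure (U : set K) : open (closure U) -> clopen (closure U).
Proof. by move=> oU; split => //; exact: closed_closure. Qed.

(** In a compact Hausdorff space the quasi-component Q of x, the intersection of its clopen
    neighbourhoods, is connected and therefore reduces to x. Closed pieces of a splitting of Q have
    disjoint open neighbourhoods U and V; by compactness a clopen A around x lies in U [|] V, and A
    cut down to U or to V is clopen again. *)
Lemma td_zero_dim : totally_disconnected [set: K] -> zero_dimensional K.
Proof.
move=> td x y xy; apply: contrapT => nU.
pose C := [set A : set K | clopen A /\ A x].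
pose Q := \bigcap_(A in C) A.
have Qx : Q x by move=> A [].
have Qy : Q y by move=> A [cA Ax]; apply: contrapT => Ay; apply: nU; exists A.
suff conQ : connected Q.
  have : connected_component [set: K] x y by exists Q.
  by rewrite td// => /= /esym/eqP; exact/negP.
have clQ : closed Q by apply: closed_bigI => A [[]].
move=> B [b Bb] [U0 oU0 BU] [D0 cD0 BD].
have clB : closed B by rewrite BD; exact: closedI.
have clB' : closed (Q `\` B).
  rewrite (_ : Q `\` B = Q `&` ~` U0); first by apply: closedI => //; exact: open_closedC.
  by rewrite {1}BU; apply/seteqP; split=> z [Qz h]; split=> //; [move=> Uz; exact: h|move=> []].
have nK := compact_normal hK cK.
have [|U [V [oU oV BsU B'V UV0]]] := (@normal_openP R K).1 nK _ _ clB clB'.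
  by apply/seteqP; split=> // z [Bz []].
have [A [cA Ax AUV]] : exists A, [/\ clopen A, A x & A `<=` U `|` V].
  have cc : compact (~` (U `|` V)) by apply/closed_compact/open_closedC/openU.
  pose P E := exists A, [/\ clopen A, A x & A `&` E = set0].
  have : P (~` (U `|` V)).
    apply: (compact_ind cc).
    - by exists setT; split; [exact: clopenT|by []|rewrite setI0].
    - move=> E1 E2 [A1 [c1 x1 e1]] [A2 [c2 x2 e2]]; exists (A1 `&` A2).
      split => //; first exact: clopenI.
      apply/seteqP; split=> // z [[z1 z2] [E|E]].
        by rewrite -e1.
      by rewrite -e2.
    - move=> E1 E2 sE [A1 [c1 x1 e1]]; exists A1; split=> //.
      by apply/seteqP; split=> // z [Az /sE Ez]; rewrite -e1.
    - move=> t tUV; have [A [[cA Ax] At]] : exists A, C A /\ ~ A t.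
        apply: contrapT => h; apply: tUV.
        have Qt : Q t by move=> A CA; apply: contrapT => At; apply: h; exists A.
        by have [Bt|Bt] := pselect (B t); [left; exact: BsU|right; exact: B'V].
      exists (~` A); last by exists A; split=> //; exact: setICr.
      by apply: open_nbhs_nbhs; split => //; case: cA => _; exact: closed_openC.
  move=> [A [cA Ax A0]]; exists A; split=> // z Az; apply: contrapT => h.
  by have : (A `&` ~` (U `|` V)) z by []; rewrite A0.
have clopenAI U1 V1 : open U1 -> open V1 -> A `<=` U1 `|` V1 -> U1 `&` V1 = set0 ->
    clopen (A `&` U1).
  move=> oU1 oV1 AUV1 UV1; have [oA cA'] := cA; split; first exact: openI.
  rewrite (_ : A `&` U1 = A `&` ~` V1); first by apply: closedI => //; exact: open_closedC.
  apply/seteqP; split=> z [Az h]; split=> //.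
    by move=> V1z; have : (U1 `&` V1) z by []; rewrite UV1.
  by case: (AUV1 _ Az).
have [Bx|Bx] := pselect (B x).
  have QU : Q `<=` U.
    move=> z /(_ (A `&` U)) []; last by [].
    split; last by split=> //; exact: BsU.
    exact: clopenAI oU oV AUV UV0.
  apply/seteqP; split; first by rewrite BD => z [].
  move=> z Qz; apply: contrapT => Bz.
  have : (U `&` V) z by split; [exact: QU|exact: B'V].
  by rewrite UV0.
have QV : Q `<=` V.
  move=> z /(_ (A `&` V)) []; last by [].
  split; last by split=> //; exact: B'V.
  by apply: clopenAI oV oU _ _; rewrite 1?setUC 1?setIC// setIC.
have : (U `&` V) b by split; [exact: BsU|apply: QV; move: Bb; rewrite BD => -[]].
by rewrite UV0.
Qed.

Lemma zd_basis (t : K) (W : set K) : zero_dimensional K -> nbhs t W ->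
  exists A, [/\ clopen A, A t & A `<=` W].
Proof.
move=> zd tW; have := zero_dimensional_cvg hK zd cK tW.
by case=> A /= [At cA] AW; exists A.
Qed.
(** For disjoint open neighbourhoods A of x and B of y, the closure of A is clopen and misses B. *)
Lemma stonian_zd : stonian K -> zero_dimensional K.
Proof.
move=> [_ _ ed] x y xy.
move: hK; rewrite open_hausdorff => /(_ _ _ xy)[[A B] /= [/set_mem Ax /set_mem By] [oA oB AB0]].
exists (closure A); split; first exact/clopen_compl_closure/ed.
  exact: subset_closure.
move=> /(_ B (open_nbhs_nbhs (conj oB By)))[z zAB].
by move/eqP: AB0 zAB => ->.
Qed.
End Topology.

(** * Module estimates, strong limits and normality *)

Section Module.
Context (R : realType) (k : scalar_kind) (K : topologicalType).
Local Notation F := (scalars R k).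
Local Notation CK := (cfun K F).
Context (X : completeNormedModType F) (m : CK -> bop X X).
Hypotheses (cK : compact [set: K]) (hK : hausdorff_space K).
Hypothesis mm : banach_module m.
Implicit Types (a b c d : CK) (x y : X) (U : set K).

Lemma modD a b x : m (a + b) x = m a x + m b x.
Proof. by have := module_linear mm 1 a b; rewrite !scale1r => ->. Qed.
Lemma modM a b x : m (a * b) x = m a (m b x). Proof. exact: module_mul. Qed.
Lemma mod1 x : m 1 x = x. Proof. exact: module_unit. Qed.
Lemma mod0 x : m 0 x = 0.
Proof. by apply: (@addrI _ (m 0 x)); rewrite -modD !addr0. Qed.
Lemma modZ (z : F) a x : m (z *: a) x = z *: m a x.
Proof. have := module_linear mm z a 0; rewrite addr0 => ->.
by change (z *: m a x + m 0 x = z *: m a x); rewrite mod0 addr0. Qed.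
Lemma modN a x : m (- a) x = - m a x.
Proof. by rewrite -scaleN1r modZ scaleN1r. Qed.
Lemma modB a b x : m (a - b) x = m a x - m b x. Proof. by rewrite modD modN. Qed.

Lemma mod_bound : exists M : R, 1 <= M /\ forall a r x,
  0 <= r -> (forall t, nrm (a t : F^o) <= r) -> nrm (m a x) <= M * r * nrm x.
Proof.
have [M0 hM] := module_bounded mm.
pose M := Num.max 1 (re M0); exists M; split; first by rewrite le_max lexx.
move=> a r x r0 ar; apply: le_trans (opn_ub _ _) _.
rewrite ler_wpM2r ?nrm_ge0//.
have := hM a; rewrite opnormE supnormE// => hle.
have : opn (m a) <= re M0 * sn a.
  have : 0 <= M0 * rc k (sn a) - rc k (opn (m a)) by rewrite subr_ge0.
  by rewrite ge0_re reB reM !reK im_rc mulr0 subr0 subr_ge0 => /andP[].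
move=> /le_trans; apply.
have sa0 := sn_ge0 cK a; have sar := sn_le cK r0 ar.
have M0M : re M0 <= M by rewrite /M le_max lexx orbT.
have M1 : 1 <= M by rewrite /M le_max lexx.
apply: le_trans (_ : M * sn a <= _); first by rewrite ler_wpM2r.
by rewrite ler_wpM2l// (le_trans _ M1).
Qed.

(** A bound of [m], raised to at least 1 so that it can be divided by and absorbs smaller powers of
    itself. *)
Definition modC : R := sval (cid mod_bound).
Lemma modC_ge1 : 1 <= modC. Proof. by rewrite /modC; case: cid => ? []. Qed.
Lemma modC_gt0 : 0 < modC. Proof. exact: lt_le_trans ltr01 modC_ge1. Qed.
Lemma mod_le a r x : 0 <= r -> (forall t, nrm (a t : F^o) <= r) ->
  nrm (m a x) <= modC * r * nrm x.
Proof. by rewrite /modC; case: cid => ? /= [_]; apply. Qed.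
Lemma mod_le1 a x : (forall t, nrm (a t : F^o) <= 1) ->
  nrm (m a x) <= modC * nrm x.
Proof. by move=> /(mod_le x ler01); rewrite mulr1. Qed.

(** By [cfun_div], c is uniformly close to g d with |g| <= 1, so c x is close to g (d x), whose norm
    is at most [modC] times that of d x. *)
Lemma mod_dom c d x : (forall t, nrm (c t : F^o) <= nrm (d t : F^o)) ->
  nrm (m c x) <= modC * nrm (m d x).
Proof.
move=> cd; rewrite leNgt; apply/negP => lt.
(* With this e the error term is at most half of the supposed gap; the summand 1 covers x = 0. *)
pose e := (nrm (m c x) - modC * nrm (m d x)) / (modC * nrm x + 1) / 2.
have q0 : 0 < modC * nrm x + 1.
  by rewrite ltr_wpDl// mulr_ge0 ?nrm_ge0// ltW// modC_gt0.
have e0 : 0 < e by rewrite /e divr_gt0// divr_gt0// subr_gt0.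
have [g [g1 cg _]] := cfun_div e0 cd.
have : m c x = m (c - g * d) x + m g (m d x).
  by rewrite -modM -modD subrK.
have h1 := @mod_le (c - g * d) e x (ltW e0) cg.
have h2 := @mod_le1 g (m d x) g1.
move=> E; have := nrmD (m (c - g * d) x) (m g (m d x)); rewrite -E.
have : e * (modC * nrm x + 1) * 2 = nrm (m c x) - modC * nrm (m d x).
  by rewrite /e; field; rewrite gt_eqF.
nra.
Qed.

Lemma urysohn_bump t (W : set K) : nbhs t W -> exists h : CK,
  [/\ h t = 1, forall s, 0 <= h s <= 1 & forall s, ~ W s -> h s = 0].
Proof.
move=> tW; have nK := compact_normal hK cK.
have cA : closed [set t].
  exact/accessible_closed_set1/hausdorff_accessible.
have cB : closed (~` interior W) by apply/open_closedC/open_interior.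
have sep : uniform_separator (~` interior W) [set t].
  apply: (iffLR (@normal_separatorP R K)) => //.
  by apply/seteqP; split=> // s [nW /= st]; apply: nW; rewrite st.
pose u := Urysohn (R := R) (~` interior W) [set t].
have cu : continuous (fun s => rc k (u s) : F^o).
  apply/cts_nrmP => s e e0.
  have := @Urysohn_continuous K R (~` interior W) [set t] s.
  move/cvgrPdist_lt => /(_ _ e0); apply: filterS => s'.
  by rewrite -rcB nrm_rc.
exists (cf (fun s => rc k (u s))); rewrite cfE//; split=> [|s|s Ws].
- rewrite (_ : u t = 1) ?rc1//; apply: (Urysohn_sub1 sep); by exists t.
- have := @Urysohn_range K R (~` interior W) [set t] (u s) (ex_intro2 _ _ s I erefl).
  by rewrite /= in_itv /= -(rc1 R k) rc_ge0 ler_rc.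
- rewrite (_ : u s = 0) ?rc0//; apply: (Urysohn_sub0 sep); exists s => //.
  by move=> /interior_subset.
Qed.

Hypothesis minj : injective m.
Hypothesis mcl : closed (range m : set (wot X)).

(* Strong limits of increasing nets in the unit interval of C(K) are operators
   of the module, since its image is closed in the weak operator topology. *)
Lemma directed_limit (D : set CK) :
  D !=set0 -> (forall a, D a -> forall t, 0 <= a t <= 1) ->
  (forall a b, D a -> D b -> exists2 c, D c & (a <= c)%O /\ (b <= c)%O) ->
  (forall x (e : R), 0 < e -> exists2 a, D a &
    forall b, D b -> (a <= b)%O -> nrm (m b x - m a x) <= e) ->
  exists E : CK, forall x (e : R), 0 < e -> exists2 a, D a &
    forall b, D b -> (a <= b)%O -> nrm (m E x - m b x) <= e.
Proof.
move=> D0 D01 Ddir Dcau.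
pose G : set_system CK := filter_from D (fun a => [set b | D b /\ (a <= b)%O]).
have FG : ProperFilter G.
  apply: filter_from_proper; last by move=> a Da; exists a; split.
  apply: filter_from_filter => // a b Da Db; have [c Dc [ac bc]] := Ddir a b Da Db.
  by exists c => // d [Dd cd]; split; split=> //; exact: le_trans cd.
have D1 a : D a -> forall t, nrm (a t : F^o) <= 1.
  by move=> Da t; have /andP[h0 h1] := D01 a Da t; rewrite nrm_le rc1 ger0_norm.
have lim x : exists y : X, forall e : R, 0 < e -> G [set a | nrm (y - m a x) < e].
  have GF : ProperFilter ((fun a => m a x) @ G) by exact: fmap_proper_filter.
  have : cauchy ((fun a => m a x) @ G).
    apply/cauchyP => e e0; have ee := ge0_rc (ltW e0).
    have re0 : 0 < re e / 2 by rewrite divr_gt0// -(ltr_rc k) rc0 -ee.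
    have [a Da ha] := Dcau x _ re0.
    exists (m a x); exists a => // b [Db ab] /=.
    rewrite -ball_normE /= ee -nrm_lt nrmC.
    by apply: le_lt_trans (ha b Db ab) _; lra.
  move=> /cauchy_cvg/cvg_ex[y yl]; exists y => e e0.
  by move/cvg_nrmP: yl => /(_ _ e0).
pose A x := sval (cid (lim x)).
have AE x (e : R) : 0 < e -> G [set a | nrm (A x - m a x) < e] by rewrite /A; case: cid => y h; exact: h.
have linA : linear A.
  move=> z x y; apply/eqP; rewrite -subr_eq0; apply/eqP/nrm_small => e e0.
  have z0 : 0 < nrm (z : F^o) + 1 by rewrite ltr_wpDl// nrm_ge0.
  have e3 : 0 < e / (nrm (z : F^o) + 1) / 3 by rewrite !divr_gt0.
  have e3' : 0 < e / 3 by lra.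
  have [a [[h1 h2] h3]] := filter_ex (filterI (filterI (AE x _ e3) (AE y _ e3')) (AE (z *: x + y) _ e3')).
  rewrite /= in h1 h2 h3.
  have -> : A (z *: x + y) - (z *: A x + A y) = (A (z *: x + y) - m a (z *: x + y)) -
     (z *: (A x - m a x) + (A y - m a y)).
    by rewrite bopD bopZ scalerBr [X in _ = _ - X]addrACA -opprD opprB addrA subrK.
  have h4 := nrmB (A (z *: x + y) - m a (z *: x + y)) (z *: (A x - m a x) + (A y - m a y)).
  have h5 := nrmD (z *: (A x - m a x)) (A y - m a y).
  rewrite nrmZ in h5.
  have : nrm (z : F^o) * nrm (A x - m a x) <= e / 3.
    have h : (nrm (z : F^o) + 1) * nrm (A x - m a x) <= e / 3.
      rewrite mulrC -ler_pdivlMr//; apply: ltW; move: h1.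
      by rewrite mulrAC.
    by apply: le_trans h; rewrite ler_wpM2r ?nrm_ge0// lerDl.
  by lra.
have bA x : nrm (A x) <= modC * nrm x.
  apply/ler_addgt0Pr => e e0; have [a h [Da _]] : exists2 a, nrm (A x - m a x) < e & D a /\ True.
    have [a Da] := D0; have [b [h1 h2]] := filter_ex (filterI (AE x _ e0)
       (ex_intro2 _ _ a Da (fun b h => h) : G [set b | D b /\ (a <= b)%O])).
    by exists b => //; case: h2.
  have := nrmD (A x - m a x) (m a x); rewrite subrK.
  by have := @mod_le1 a x (D1 a Da); lra.
pose B : bop X X := mkbop A.
have BE : B = A :> (X -> X) by exact: mkbopE linA bA.
have cB : (m : CK -> wot X) @ G --> (B : wot X).
  apply/initial_cvgP.
  apply/ptws_cvgP => -[x f] /=.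
  apply: (@cvg_comp _ _ _ (fun a => m a x) f G (nbhs (B x)) (nbhs (f (B x)))).
    by apply/cvg_nrmP => e e0; rewrite BE; exact: AE.
  exact: bop_cts.
have : range m B.
  apply: (@closed_cvg _ (wot X) G _ m (range m) mcl _ B cB).
  by apply: filterE => a; exists a.
move=> [E _ EB]; exists E => x e e0; have [a Da h] := AE x e e0.
by exists a => // b Db ab; rewrite EB BE ltW// h.
Qed.

(** One [A] serves all [b]. In applications a net increasing to U swallows the compact set A, and
    what is left of the net is such a b. *)
Definition bop_normal U := forall x (e : R), 0 < e ->
  exists A, [/\ clopen A, A `<=` U & forall b, (forall t, nrm (b t : F^o) <= 1) ->
    (forall t, A t -> b t = 0) -> (forall t, ~ closure U t -> b t = 0) ->
    nrm (m b x) <= e].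

Lemma mod_eq0 a : (forall x (e : R), 0 < e -> nrm (m a x) <= e) -> a = 0.
Proof.
move=> h; apply: minj; apply: bop_eq => x; rewrite mod0.
by apply: nrm_small => e; exact: h.
Qed.

(** The strong limit E of D turns out to be 1 on U and 0 off the closure of U. By continuity the
    closure of U is then {E = 1}, a clopen set. *)
Lemma directed_cover U (D : set CK) : open U ->
  D !=set0 -> (forall a, D a -> forall t, 0 <= a t <= 1) ->
  (forall a b, D a -> D b -> exists2 c, D c & (a <= c)%O /\ (b <= c)%O) ->
  (forall x (e : R), 0 < e -> exists2 a, D a &
    forall b, D b -> (a <= b)%O -> nrm (m b x - m a x) <= e) ->
  (forall a, D a -> forall t, ~ U t -> a t = 0) ->
  (forall t, U t -> exists2 a, D a & a t = 1) ->
  [/\ clopen (closure U) & forall x (e : R), 0 < e -> exists2 a, D a &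
      nrm (m (ind R k (closure U) - a) x) <= e].
Proof.
move=> oU D0 D01 Ddir Dcau Dvan Dcov.
have [E hE] := directed_limit D0 D01 Ddir Dcau.
have M0 := modC_gt0.
(* Injectivity of [m] turns strong convergence into local information. If E stayed away from all
   later members of D by e on W, a bump b supported in W would satisfy |b| <= |E - a| / e, hence act
   as 0. *)
have key (t0 : K) a0 (e : R) (W : set K) : D a0 -> 0 < e -> nbhs t0 W ->
    (forall a s, D a -> (a0 <= a)%O -> W s -> e <= nrm (E s - a s : F^o)) -> False.
  move=> Da0 e0 t0W h; have [b [b1 b01 bW]] := urysohn_bump t0W.
  suff b0 : b = 0 by move: b1; rewrite b0 cfun0 => /esym/eqP; rewrite oner_eq0.
  apply: mod_eq0 => x d d0.
  have de0 : 0 < d * e / modC by rewrite divr_gt0// mulr_gt0.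
  have [a1 Da1 ha1] := hE x _ de0; have [a Da [a0a a1a]] := Ddir _ _ Da0 Da1.
  have := @mod_dom b ((rc k e^-1) *: (E - a)) x.
  rewrite modZ nrmZ nrm_rc gtr0_norm ?invr_gt0// modB => hd.
  have {hd} : nrm (m b x) <= modC * (e^-1 * nrm (m E x - m a x)).
    apply: hd => s; rewrite cfunZ nrmM nrm_rc gtr0_norm ?invr_gt0//.
    have [Ws|/bW->] := pselect (W s); last by rewrite nrm0 mulr_ge0 ?nrm_ge0// invr_ge0 ltW.
    have := h a s Da a0a Ws; rewrite -(ler_pM2l (_ : 0 < e^-1)) ?invr_gt0// mulVf ?gt_eqF//.
    apply: le_trans; have /andP[? ?] := b01 s.
    by rewrite nrm_le rc1 ger0_norm.
  move=> /le_trans; apply; have := ha1 a Da a1a.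
  rewrite ler_pdivlMr// => hh.
  by rewrite mulrCA mulrC ler_pdivrMr// mulrC.
have E1 t : U t -> E t = 1.
  move=> Ut; apply/eqP/contraT => Et; exfalso.
  have [a0 Da0 a0t] := Dcov t Ut.
  pose e := nrm (E t - 1 : F^o); have e0 : 0 < e by rewrite nrm_gt0 subr_eq0.
  have e4 : 0 < e / 4 by lra.
  have /cts_nrmP/(_ t _ e4) cE := cfun_cts E; have /cts_nrmP/(_ t _ e4) ca := cfun_cts a0.
  apply: (@key t a0 (e / 4) _ Da0 e4 (filterI cE ca)) => a s Da a0a [/= hs1 hs2].
  have : nrm (1 - a s : F^o) <= nrm (1 - a0 s : F^o).
    have /andP[_ as1] := D01 a Da s; have /andP[_ a0s1] := D01 a0 Da0 s.
    have /cfun_leP/(_ s) h := a0a.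
    rewrite nrm_le -(nrmE (1 - a0 s : F^o)) !ger0_norm ?subr_ge0//.
    by rewrite lerD2l lerN2.
  have := nrm_tri (E s : F^o) (E t : F^o) 1; have := nrm_tri (a s : F^o) (E s : F^o) 1.
  rewrite -/e a0t in hs2 *; rewrite (nrmC (a s : F^o) 1); lra.
have E0 t : ~ closure U t -> E t = 0.
  move=> Ut; apply/eqP/contraT => Et; exfalso.
  have [a0 Da0] := D0.
  pose e := nrm (E t : F^o); have e0 : 0 < e by rewrite nrm_gt0.
  have e4 : 0 < e / 4 by lra.
  have /cts_nrmP/(_ t _ e4) cE := cfun_cts E.
  have oc : nbhs t (~` closure U) by apply: open_nbhs_nbhs; split => //; exact/closed_openC/closed_closure.
  apply: (@key t a0 (e / 4) _ Da0 e4 (filterI cE oc)) => a s Da a0a [/= hs1 hs2].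
  rewrite (Dvan a Da) ?subr0; last by move=> Us; apply: hs2; exact: subset_closure.
  by have := nrm_sub (E t : F^o) (E s : F^o); rewrite -/e; lra.
have E1' t : closure U t -> E t = 1.
  move=> cUt; apply/eqP; rewrite -subr_eq0; apply/eqP/(@nrm_small R k F^o) => e e0.
  have /cts_nrmP/(_ t _ e0)/cUt[s [Us]] := cfun_cts E.
  by rewrite (E1 s Us) => /ltW.
have clE : clopen (closure U).
  rewrite (_ : closure U = [set t | E t = 1]).
    apply: idem_clopen; apply: cfun_eq => t; rewrite cfunM.
    by have [/E1'->|/E0->] := pselect (closure U t); rewrite ?mulr1 ?mulr0.
  apply/seteqP; split=> t /=; first exact: E1'.
  by move=> Et; apply: contrapT => /E0; rewrite Et => /eqP; rewrite oner_eq0.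
split=> // x e e0; have [a Da ha] := hE x e e0; exists a => //.
rewrite (_ : ind R k _ = E) ?modB ?ha//.
apply: cfun_eq => t; have [cUt|cUt] := pselect (closure U t).
  by rewrite ind_in// E1'.
by rewrite ind_out// E0.
Qed.

(** The clopen set wanted is the closure of {|a| > 1/2} for an a in D close to the limit. On the
    rest of the closure of U, |1 - a| >= 1/2, so that |b| <= 2 |1 - a| there and [mod_dom]
    applies. *)
Lemma cover_normal U (D : set CK) : stonian K -> open U ->
  (forall a, D a -> forall t, 0 <= a t <= 1) ->
  (forall a, D a -> forall t, ~ U t -> a t = 0) ->
  (forall x (e : R), 0 < e -> exists2 a, D a & nrm (m (ind R k (closure U) - a) x) <= e) ->
  bop_normal U.
Proof.
move=> [_ _ ed] oU D01 Dvan h x e e0.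
have clU : clopen (closure U) by split; [exact: ed|exact: closed_closure].
have M0 := modC_gt0.
have d0 : 0 < e / (2 * modC) by rewrite divr_gt0// mulr_gt0.
have [a Da ha] := h x _ d0.
pose V := [set t | 2^-1 < nrm (a t : F^o)].
have hc (c : R) : open [set t | c < nrm (a t : F^o)].
  rewrite openE => t /= ct; pose d := nrm (a t : F^o) - c.
  have d0' : 0 < d by rewrite subr_gt0.
  have /cts_nrmP/(_ t _ d0') := cfun_cts a; apply: filterS => s /=.
  by have := nrm_sub (a t : F^o) (a s : F^o); rewrite /d; lra.
have ge2 t : closure V t -> 2^-1 <= nrm (a t : F^o).
  move=> cVt; rewrite leNgt; apply/negP => at2.
  pose d := 2^-1 - nrm (a t : F^o); have d0' : 0 < d by rewrite subr_gt0.
  have /cts_nrmP/(_ t _ d0')/cVt[s []] := cfun_cts a; rewrite /V /d /=.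
  by have := nrm_sub (a s : F^o) (a t : F^o); rewrite (nrmC (a s : F^o)); lra.
exists (closure V); split; first by split; [apply: ed; exact: hc|exact: closed_closure].
  move=> t /ge2 h2; apply: contrapT => /(Dvan a Da) at0.
  by move: h2; rewrite at0 nrm0; lra.
move=> b b1 bV bU.
have := @mod_dom b (rc k 2 *: (ind R k (closure U) - a)) x.
rewrite modZ nrmZ nrm_rc gtr0_norm// => hd.
have {hd} : nrm (m b x) <= modC * (2 * nrm (m (ind R k (closure U) - a) x)).
  apply: hd => t; rewrite cfunZ nrmM nrm_rc gtr0_norm//.
  have [cUt|/bU->] := pselect (closure U t); last first.
    by rewrite nrm0 mulr_ge0 ?nrm_ge0.
  have [/bV->|Vt] := pselect (closure V t).
    by rewrite nrm0 mulr_ge0 ?nrm_ge0.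
  have at2 : nrm (a t : F^o) <= 2^-1.
    by rewrite leNgt; apply/negP => ?; apply: Vt; exact: subset_closure.
  rewrite cfunB ind_in//; have := nrm_sub (1 : F^o) (a t : F^o); rewrite nrm1.
  by have := b1 t; lra.
move=> /le_trans; apply.
move: ha; rewrite ler_pdivlMr ?mulr_gt0//; lra.
Qed.
End Module.

(** * Veksler modules without bounded sequences *)

Section Limits.
Context (R : realType) (k : scalar_kind).
Local Notation F := (scalars R k).

Lemma cvg_nrm_le (G : set_system F^o) (l z : F) (C : R) : ProperFilter G ->
  G --> (l : F^o) -> G [set w : F^o | nrm (w - z : F^o) <= C] -> nrm (l - z : F^o) <= C.
Proof.
move=> PG /cvg_nrmP Gl GC; apply/ler_addgt0Pr => e e0.
have [w [h1 h2]] := filter_ex (filterI (Gl _ e0) GC).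
by rewrite /= in h1 h2; have := nrm_tri (w : F^o) (l : F^o) z; lra.
Qed.

(** A finer ultrafilter converges, and the Cauchy condition makes its limit a limit of G. *)
Lemma scalar_cauchy (G : set_system F^o) : ProperFilter G ->
  (forall e : R, 0 < e -> exists z : F, G [set w : F^o | nrm (w - z : F^o) <= e]) ->
  exists l : F^o, G --> l.
Proof.
move=> PG h; have [H [UH GH]] := ultraFilterLemma PG.
have [z0 hz0] := h 1 ltr01.
have [|l Hl] := @ultra_bounded_cvg R k H (1 + nrm (z0 : F^o)) UH.
  apply: GH; apply: filterS hz0 => w /=.
  by have := nrm_sub (w : F^o) (z0 : F^o); lra.
exists l; apply/cvg_nrmP => e e0.
have e3 : 0 < e / 3 by lra.
have [z hz] := h _ e3.
have hl : nrm (l - z : F^o) <= e / 3.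
  by apply: cvg_nrm_le Hl (GH _ hz).
apply: filterS hz => w /=; have := nrm_tri (z : F^o) (l : F^o) w.
by rewrite (nrmC (z : F^o) w); lra.
Qed.
End Limits.

Section Extension.
Context (R : realType) (k : scalar_kind) (K : topologicalType).
Local Notation F := (scalars R k).
Local Notation CK := (cfun K F).

(** The value at a point t of the closure is a limit of [a] along an ultrafilter finer than the
    trace on U of the neighbourhoods of t. Continuity comes from the open closures of the sets {|a -
    b t| < r}, on which b differs from b t by at most r. Openness is asked of these closures alone,
    so that the lemma serves before K is known to be Stonian. *)
Lemma cts_extend (U : set K) (a : K -> F) (C : R) : 0 <= C -> open U ->
  (forall t, U t -> nrm (a t : F^o) <= C) ->
  (forall t, U t -> forall e : R, 0 < e -> \forall s \near t, nrm (a t - a s : F^o) < e) ->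
  open (closure U) ->
  (forall (z : F) (r : R), open (closure [set u | U u /\ nrm (a u - z : F^o) < r])) ->
  exists b : CK, [/\ forall t, U t -> b t = a t, forall t, ~ closure U t -> b t = 0
    & forall t, nrm (b t : F^o) <= C].
Proof.
move=> C0 oU aC aU oclU oV.
pose V (z : F) (r : R) := [set u | U u /\ nrm (a u - z : F^o) < r].
have Vle z r u : closure (V z r) u -> U u -> nrm (a u - z : F^o) <= r.
  move=> cVu Uu; apply/ler_addgt0Pr => e e0.
  have [s [[Us hs] hs2]] := cVu _ (aU u Uu e e0).
  by rewrite /= in hs2; have := nrm_tri (a s : F^o) (a u : F^o) z; lra.
have lim t : closure U t -> exists l : F, nrm (l : F^o) <= C /\
    forall r : R, 0 < r -> closure (V l r) t.
  move=> cUt; pose G := within U (nbhs t).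
  have PG : ProperFilter G.
    apply: Build_ProperFilter_ex => B /cUt[s [Us Bs]]; exists s; exact: Bs.
  have [H [UH GH]] := ultraFilterLemma PG.
  have PH : ProperFilter H by exact: ultra_proper.
  have UH' : UltraFilter ((a : K -> F^o) @ H) by exact: fmap_ultra.
  have HU : H U by apply: GH; rewrite /G /within /=; exact: nearW.
  have [|l Hl] := @ultra_bounded_cvg R k _ C UH'.
    by change (H [set s | nrm (a s : F^o) <= C]); exact: filterS HU.
  exists l; split.
    have := @cvg_nrm_le R k _ l 0 C _ Hl; rewrite subr0; apply.
    change (H [set s | nrm (a s - 0 : F^o) <= C]).
    by apply: filterS HU => s Us /=; rewrite subr0; exact: aC.
  move=> r r0 B tB.
  have HB : H B by apply: GH; rewrite /G /within /=; near=> s => _; near: s.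
  move/cvg_nrmP: Hl => /(_ _ r0) Hr.
  have {}Hr : H [set s | nrm (l - a s : F^o) < r] by [].
  have [s [[Us Bs] hs]] := filter_ex (filterI (filterI HU HB) Hr).
  by exists s; split=> //; split=> //; rewrite nrmC.
pose b t : F := if pselect (closure U t) is left ct then sval (cid (lim t ct)) else 0.
have bcl t : closure U t -> nrm (b t : F^o) <= C /\
    forall r : R, 0 < r -> closure (V (b t) r) t.
  by rewrite /b; case: pselect => // ct _; case: cid.
have bout t : ~ closure U t -> b t = 0 by rewrite /b; case: pselect.
have bnear t s (r : R) : closure U t -> 0 < r -> closure U s ->
    closure (V (b t) r) s -> nrm (b t - b s : F^o) <= r.
  move=> ct r0 cs cVs; apply/ler_addgt0Pr => e e0.
  have [_ /(_ _ e0) cse] := bcl s cs.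
  have [u [[Uu hu] hu2]] := cse _ (open_nbhs_nbhs (conj (oV _ _) cVs)).
  have := Vle _ _ _ hu2 Uu; have := nrm_tri (a u : F^o) (b t) (b s).
  by rewrite (nrmC (b t : F^o) (a u)); lra.
have cb : continuous (b : K -> F^o).
  apply/cts_nrmP => t e e0; have e2 : 0 < e / 2 by lra.
  have [ct|ct] := pselect (closure U t).
    have [_ /(_ _ e2) cVt] := bcl t ct.
    have n1 := open_nbhs_nbhs (conj (oV _ _) cVt).
    have n2 := open_nbhs_nbhs (conj oclU ct).
    apply: filterS2 n1 n2 => s h1 h2.
    by have := bnear t s _ ct e2 h2 h1; lra.
  have oc : open (~` closure U) by apply/closed_openC/closed_closure.
  apply: filterS (open_nbhs_nbhs (conj oc ct)) => s cs.
  by rewrite !bout// subrr nrm0.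
exists (cf b); rewrite cfE//; split=> // t.
  move=> Ut; apply/eqP; rewrite eq_sym -subr_eq0; apply/eqP/(@nrm_small R k F^o) => e e0.
  have cUt : closure U t by exact: subset_closure.
  by have [_ /(_ _ e0) /Vle] := bcl t cUt; apply.
have [ct|ct] := pselect (closure U t); first by have [] := bcl t ct.
by rewrite bout// nrm0.
Unshelve. all: by end_near.
Qed.

Lemma cfun_eq_closure (U : set K) (a b : CK) : (forall t, U t -> a t = b t) ->
  forall t, closure U t -> a t = b t.
Proof.
move=> ab t cUt; apply/eqP; rewrite -subr_eq0; apply/eqP/(@nrm_small R k F^o) => e e0.
have /cts_nrmP/(_ t _ e0)/cUt[s [Us /=]] := cfun_cts (a - b).
change (nrm ((a t - b t) - (a s - b s) : F^o) < e -> nrm (a t - b t : F^o) <= e).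
by rewrite (ab s Us) subrr subr0 => /ltW.
Qed.
End Extension.

Section Linfty.
Context (R : realType) (k : scalar_kind).
Local Notation F := (scalars R k).
Local Notation linf := (linfty R k).

Lemma linfty_ub (s : linf) n : nrm (s n : F^o) <= nrm s.
Proof. by rewrite nrm_le -nrmE; exact: supnorm_linfty_ge. Qed.
Lemma linfty_le (s : linf) (r : R) : (forall n, nrm (s n : F^o) <= r) -> nrm s <= r.
Proof.
by move=> h; rewrite nrm_le; apply: supnorm_linfty_le => n; rewrite -(nrm_le (s n : F^o)).
Qed.
Definition mklinf (s : nat -> F) : linf :=
  if pselect ((s : nat -> F^o) \in @bddseq R k) is left h then Linfty h else 0.
Lemma mklinfE s (C : R) : (forall n, nrm (s n : F^o) <= C) -> mklinf s = s :> (nat -> F).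
Proof.
move=> sC; rewrite /mklinf; case: pselect => // -[]; rewrite inE /=.
by exists (rc k C) => _ [n _ <-]; rewrite -(nrm_le (s n : F^o)).
Qed.

(** An operator bounded below has a continuous inverse on its range. The range is closed: preimages
    of a convergent sequence are Cauchy, and their coordinatewise limit is bounded and a limit in
    norm. *)
Lemma contains_linftyP (X : normedModType F) (E : set X) (T : bop linf X) (c : R) :
  0 < c -> (forall s, nrm s <= c * nrm (T s)) -> range T `<=` E -> contains_linfty E.
Proof.
move=> c0 Tc TE.
have Tinj : injective T.
  move=> s s' ss; apply/eqP; rewrite -subr_eq0; apply/eqP/nrm0_eq0/eqP.
  by rewrite eq_le nrm_ge0 andbT; apply: le_trans (Tc _) _; rewrite bopB ss subrr nrm0 mulr0.
pose S v : linf := xget 0 [set s | T s = v].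
have TK : cancel T S.
  by move=> s; apply: Tinj; rewrite /S; case: xgetP => [s' _ ->//|/(_ s)]; case.
exists T, S; split=> //; split=> //; first exact: bop_linear.
- exact: bop_cts.
- rewrite (_ : range T = closure (range T)); first exact: closed_closure.
  apply/seteqP; split; first exact: subset_closure.
  move=> v /closure_nrmP cv.
  have h n : exists s, nrm (v - T s) < n.+1%:R^-1.
    by have [_ [s _ <-] hs] := cv n.+1%:R^-1 ltac:(by rewrite invr_gt0); exists s.
  pose u n := sval (cid (h n)); have uE n : nrm (v - T (u n)) < n.+1%:R^-1.
    by rewrite /u; case: cid.
  have small (e : R) : 0 < e -> exists N, forall n, (N <= n)%N -> n.+1%:R^-1 <= e.
    move=> e0; have e0' : 0 < e^-1 by rewrite invr_gt0.
    have [N hN] := ex_intro (fun n => e^-1 < n%:R) _ (archi_boundP (ltW e0')).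
    exists N => n Nn; rewrite -[leRHS]invrK lef_pV2 ?posrE//.
    by apply/ltW/(lt_le_trans hN); rewrite ler_nat leqW.
  have cau (e : R) : 0 < e -> exists N, forall n p, (N <= n)%N -> (N <= p)%N ->
      nrm (u n - u p) <= e.
    move=> e0; have e2 : 0 < e / c / 2 by rewrite !divr_gt0.
    have [N hN] := small _ e2; exists N => n p Nn Np.
    apply: le_trans (Tc _) _; rewrite bopB -ler_pdivlMl// mulrC.
    have := nrm_tri v (T (u n)) (T (u p)); rewrite (nrmC (T (u n)) v).
    move: (uE n) (uE p) (hN n Nn) (hN p Np).
    by set q := n.+1%:R^-1; set q' := p.+1%:R^-1; lra.
  have lim j : exists l : F^o, (fun n => u n j : F^o) @ \oo --> l.
    apply: scalar_cauchy => e e0; have [N hN] := cau e e0.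
    exists (u N j); exists N => // n /= Nn.
    by apply: le_trans (linfty_ub (u n - u N) j) _; exact: hN.
  pose l j : F := sval (cid (lim j)).
  have lE j : (fun n => u n j : F^o) @ \oo --> (l j : F^o) by rewrite /l; case: cid.
  have ul (e : R) : 0 < e -> exists N, forall n j, (N <= n)%N ->
      nrm (l j - u n j : F^o) <= e.
    move=> e0; have [N hN] := cau e e0; exists N => n j Nn.
    apply: cvg_nrm_le (lE j) _; exists N => // p /= Np.
    by apply: le_trans (linfty_ub (u p - u n) j) _; exact: hN.
  have [N1 hN1] := ul 1 ltr01.
  have lC j : nrm (l j : F^o) <= 1 + nrm (u N1).
    have := hN1 N1 j (leqnn _); have := nrm_sub (l j : F^o) (u N1 j).
    by have := linfty_ub (u N1) j; lra.
  have lK := mklinfE lC.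
  exists (mklinf l) => //; apply/eqP; rewrite eq_sym -subr_eq0; apply/eqP/nrm_small => e e0.
  have q0 : 0 < e / 2 / (opn T + 1) by rewrite !divr_gt0// ltr_wpDl// opn_ge0.
  have e2 : 0 < e / 2 by lra.
  have [N hN] := ul _ q0; have [N' hN'] := small _ e2.
  pose n := maxn N N'.
  have h1 : nrm (mklinf l - u n) <= e / 2 / (opn T + 1).
    by apply: linfty_le => j; rewrite (_ : (mklinf l - u n) j = mklinf l j - u n j)// lK; apply: hN; exact: leq_maxl.
  have h0 := nrm_tri (T (u n)) v (T (mklinf l)).
  have := opn_ub T (u n - mklinf l); rewrite bopB (nrmC (u n)) => h2.
  have h3 := lt_le_trans (uE n) (hN' n (leq_maxr _ _)).
  have : opn T * nrm (mklinf l - u n) <= e / 2.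
    apply: le_trans (_ : (opn T + 1) * nrm (mklinf l - u n) <= _).
      by rewrite ler_wpM2r ?nrm_ge0// lerDl.
    by rewrite mulrC -ler_pdivlMr// ltr_wpDl// opn_ge0.
  lra.
- apply/subspace_continuousP => _ [s _ <-].
  apply/cvg_nrmP => e e0.
  have ec : 0 < e / c by rewrite divr_gt0.
  have : nbhs (T s) [set w | nrm (T s - w) < e / c] by apply/nbhs_nrmP; exists (e / c).
  apply: filterS => z hz [s' _ Es']; move: hz; rewrite /= -Es' -bopB ltr_pdivlMr// mulrC => h.
  change (nrm (S (T s) - S (T s')) < e); rewrite !TK.
  exact: le_lt_trans (Tc _) h.
Qed.
End Linfty.

Section Veksler.
Context (R : realType) (k : scalar_kind) (K : topologicalType).
Local Notation F := (scalars R k).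
Local Notation CK := (cfun K F).
Local Notation ind := (ind R k).
Context (X : completeNormedModType F) (m : CK -> bop X X).
Hypotheses (cK : compact [set: K]) (hK : hausdorff_space K).
Hypothesis mm : banach_module m.
Hypothesis zd : zero_dimensional K.
Hypothesis carr : forall x, x != 0 -> exists e, carrier_projection m x e.

Section Disjoint.
Context (c : nat -> set K) (x : X).
Hypothesis cc : forall n, clopen (c n).
Hypothesis cdis : forall i j t, c i t -> c j t -> i = j.
Hypothesis cmin : forall n A, clopen A -> m (ind A) (m (ind (c n)) x) = m (ind (c n)) x -> c n `<=` A.

(** A sequence read as a function on K: constant on each piece [c n] and 0 off their union. *)
Definition step_fun (s : nat -> F) (t : K) : F :=
  if pselect (exists n, c n t) is left h then s (sval (cid h)) else 0.
Lemma step_funE s n t : c n t -> step_fun s t = s n.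
Proof.
move=> ct; rewrite /step_fun; case: pselect => [h|[]]; last by exists n.
by case: cid => p /= pt; rewrite (cdis pt ct).
Qed.
Lemma step_fun_out s t : (forall n, ~ c n t) -> step_fun s t = 0.
Proof. by move=> h; rewrite /step_fun; case: pselect => // h'; exfalso; case: h' => n /h. Qed.

(** A point outside all pieces has a neighbourhood missing the first N of them; on the others the
    values are at most e / 2. *)
Lemma step_fun_cts s : (forall e : R, 0 < e -> exists N, forall n, (N <= n)%N -> nrm (s n : F^o) <= e) ->
  continuous (step_fun s : K -> F^o).
Proof.
move=> s0; apply/cts_nrmP => t e e0.
have [[n ct]|nc] := pselect (exists n, c n t).
  apply: filterS (open_nbhs_nbhs (conj (cc n).1 ct)) => u cu.
  by rewrite !(step_funE _ (n := n))// subrr nrm0.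
have e2 : 0 < e / 2 by lra.
have [N hN] := s0 _ e2.
have : \forall u \near t, forall n, (n < N)%N -> ~ c n u.
  elim: {hN} N => [|N IH]; first by near=> u.
  have oc : open (~` c N) by apply: closed_openC; case: (cc N).
  have tc : ~ c N t by move=> ?; apply: nc; exists N.
  apply: filterS2 IH (open_nbhs_nbhs (conj oc tc)) => u h1 h2 n.
  by rewrite ltnS leq_eqVlt => /orP[/eqP->|/h1].
apply: filterS => u hu; rewrite (step_fun_out _ (t := t)); last by move=> n ct; apply: nc; exists n.
rewrite sub0r nrmN; have [[n cu]|ncu] := pselect (exists n, c n u).
  rewrite (step_funE _ cu); apply: le_lt_trans (_ : e / 2 < e); last by lra.
  by apply: hN; rewrite leqNgt; apply/negP => /hu; apply.
by rewrite step_fun_out ?nrm0// => n cu; apply: ncu; exists n.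
Unshelve. all: by end_near.
Qed.

(* The closure is the carrier of [sum_(n in A) 2^-n c_n x]. *)
Lemma open_closure_step (A : set nat) : open (closure (\bigcup_(n in A) c n)).
Proof.
set V := \bigcup_(n in A) c n.
pose s n : F := if pselect (A n) is left _ then rc k (2^-1 ^+ n) else 0.
have cs : continuous (step_fun s : K -> F^o).
  apply: step_fun_cts => e e0.
  have /cvgrPdist_le/(_ _ e0)[N _ hN] : (fun n => 2^-1 ^+ n : R) @ \oo --> (0 : R).
    by apply: cvg_expr; rewrite ger0_norm; lra.
  exists N => n Nn; rewrite /s; case: pselect => _; last by rewrite nrm0 ltW.
  by have := hN n Nn; rewrite sub0r normrN nrm_rc.
pose a : CK := cf (step_fun s : K -> F^o).
have aE t : a t = step_fun s t by rewrite /a cfE.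
have sA n : A n -> s n != 0.
  by rewrite /s; case: pselect => // _ _; rewrite rc_neq0// expf_neq0// invr_neq0.
have aV t : ~ V t -> a t = 0.
  move=> Vt; rewrite aE; have [[n cu]|ncu] := pselect (exists n, c n t).
    rewrite (step_funE _ cu) /s; case: pselect => // An.
    by exfalso; apply: Vt; exists n.
  by rewrite step_fun_out// => n cu; apply: ncu; exists n.
have ca n : ind (c n) * a = s n *: ind (c n).
  apply: cfun_eq => t; rewrite cfunM cfunZ aE.
  have [ct|ct] := pselect (c n t); first by rewrite ind_in// (step_funE _ ct) mul1r mulr1.
  by rewrite ind_out// mul0r mulr0.
pose y := m a x.
have [y0|y0] := eqVneq y 0.
  rewrite (_ : V = set0); first by rewrite closure0; exact: open0.
  apply/seteqP; split=> // t [n An cnt].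
  have : m (ind (c n)) y = 0 by rewrite y0 bop0.
  rewrite -modM// ca modZ// => /eqP; rewrite scaler_eq0 (negbTE (sA n An)) /= => /eqP h.
  by apply: (cmin (n := n) clopen0 _ cnt); rewrite h bop0.
have [e [ie ey emin]] := carr y0.
pose E := [set t | e t = 1]; have cE : clopen E by exact: idem_clopen.
have eE : e = ind E by exact: idem_ind.
(* Since e fixes y and c_n a = s_n c_n with s_n nonzero, e fixes c_n x; minimality of c_n then gives
   the inclusion. *)
have VE : V `<=` E.
  move=> t [n An ct]; apply: (cmin cE _ ct).
  have : m (ind (c n)) (m e y) = m (ind (c n)) y by rewrite ey.
  rewrite -eE /y -(modM mm e a) -(modM mm _ (e * a)) -(modM mm _ a) -(modM mm e) mulrA [ind (c n) * e]mulrC -[e * _ * a]mulrA ca.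
  by rewrite !modM// !modZ// bopZ => /(scalerI (sA n An)).
suff -> : closure V = E by case: cE.
apply/seteqP; split.
  have /closure_id -> : closed E by case: cE.
  exact: closureS.
move=> t Et; apply: contrapT => cVt.
have oW : open (E `&` ~` closure V).
  by apply: openI; [case: cE|exact/closed_openC/closed_closure].
have [g [cg gt gW]] := zd_basis cK hK zd (open_nbhs_nbhs (conj oW (conj Et cVt))).
have cEg : clopen (E `&` ~` g) by apply: clopenI => //; exact: clopenC.
(* As a vanishes off V, every clopen set containing V fixes y. Removing g from E would therefore
   give a smaller carrier. *)
have fixy : m (ind (E `&` ~` g)) y = y.
  rewrite /y -modM//; congr (m _ x); apply: cfun_eq => u; rewrite cfunM.
  have [Vu|/aV->] := pselect (V u); last by rewrite mulr0.
  rewrite ind_in ?mul1r//; split; first exact: VE.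
  by move=> /gW[_]; apply; exact: subset_closure.
have := emin _ (ind_idem R k cEg) fixy; rewrite eE => /(ind_le R k cE cEg)/(_ t Et) [_]; exact.
Unshelve. all: by end_near.
Qed.

(** The sequence s is sent to (b s) x, where b s extends the step function with values s. This map
    is bounded below because the projection of [c n] turns (b s) x into s n times a vector of norm
    at least d. *)
Lemma disjoint_linfty (d : R) : 0 < d -> (forall n, d <= nrm (m (ind (c n)) x)) ->
  contains_linfty (cyclic_subspace m x).
Proof.
move=> d0 dc.
pose U := \bigcup_n c n.
have oU : open U by apply: bigcup_open => n _; case: (cc n).
have ext (s : linfty R k) : exists b : CK, [/\ forall n t, c n t -> b t = s n,
    forall t, ~ closure U t -> b t = 0 & forall t, nrm (b t : F^o) <= nrm s].
  have [||||||b [b1 b2 b3]] := @cts_extend R k K U (step_fun s) (nrm s).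
  - exact: nrm_ge0.
  - exact: oU.
  - by move=> t [n _ ct]; rewrite (step_funE _ ct) linfty_ub.
  - move=> t [n _ ct] e e0; apply: filterS (open_nbhs_nbhs (conj (cc n).1 ct)) => u cu.
    by rewrite (step_funE _ ct) (step_funE _ cu) subrr nrm0.
  - exact: open_closure_step.
  - move=> z r; rewrite (_ : [set u | _] = \bigcup_(n in [set n | nrm (s n - z : F^o) < r]) c n).
      exact: open_closure_step.
    apply/seteqP; split=> u /=.
      by move=> [[n _ cu]]; rewrite (step_funE _ cu) => h; exists n.
    by move=> [n /= h cu]; rewrite (step_funE _ cu); split=> //; exists n.
  exists b; split=> // n t ct; rewrite b1; first by rewrite (step_funE _ ct).
  by exists n.
pose b s := sval (cid (ext s)).
have bP s : [/\ forall n t, c n t -> b s t = s n,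
    forall t, ~ closure U t -> b s t = 0 & forall t, nrm (b s t : F^o) <= nrm s].
  by rewrite /b; case: cid.
have bl (z : F) s s' : b (z *: s + s') = z *: b s + b s'.
  apply: cfun_eq => t; rewrite cfunD cfunZ.
  have [b1 b2 _] := bP s; have [b1' b2' _] := bP s'; have [b1'' b2'' _] := bP (z *: s + s').
  have [cUt|cUt] := pselect (closure U t); last first.
    by rewrite b2// b2'// b2''// mulr0 addr0.
  suff : (b (z *: s + s')) t = (z *: b s + b s') t by [].
  apply: cfun_eq_closure cUt => u [n _ cu].
  by rewrite cfunD cfunZ (b1 n)// (b1' n)// (b1'' n).
pose f s := m (b s) x.
have lf : linear f by move=> z s s'; rewrite /f bl modD// modZ.
have fb s : nrm (f s) <= (modC cK mm * nrm x) * nrm s.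
  have [_ _ h] := bP s; have := mod_le cK mm x (nrm_ge0 s) h.
  by rewrite -mulrA [nrm s * _]mulrC mulrA.
pose T : bop (linfty R k) X := mkbop f.
have TE : T = f :> (_ -> _) by exact: mkbopE lf fb.
have M0 := modC_gt0 cK mm.
apply: (@contains_linftyP R k X _ T (modC cK mm / d)).
- by rewrite divr_gt0.
- move=> s; apply: linfty_le => n; rewrite TE.
  have h : m (ind (c n)) (f s) = s n *: m (ind (c n)) x.
    rewrite /f -modM// -modZ//; congr (m _ x); apply: cfun_eq => t; rewrite cfunM cfunZ.
    have [ct|ct] := pselect (c n t); last by rewrite ind_out// mul0r mulr0.
    by rewrite ind_in// mul1r mulr1; have [h1 _ _] := bP s; rewrite (h1 n).
  have := mod_le1 cK mm (f s) (fun t => nrm_ind R k t (cc n)).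
  rewrite h nrmZ => h2.
  rewrite mulrAC ler_pdivlMr//; apply: le_trans h2.
  by rewrite ler_wpM2l ?nrm_ge0.
- move=> _ [s _ <-]; rewrite TE; apply: subset_closure; by exists (b s).
Qed.
End Disjoint.

Hypothesis nol : forall x, ~ contains_linfty (cyclic_subspace m x).

(** Each [c n] is shrunk to the carrier of its piece of x, which does not change the piece and
    provides the minimality that [disjoint_linfty] rests on. *)
Lemma disjoint_small (c : nat -> set K) x (d : R) : (forall n, clopen (c n)) ->
  (forall i j t, c i t -> c j t -> i = j) -> 0 < d ->
  (forall n, d <= nrm (m (ind (c n)) x)) -> False.
Proof.
move=> cc cdis d0 dc; apply: (nol (x := x)).
have nz n : m (ind (c n)) x != 0 by rewrite -nrm_gt0; exact: lt_le_trans (dc n).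
pose e n := sval (cid (carr (nz n))).
have eP n : carrier_projection m (m (ind (c n)) x) (e n) by rewrite /e; case: cid.
pose E n := [set t | e n t = 1].
have cE n : clopen (E n) by have [ie _ _] := eP n; exact: idem_clopen.
have eE n : e n = ind (E n) by have [ie _ _] := eP n; exact: idem_ind.
have Ec n : E n `<=` c n.
  have [_ _ h] := eP n; have := h (ind (c n)) (ind_idem R k (cc n)).
  rewrite -modM// (ind_idem R k (cc n)) => /(_ erefl); rewrite eE.
  by move/(ind_le R k (cE n) (cc n)).
have Ex n : m (ind (E n)) x = m (ind (c n)) x.
  have [_ h _] := eP n; rewrite -[RHS]h eE -modM// ind_mul//.
  by rewrite (_ : E n `&` c n = E n)//; apply/setIidPl.
apply: (@disjoint_linfty E x cE _ _ d d0) => [i j t /Ec it /Ec jt|n A cA|n].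
- exact: cdis it jt.
- have [_ _ h] := eP n; rewrite Ex => /(h _ (ind_idem R k cA)).
  by rewrite eE => /(ind_le R k (cE n) cA).
- by rewrite Ex.
Qed.

(** Otherwise a clopen subset of U could be enlarged again and again, each time changing its piece
    of x by more than d; the successive differences are disjoint, against [disjoint_small]. *)
Lemma veksler_cauchy (U : set K) x (d : R) : 0 < d ->
  exists2 a, inside U a & forall b, inside U b -> (a <= b)%O -> nrm (m b x - m a x) <= d.
Proof.
move=> d0; apply: contrapT => h.
have next A : exists B, clopen A -> A `<=` U ->
    [/\ clopen B, B `<=` U, A `<=` B & d < nrm (m (ind B) x - m (ind A) x)].
  have [[cA AU]|nA] := pselect (clopen A /\ A `<=` U); last first.
    by exists A => cA AU; exfalso; apply: nA.
  apply: contrapT => nB; apply: h; exists (ind A); first by exists A.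
  move=> _ [B [cB BU] <-] /(ind_le R k cA cB) AB; rewrite leNgt; apply/negP => lt.
  by apply: nB; exists B.
pose f A := sval (cid (next A)).
have fP A : clopen A -> A `<=` U -> [/\ clopen (f A), f A `<=` U, A `<=` f A &
    d < nrm (m (ind (f A)) x - m (ind A) x)] by rewrite /f; case: cid.
pose E n := iter n f set0.
have EP n : clopen (E n) /\ E n `<=` U.
  elim: n => [|n [c1 c2]]; first by split; [exact: clopen0|].
  by have [] := fP _ c1 c2.
have ES n : E n `<=` E n.+1 by have [c1 c2] := EP n; have [] := fP _ c1 c2.
have Emono i j : (i <= j)%N -> E i `<=` E j.
  move=> /subnK <-; elim: (j - i)%N => // n IH; exact: subset_trans IH (ES _).
have cD n : clopen (E n.+1 `&` ~` E n).
  by apply: clopenI; [have [] := EP n.+1|apply: clopenC => //; have [] := EP n].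
apply: (@disjoint_small (fun n => E n.+1 `&` ~` E n) x d cD _ d0).
  move=> i j t [i1 i2] [j1 j2]; apply/eqP; rewrite eqn_leq; apply/andP; split.
    by rewrite leqNgt; apply/negP => ji; apply: i2; exact: (Emono j.+1).
  by rewrite leqNgt; apply/negP => ij; apply: j2; exact: (Emono i.+1).
move=> n; have [c1 c2] := EP n; have [c1' c2' _ hd] := fP _ c1 c2.
have -> : ind (E n.+1 `&` ~` E n) = ind (E n.+1) - ind (E n).
  have cC : clopen (~` E n) by exact: clopenC.
  rewrite -ind_mul// indC// mulrBr mulr1 ind_mul//.
  rewrite (_ : E n.+1 `&` E n = E n)//; apply/setIidPr; exact: ES.
by rewrite modB// ltW.
Qed.

Hypothesis minj : injective m.
Hypothesis mcl : closed (range m : set (wot X)).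

Lemma veksler_normal : stonian K /\ forall U, open U -> bop_normal m U.
Proof.
have cov U : open U -> [/\ clopen (closure U) & forall x (e : R), 0 < e ->
    exists2 a, inside U a & nrm (m (ind (closure U) - a) x) <= e].
  move=> oU; apply: (directed_cover cK hK mm minj mcl oU).
  - by exists (ind set0); exists set0 => //; split; [exact: clopen0|].
  - by move=> _ [A [cA AU] <-] t; exact: ind_01.
  - move=> _ _ [A [cA AU] <-] [B [cB BU] <-]; exists (ind (A `|` B)).
      exists (A `|` B) => //; split; first exact: clopenU.
      by move=> t [/AU|/BU].
    have cAB : clopen (A `|` B) by exact: clopenU.
    by split; [apply/(ind_le R k cA cAB) => t|apply/(ind_le R k cB cAB) => t]; [left|right].
  - by move=> x e e0; exact: veksler_cauchy.
  - by move=> _ [A [cA AU] <-] t Ut; rewrite ind_out// => /AU.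
  - move=> t Ut; have [A [cA At AU]] := zd_basis cK hK zd (open_nbhs_nbhs (conj oU Ut)).
    by exists (ind A); [exists A|rewrite ind_in].
have st : stonian K by split=> // U /cov[[]].
split=> // U oU; have [cl h] := cov U oU.
apply: (cover_normal cK mm st oU _ _ h).
- by move=> _ [A [cA AU] <-] t; exact: ind_01.
- by move=> _ [A [cA AU] <-] t Ut; rewrite ind_out// => /AU.
Qed.
End Veksler.

(** * Kaplansky modules and Bade completeness *)

Section Order.
Context (R : realType) (k : scalar_kind) (K : topologicalType).
Local Notation F := (scalars R k).
Local Notation CK := (cfun K F).

Lemma nrm_le_mono (z w : F) : 0 <= z -> z <= w -> nrm (z : F^o) <= nrm (w : F^o).
Proof.
by move=> z0 zw; rewrite nrm_le -nrmE !ger0_norm//; exact: le_trans zw.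
Qed.

Lemma ge0_closed_nrm (z : F) :
  (forall e : R, 0 < e -> exists2 w : F, 0 <= w & nrm (z - w : F^o) < e) -> 0 <= z.
Proof.
move=> h; rewrite ge0_re; apply/andP; split.
  apply/ler_addgt0Pr => e e0; have [w w0 zw] := h e e0.
  move: w0; rewrite ge0_re => /andP[w0 _].
  have := nrm_re (z - w); rewrite reB; have := ler_norm (re w - re z).
  by rewrite distrC; lra.
rewrite -normr_le0; apply/ler_addgt0Pr => e e0; have [w w0 zw] := h e e0.
move: w0; rewrite ge0_re => /andP[_ /eqP w0].
by have := nrm_im (z - w); rewrite imB w0 subr0; lra.
Qed.

Lemma cfun_ge0_closure (U : set K) (a : CK) : (forall t, U t -> 0 <= a t) ->
  forall t, closure U t -> 0 <= a t.
Proof.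
move=> h t cUt; apply: ge0_closed_nrm => e e0.
have /cts_nrmP/(_ t _ e0)/cUt[s [Us hs]] := cfun_cts a.
by exists (a s) => //; exact: h.
Qed.

Lemma open_cfun_neq0 (a : CK) : open [set t | a t != 0].
Proof.
rewrite openE => t /= at0.
have n0 : 0 < nrm (a t : F^o) by rewrite nrm_gt0.
have /cts_nrmP/(_ t _ n0) := cfun_cts a; apply: filterS => s /=.
by rewrite -(nrm_gt0 (a s : F^o)); have := nrm_sub (a t : F^o) (a s); lra.
Qed.

Lemma inside_01 (U : set K) (a : CK) : inside U a -> forall t, 0 <= a t <= 1.
Proof. by move=> [A [cA AU] <-] t; exact: ind_01. Qed.
Lemma inside_out (U : set K) (a : CK) : inside U a -> forall t, ~ U t -> a t = 0.
Proof. by move=> [A [cA AU] <-] t Ut; rewrite ind_out// => /AU. Qed.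

Lemma stonian_closure_clopen (U : set K) : stonian K -> open U -> clopen (closure U).
Proof. by move=> [_ _ ed] oU; split; [exact: ed|exact: closed_closure]. Qed.

Lemma closure_sub_closed (U E : set K) : closed E -> U `<=` E -> closure U `<=` E.
Proof. by move=> /closure_id {2}-> UE; exact: closureS. Qed.
End Order.

Lemma tails_filter (I : Type) (le : I -> I -> Prop) : directed le -> ProperFilter (tails le).
Proof.
move=> [[i0] refl trans ub]; apply: filter_from_proper; last by move=> i _; exists i; exact: refl.
apply: filter_from_filter; first by exists i0.
move=> i j _ _; have [l [il jl]] := ub i j; exists l => // p lp.
by split; [exact: trans lp|exact: trans lp].
Qed.

Section Kaplansky.
Context (R : realType) (k : scalar_kind) (K : topologicalType).
Local Notation F := (scalars R k).
Local Notation CK := (cfun K F).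
Local Notation ind := (ind R k).
Context (X : completeNormedModType F) (m : CK -> bop X X).
Hypotheses (cK : compact [set: K]) (hK : hausdorff_space K).
Hypothesis mm : banach_module m.
Hypothesis st : stonian K.

Lemma ind_setU (A B : set K) : clopen A -> clopen B ->
  ind (A `|` B) = ind A + ind B - ind A * ind B.
Proof.
move=> cA cB; have cAB : clopen (A `|` B) by exact: clopenU.
apply: cfun_eq => t; rewrite cfunB cfunD cfunM.
have [At|At] := pselect (A t).
  by rewrite (ind_in R k cA)// (ind_in R k cAB) ?mul1r ?addrK//; left.
rewrite (ind_out R k cA)// mul0r subr0 add0r; have [Bt|Bt] := pselect (B t).
  by rewrite (ind_in R k cB)// (ind_in R k cAB)//; right.
by rewrite (ind_out R k cB)// (ind_out R k cAB)// => -[].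
Qed.

(** The carrier has to be the complement of the closure of the union of all clopen sets annihilating
    x. The one thing to be checked is that this closure annihilates x too; Kaplansky's condition and
    weak-star continuity each do this for families closed under finite unions. *)
Lemma carrier_of_null x :
  (forall N : set (set K), (forall A, N A -> clopen A /\ m (ind A) x = 0) ->
    N set0 -> (forall A B, N A -> N B -> N (A `|` B)) ->
    m (ind (closure (\bigcup_(A in N) A))) x = 0) ->
  exists e, carrier_projection m x e.
Proof.
move=> h.
pose N := [set A | clopen A /\ m (ind A) x = 0].
pose U := \bigcup_(A in N) A.
have oU : open U by apply: bigcup_open => A [[]].
have cE := stonian_closure_clopen st oU.
have cE' : clopen (~` closure U) by exact: clopenC.
have Ex : m (ind (closure U)) x = 0.
  apply: h => [A []//||A B [cA Ax] [cB Bx]].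
    split; first exact: clopen0.
    rewrite (_ : ind set0 = 0) ?mod0//; apply: cfun_eq => t.
    by rewrite ind_out//; exact: clopen0.
  split; first exact: clopenU.
  by rewrite ind_setU// modB// modD// Ax Bx modM// Bx bop0 addr0 subr0.
exists (ind (~` closure U)); split.
- exact: ind_idem.
- by rewrite indC// modB// mod1// Ex subr0.
- move=> e' ie e'x; have cA := idem_clopen ie; rewrite (idem_ind ie).
  apply/ind_le => // t cUt /=; apply: contrapT => e't; apply: cUt.
  apply: subset_closure; exists (~` [set t | e' t = 1]) => //; split; first exact: clopenC.
  by rewrite indC// -(idem_ind ie) modB// mod1// e'x subrr.
Qed.

(** In C(K) the supremum of the characteristic functions of the members of N is the characteristic
    function of the closure of their union. *)
Lemma kaplansky_carrier x : kaplansky m -> exists e, carrier_projection m x e.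
Proof.
move=> [_ kap]; apply: carrier_of_null => N NP N0 NU.
set U := \bigcup_(A in N) A.
have oU : open U by apply: bigcup_open => A /NP[[]].
have cE := stonian_closure_clopen st oU.
have ubE : ubound [set ind A | A in N] (ind (closure U)).
  move=> _ [A NA <-]; have [cA _] := NP A NA; apply/ind_le => // t At.
  by apply: subset_closure; exists A.
apply: (kap x [set ind A | A in N]).
- move=> _ [A /NP[cA _] <-]; apply/cfun_leP => t.
  by have /andP[] := ind_01 R k t cA.
- by exists (ind (closure U)).
- split=> // b bub; apply/cfun_leP => t.
  have [cUt|cUt] := pselect (closure U t).
    rewrite ind_in// -subr_ge0; have := @cfun_ge0_closure R k K U (b - 1).
    apply=> // s [A NA As]; rewrite cfunB subr_ge0.
    have [cA _] := NP A NA.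
    by have /cfun_leP/(_ s) := bub _ (ex_intro2 _ _ A NA erefl); rewrite ind_in.
  rewrite ind_out//; have /cfun_leP/(_ t) := bub _ (ex_intro2 _ _ _ N0 erefl).
  by rewrite ind_out//; exact: clopen0.
- by move=> _ [A /NP[_ Ax] <-].
Qed.

Section Normal.
Hypothesis nm : forall U, open U -> bop_normal m U.

(** The supremum a vanishes off the closure of the union U of the supports of A. On a clopen B
    inside U, compactness yields a finite positive combination c of members of A with c x = 0 and c
    >= 1 on B, which dominates a there up to a factor. The part of a off B is small by normality. *)
Lemma normal_kaplansky : kaplansky m.
Proof.
split=> // x A a A0 _ [aub alb] Ax.
pose U := \bigcup_(b in A) [set t | b t != 0].
have oU : open U by apply: bigcup_open => b _; exact: open_cfun_neq0.
have cE := stonian_closure_clopen st oU.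
have a0 t : closure U t \/ a t = 0.
  have [cUt|cUt] := pselect (closure U t); [by left|right].
  have bU b : A b -> b t = 0.
    move=> Ab; apply/eqP/contraT => bt; exfalso; apply: cUt.
    by apply: subset_closure; exists b.
  (* For empty A, the function a - 1 would be an upper bound as well, so a would not be least. *)
  have [[b Ab]|nA] := pselect (A !=set0); last first.
    have : ubound A (a - 1) by move=> b Ab; exfalso; apply: nA; exists b.
    move/alb/cfun_leP/(_ t); rewrite cfunB cfun1.
    by rewrite -subr_ge0 addrAC subrr add0r oppr_ge0 => /(lt_le_trans ltr01); rewrite ltxx.
  have le1 : 0 <= a t by rewrite -(bU b Ab); have /cfun_leP := aub b Ab; exact.
  apply/eqP; rewrite eq_le le1 andbT.
  have /alb/cfun_leP/(_ t) : ubound A (a * ind (closure U)).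
    move=> c Ac; apply/cfun_leP => s; rewrite cfunM.
    have [cUs|cUs] := pselect (closure U s).
      by rewrite ind_in// mulr1; have /cfun_leP := aub c Ac; exact.
    rewrite ind_out// mulr0 (_ : c s = 0)//.
    by apply/eqP/contraT => cs; exfalso; apply: cUs; apply: subset_closure; exists c.
  by rewrite cfunM ind_out// mulr0.
have [C C0 aC] := cfun_bounded a cK.
have M0 := modC_gt0 cK mm.
apply: nrm_small => e e0.
have e0' : 0 < e / (C + 1) by rewrite divr_gt0// ltr_wpDl.
have [B [cB BU hB]] := nm oU x e0'.
have aB : m (a * ind B) x = 0.
  pose Q (S : set K) := exists c : CK, [/\ forall t, 0 <= c t, m c x = 0 &
    forall t, S t -> 1 <= nrm (c t : F^o)].
  have [c [c0 cx c1]] : Q B.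
    apply: (compact_ind (closed_compact cK cB.2)).
    - by exists 0; split=> //; rewrite ?mod0.
    - move=> B1 B2 [c1 [c10 c1x h1]] [c2 [c20 c2x h2]]; exists (c1 + c2); split.
      + by move=> t; rewrite cfunD addr_ge0.
      + by rewrite modD// c1x c2x addr0.
      + move=> t [/h1|/h2] /le_trans; apply; apply: nrm_le_mono => //.
          by rewrite cfunD lerDl.
        by rewrite cfunD lerDr.
    - by move=> B1 B2 BB [c [c0 cx h]]; exists c; split=> // t /BB/h.
    - move=> t /BU[b Ab /= bt].
      have n0 : 0 < nrm (b t : F^o) by rewrite nrm_gt0.
      have n2 : 0 < nrm (b t : F^o) / 2 by lra.
      exists [set s | nrm (b t - b s : F^o) < nrm (b t : F^o) / 2].
        by have /cts_nrmP := cfun_cts b; apply.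
      have i0 : 0 <= 2 / nrm (b t : F^o) by rewrite divr_ge0// ltW.
      exists (rc k (2 / nrm (b t : F^o)) *: b); split.
      + move=> s; rewrite cfunZ mulr_ge0 ?rc_ge0//.
        by have /cfun_leP := A0 b Ab; exact.
      + by rewrite modZ// Ax// scaler0.
      + move=> s /= bs; change (1 <= nrm (rc k (2 / nrm (b t : F^o)) * b s : F^o)).
        rewrite nrmM nrm_rc ger0_norm//.
        rewrite mulrAC ler_pdivlMr// mul1r.
        by have := nrm_sub (b t : F^o) (b s); lra.
  apply/nrm0_eq0/eqP; rewrite eq_le nrm_ge0 andbT.
  have := @mod_dom R k K X m cK mm (a * ind B) (rc k C *: c) x.
  rewrite modZ// cx scaler0 nrm0 mulr0; apply => t.
  rewrite cfunM cfunZ !nrmM nrm_rc ger0_norm//.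
  have [Bt|Bt] := pselect (B t); last first.
    by rewrite ind_out// nrm0 mulr0 mulr_ge0 ?nrm_ge0.
  rewrite ind_in// nrm1 mulr1; apply: le_trans (aC t) _.
  by rewrite ler_peMr// c1.
(* Division by C + 1 puts the remainder into the unit ball, also when C is 0. *)
have -> : m a x = m (a * ind B) x + rc k (C + 1) *: m (rc k (C + 1)^-1 *: (a * (1 - ind B))) x.
  rewrite modZ// scalerA -rcM mulfV ?gt_eqF ?ltr_wpDl// rc1 scale1r -modD//.
  by rewrite -mulrDr addrC subrK mulr1.
rewrite aB add0r nrmZ nrm_rc ger0_norm; last by rewrite addr_ge0.
rewrite mulrC -ler_pdivlMr ?ltr_wpDl//; apply: hB => t.
- rewrite cfunZ nrmM nrm_rc gtr0_norm ?invr_gt0 ?ltr_wpDl//.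
  rewrite mulrC ler_pdivrMr ?ltr_wpDl// mul1r cfunM nrmM.
  apply: le_trans (_ : C * 1 <= _); last by rewrite mulr1 lerDl.
  apply: ler_pM; rewrite ?nrm_ge0//.
  rewrite cfunB cfun1; have [Bt|Bt] := pselect (B t).
    by rewrite ind_in// subrr nrm0.
  by rewrite ind_out// subr0 nrm1.
- by move=> Bt; rewrite cfunZ cfunM cfunB ind_in// cfun1 subrr !mulr0.
- by move=> cUt; rewrite cfunZ cfunM; case: (a0 t) => // ->; rewrite mul0r mulr0.
Qed.

(** The supremum e is the characteristic function of the closure of the union of the sets E i. The
    compact set A given by normality lies in one E i, and for later j the function e - e_ j vanishes
    on A and off that closure. *)
Lemma normal_bade : bade_complete m.
Proof.
move=> I le e_ e dir ie emono iee e_e emin x.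
have FT := tails_filter dir.
pose E i := [set t | e_ i t = 1].
have cE i : clopen (E i) by exact: idem_clopen.
have eE i : e_ i = ind (E i) by exact: idem_ind.
pose U := \bigcup_i E i.
have oU : open U by apply: bigcup_open => i _; case: (cE i).
have cU := stonian_closure_clopen st oU.
have eU : e = ind (closure U).
  apply: le_anti; apply/andP; split.
    apply: emin => [|i]; first exact: ind_idem.
    rewrite eE; apply/ind_le => // t Et; apply: subset_closure; by exists i.
  rewrite (idem_ind iee); apply/ind_le => //; first exact: idem_clopen.
  apply: closure_sub_closed; first by case: (idem_clopen iee).
  move=> t [i _ Et].
  have /(ind_le R k (cE i) (idem_clopen iee)) : (ind (E i) <= ind [set t | e t = 1])%O.
    by rewrite -eE -(idem_ind iee).
  exact.
apply/cvg_nrmP => d d0; have d2 : 0 < d / 2 by lra.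
have [A [cA AU hA]] := nm oU x d2.
have [i Ai] : exists i, A `<=` E i.
  apply: (compact_ind (Q := fun S => exists i, S `<=` E i) (closed_compact cK cA.2)).
  - by case: dir => -[i0] _ _ _; exists i0.
  - move=> B C [i iB] [j jC]; have [l [il jl]] := directed_ub dir i j.
    have sub p : le p l -> E p `<=` E l.
      by move=> /emono; rewrite !eE => /ind_le; apply.
    by exists l => t [/iB/(sub _ il)|/jC/(sub _ jl)].
  - by move=> B C BC [i iC]; exists i; exact: subset_trans iC.
  - move=> t /AU[i _ Eit]; exists (E i); last by exists i.
    by apply: open_nbhs_nbhs; split => //; case: (cE i).
exists i => // j ij /=; rewrite sub0r nrmN /nrm normr_id -/(nrm _).
apply: le_lt_trans (_ : d / 2 < d); last by lra.
have ej : E i `<=` E j by have := emono _ _ ij; rewrite !eE => /ind_le; apply.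
apply: hA => t.
- rewrite eU eE cfunB; have [Et|Et] := pselect (E j t).
    rewrite (ind_in R k (cE j))// ind_in ?subrr ?nrm0//.
    by apply: subset_closure; exists j.
  by rewrite (ind_out R k (cE j))// subr0 nrm_ind.
- move=> At; rewrite eU eE cfunB !ind_in ?subrr//; first exact/ej/Ai.
  by apply: subset_closure; exact: AU.
- move=> cUt; rewrite eU eE cfunB !ind_out ?subrr//.
  by move=> Ejt; apply: cUt; apply: subset_closure; exists j.
Qed.
End Normal.

(** Bade completeness is applied to the clopen subsets of U, indexed by themselves and ordered by
    inclusion; since K is zero-dimensional, the closure of U represents their supremum. *)
Lemma bade_normal : bade_complete m -> forall U, open U -> bop_normal m U.
Proof.
move=> bc U oU; have zd := stonian_zd hK st.
have cU := stonian_closure_clopen st oU.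
pose I := {A : set K | clopen A /\ A `<=` U}.
pose mk A (h : clopen A /\ A `<=` U) : I := exist (fun A : set K => clopen A /\ A `<=` U) A h.
pose le (A B : I) := sval A `<=` sval B.
have dir : directed le.
  split.
  - by constructor; exists set0; split; [exact: clopen0|].
  - by move=> i t.
  - by move=> i j l ij jl t /ij/jl.
  - move=> [A [cA AU]] [B [cB BU]].
    have h : clopen (A `|` B) /\ A `|` B `<=` U.
      by split; [exact: clopenU|move=> t [/AU|/BU]].
    by exists (mk _ h); split=> t /=; [left|right].
refine (@cover_normal R k K X m cK mm U (inside (R:=R) (k:=k) U) st oU _ _ _).
- exact: inside_01.
- exact: inside_out.
- move=> x d d0.
  have h1 (i : I) : idempotents (ind (sval i)) by case: i => [A [cA AU]]; exact: ind_idem.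
  have h2 (i j : I) : le i j -> (ind (sval i) <= ind (sval j))%O.
    by move: i j => [A [cA AU]] [B [cB BU]] AB; apply/ind_le.
  have h3 (i : I) : (ind (sval i) <= ind (closure U))%O.
    by move: i => [A [cA AU]]; apply/ind_le => //= t /AU; exact: subset_closure.
  have h4 f : idempotents f -> (forall i : I, (ind (sval i) <= f)%O) -> (ind (closure U) <= f)%O.
    move=> jf fub; rewrite (idem_ind jf); apply/ind_le => //; first exact: idem_clopen.
    apply: closure_sub_closed; first by case: (idem_clopen jf).
    move=> t Ut; have [A [cA At AU]] := zd_basis cK hK zd (open_nbhs_nbhs (conj oU Ut)).
    have /(ind_le R k cA (idem_clopen jf)) : (ind A <= ind [set t | f t = 1])%O.
      by rewrite -(idem_ind jf); exact: (fub (mk A (conj cA AU))).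
    exact.
  have FT := tails_filter dir.
  have := bc I le (fun A => ind (sval A)) (ind (closure U)) dir h1 h2 (ind_idem R k cU) h3 h4 x.
  move=> /cvg_nrmP/(_ d d0)[[A [cA AU]] _ /(_ (mk A (conj cA AU)) (fun t h => h))].
    rewrite /= sub0r nrmN /nrm normr_id -/(nrm _) => /ltW h.
    by exists (ind A) => //; exists A.
Qed.
End Kaplansky.

(** * Order continuity of the cyclic norm *)

Section CMin.
Context (R : realType) (k : scalar_kind) (K : topologicalType).
Local Notation F := (scalars R k).
Local Notation CK := (cfun K F).
Implicit Types (p q a : CK).

Lemma min_lip (a b c d : R) : `|Num.min a b - Num.min c d| <= `|a - c| + `|b - d|.
Proof.
have := ler_norm (a - c); have := ler_norm (b - d); have := ler_norm (c - a); have := ler_norm (d - b).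
rewrite (distrC c a) (distrC d b) => h1 h2 h3 h4.
by rewrite ler_norml; case: (leP a b) => ?; case: (leP c d) => ?; apply/andP; split; lra.
Qed.

Definition cmin p q : CK := cf (fun t => rc k (Num.min (re (p t)) (re (q t)))).
Lemma cminE p q t : cmin p q t = rc k (Num.min (re (p t)) (re (q t))).
Proof.
rewrite /cmin cfE//; apply/cts_nrmP => s e e0; have e2 : 0 < e / 2 by lra.
have /cts_nrmP/(_ s _ e2) hp := cfun_cts p; have /cts_nrmP/(_ s _ e2) hq := cfun_cts q.
apply: filterS2 hp hq => u h1 h2; rewrite -rcB nrm_rc.
apply: le_lt_trans (min_lip _ _ _ _) _; rewrite -!reB.
by have := nrm_re (p s - p u); have := nrm_re (q s - q u); lra.
Qed.
Lemma cmin_lip p q p' q' t :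
  nrm (cmin p q t - cmin p' q' t : F^o) <= nrm ((cabs (p - p') + cabs (q - q')) t : F^o).
Proof.
rewrite !cminE cfunD !cabsE -rcB -rcD !nrm_rc [leRHS]ger0_norm ?addr_ge0 ?nrm_ge0//.
apply: le_trans (min_lip _ _ _ _) _; rewrite -!reB !cfunB.
by apply: lerD; exact: nrm_re.
Qed.
End CMin.

Section Cone.
Context (R : realType) (k : scalar_kind) (K : topologicalType).
Local Notation F := (scalars R k).
Local Notation CK := (cfun K F).
Context (X : completeNormedModType F) (m : CK -> bop X X).
Hypotheses (cK : compact [set: K]) (hK : hausdorff_space K).
Hypothesis mm : banach_module m.
Implicit Types (a b p q : CK) (u v w y z : X).

Lemma seq_complete (u : nat -> X) :
  (forall e : R, 0 < e -> exists N, forall n j : nat, (N <= n)%N -> (N <= j)%N -> nrm (u n - u j) <= e) ->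
  exists l, forall e : R, 0 < e -> exists N, forall n, (N <= n)%N -> nrm (l - u n) <= e.
Proof.
move=> h; have PF : ProperFilter (u @ \oo) by exact: fmap_proper_filter.
have : cauchy (u @ \oo).
  apply/cauchyP => e e0; have ee := ge0_rc (ltW e0).
  have re0 : 0 < re e / 2 by rewrite divr_gt0// -(ltr_rc k) rc0 -ee.
  have [N hN] := h _ re0; exists (u N); exists N => // n /= Nn.
  rewrite -ball_normE /= ee -nrm_lt; apply: le_lt_trans (hN _ _ (leqnn _) Nn) _; lra.
move=> /cauchy_cvg/cvg_ex[l ul]; exists l => e e0.
by move/cvg_nrmP: ul => /(_ _ e0)[N _ hN]; exists N => n /hN /ltW.
Qed.

Section FixX.
Context (x : X).
Local Notation cone := (cyclic_cone m x).
Local Notation cyc := (cyclic_subspace m x).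

Lemma coneP u : cone u <-> forall e : R, 0 < e -> exists2 a : CK, (forall t, 0 <= a t) & nrm (u - m a x) < e.
Proof.
split=> [/closure_nrmP h e e0|h].
  by have [_ [a /cfun_leP a0 <-] ua] := h e e0; exists a.
apply/closure_nrmP => e e0; have [a a0 ua] := h e e0.
by exists (m a x) => //; exists a => //=; apply/cfun_leP.
Qed.
Lemma cone_closed u : (forall e : R, 0 < e -> exists2 v, cone v & nrm (u - v) < e) -> cone u.
Proof.
move=> h; have /closure_id -> : closed cone by exact: closed_closure.
by apply/closure_nrmP.
Qed.
Lemma cone_mod a : (forall t, 0 <= a t) -> cone (m a x).
Proof. by move=> a0; apply/coneP => e e0; exists a => //; rewrite subrr nrm0. Qed.
Lemma cone0 : cone 0.
Proof. by rewrite -(mod0 mm x); apply: cone_mod => t; exact: lexx. Qed.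
Lemma coneD u v : cone u -> cone v -> cone (u + v).
Proof.
move=> /coneP hu /coneP hv; apply/coneP => e e0; have e2 : 0 < e / 2 by lra.
have [a a0 ua] := hu _ e2; have [b b0 vb] := hv _ e2.
exists (a + b); first by move=> t; rewrite cfunD addr_ge0.
rewrite modD// opprD addrACA; have := nrmD (u - m a x) (v - m b x); lra.
Qed.
Lemma coneZ (r : R) u : 0 <= r -> cone u -> cone (rc k r *: u).
Proof.
move=> r0 /coneP hu; apply/coneP => e e0.
have q0 : 0 < e / (r + 1) by rewrite divr_gt0// ltr_wpDl.
have [a a0 ua] := hu _ q0; exists (rc k r *: a).
  by move=> t; rewrite cfunZ mulr_ge0// rc_ge0.
rewrite modZ// -scalerBr nrmZ nrm_rc ger0_norm//.
move: ua; rewrite ltr_pdivlMr ?ltr_wpDl// => h; apply: le_lt_trans h.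
by rewrite mulrC ler_wpM2l ?nrm_ge0// lerDl.
Qed.
Lemma cycP u : cyc u <-> forall e : R, 0 < e -> exists a, nrm (u - m a x) < e.
Proof.
split=> [/closure_nrmP h e e0|h].
  by have [_ [a _ <-] ua] := h e e0; exists a.
apply/closure_nrmP => e e0; have [a ua] := h e e0.
by exists (m a x) => //; exists a.
Qed.
Lemma cone_cyc u : cone u -> cyc u.
Proof. by move=> /coneP h; apply/cycP => e /h[a _ ua]; exists a. Qed.
Lemma cyc_mod a : cyc (m a x).
Proof. by apply/cycP => e e0; exists a; rewrite subrr nrm0. Qed.
Lemma cycB u v : cyc u -> cyc v -> cyc (u - v).
Proof.
move=> /cycP hu /cycP hv; apply/cycP => e e0; have e2 : 0 < e / 2 by lra.
have [a ua] := hu _ e2; have [b vb] := hv _ e2.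
exists (a - b); rewrite modB// opprD addrACA -opprD.
have := nrmB (u - m a x) (v - m b x); lra.
Qed.

Lemma subACA (V : zmodType) (a b c d : V) : a - b - (c - d) = a - c - (b - d).
Proof. by rewrite !opprB addrACA [RHS]addrACA; congr (_ + _); rewrite addrC. Qed.

Lemma cyclic_norm_sup y :
  supremums [set `|m a y| | a in [set a : CK | supnorm (a : K -> F) <= 1]] (cyclic_norm m y).
Proof.
apply: scalars_fsup.
- exists `|m 0 y|, 0 => //=; rewrite (supnormE cK (0 : CK)) -(rc1 R k) ler_rc sn_le// => t.
  by rewrite cfun0 nrm0.
- by move=> _ [a _ <-].
- exists (rc k (modC cK mm * nrm y)) => _ [a /= a1 <-]; rewrite -nrm_le.
  apply: mod_le1 => t; apply: le_trans (sn_ub cK a t) _.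
  by rewrite -(ler_rc k) -supnormE// rc1.
Qed.
Lemma cyclic_norm_ge y : nrm y <= nrm (cyclic_norm m y : F^o).
Proof.
have [ub _] := cyclic_norm_sup y.
rewrite nrm_le -(nrmE (cyclic_norm m y : F^o)).
have h : `|y| <= cyclic_norm m y.
  apply: ub; exists 1; rewrite ?mod1//= (supnormE cK (1 : CK)) -(rc1 R k) ler_rc sn_le// => t.
  by rewrite cfun1 nrm1.
by rewrite ger0_norm//; exact: le_trans h.
Qed.
Lemma cyclic_norm_le y : nrm (cyclic_norm m y : F^o) <= modC cK mm * nrm y.
Proof.
have [ub lb] := cyclic_norm_sup y.
have c0 : 0 <= cyclic_norm m y.
  apply: le_trans (ub `|m 0 y| _) => //; exists 0 => //=.
  by rewrite (supnormE cK (0 : CK)) -(rc1 R k) ler_rc sn_le// => t; rewrite cfun0 nrm0.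
rewrite ge0_nrm// -(ler_rc k) -ge0_rc//; apply: lb => _ [a /= a1 <-]; rewrite -nrm_le.
apply: mod_le1 => t; apply: le_trans (sn_ub cK a t) _.
by rewrite -(ler_rc k) -supnormE// rc1.
Qed.

Lemma cabs_mod a : nrm (m (cabs a) x) <= modC cK mm * nrm (m a x).
Proof. by apply: mod_dom => t; rewrite cabsE nrm_rc ger0_norm ?nrm_ge0. Qed.

(** The infimum of z1 and z2: if p_n x tends to z1 and q_n x to z2, the vectors min(p_n, q_n) x
    converge, since the minimum is Lipschitz and [mod_dom] carries this over to vectors. It makes
    the upper bounds of D x a downward directed set. *)
Lemma cone_meet (D : set CK) z1 z2 : D !=set0 -> (forall a, D a -> forall t, 0 <= a t) ->
  (forall a, D a -> cone (z1 - m a x)) -> (forall a, D a -> cone (z2 - m a x)) ->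
  exists z3, [/\ cyc z3, cone (z1 - z3), cone (z2 - z3) & forall a, D a -> cone (z3 - m a x)].
Proof.
move=> [a1 Da1] D0 h1 h2; set M := modC cK mm; have M1 : 1 <= M := modC_ge1 cK mm.
have cz z : (forall a, D a -> cone (z - m a x)) -> cone z.
  by move=> h; rewrite -(subrK (m a1 x) z); apply: coneD; [exact: h|apply/cone_mod/D0].
have pn z : cone z -> exists p : nat -> CK, forall n, (forall t, 0 <= p n t) /\
    nrm (z - m (p n) x) < n.+1%:R^-1.
  move=> /coneP h; have h' n : exists a, (forall t, 0 <= a t) /\ nrm (z - m a x) < n.+1%:R^-1.
    by have [|a a0 ha] := h n.+1%:R^-1; [rewrite invr_gt0|exists a].
  by exists (fun n => sval (cid (h' n))) => n; case: cid.
have [p hp] := pn _ (cz _ h1); have [q hq] := pn _ (cz _ h2).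
have small (e : R) : 0 < e -> exists N, forall n, (N <= n)%N -> n.+1%:R^-1 <= e.
  move=> e0; have e0' : 0 < e^-1 by rewrite invr_gt0.
  have hN := archi_boundP (ltW e0').
  exists (Num.Def.archi_bound e^-1) => n Nn; rewrite -[leRHS]invrK lef_pV2 ?posrE//.
  by apply/ltW/(lt_le_trans hN); rewrite ler_nat leqW.
have ps (e : R) : 0 < e -> exists N, forall n, (N <= n)%N ->
    nrm (z1 - m (p n) x) <= e /\ nrm (z2 - m (q n) x) <= e.
  move=> e0; have [N hN] := small _ e0; exists N => n Nn.
  by have [_ /ltW hp2] := hp n; have [_ /ltW hq2] := hq n; split; exact: le_trans (hN n Nn).
pose c n := cmin (p n) (q n).
have [z3 hz3] : exists l, forall e : R, 0 < e -> exists N, forall n, (N <= n)%N -> nrm (l - m (c n) x) <= e.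
  apply: seq_complete => e e0.
  (* Four errors occur, and each passes through two applications of [mod_dom]. *)
  have e4 : 0 < e / (4 * M ^+ 2) by rewrite divr_gt0// mulr_gt0// exprn_gt0// (lt_le_trans ltr01).
  have [N hN] := ps _ e4; exists N => n n' Nn Nn'.
  rewrite -modB//.
  have := @mod_dom R k K X m cK mm (c n - c n') (cabs (p n - p n') + cabs (q n - q n')) x
    (fun t => cmin_lip _ _ _ _ t).
  rewrite (modD mm (cabs _)) => hd; apply: le_trans hd _; rewrite -/M.
  have := nrmD (m (cabs (p n - p n')) x) (m (cabs (q n - q n')) x).
  have := cabs_mod (p n - p n'); have := cabs_mod (q n - q n'); rewrite !modB// -/M.
  have [p1 q1] := hN n Nn; have [p2 q2] := hN n' Nn'.
  have := nrm_tri z1 (m (p n) x) (m (p n') x); have := nrm_tri z2 (m (q n) x) (m (q n') x).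
  rewrite (nrmC (m (p n) x) z1) (nrmC (m (q n) x) z2).
  move: p1 q1 p2 q2; set e' := e / _ => p1 q1 p2 q2 i1 i2 i3 i4 i5.
  have e'M : e = e' * (4 * M ^+ 2).
    by rewrite /e' divfK// mulf_neq0// expf_neq0// gt_eqF// (lt_le_trans ltr01).
  have j1 : nrm (m (p n) x - m (p n') x) <= 2 * e' by lra.
  have j2 : nrm (m (q n) x - m (q n') x) <= 2 * e' by lra.
  have M0 : 0 <= M by exact: le_trans M1.
  have := ler_wpM2l M0 j1; have := ler_wpM2l M0 j2 => j3 j4.
  have j5 : nrm (m (cabs (p n - p n')) x + m (cabs (q n - q n')) x) <= M * (4 * e') by lra.
  by have := ler_wpM2l M0 j5; rewrite e'M expr2; lra.
exists z3; split.
- apply/cycP => e e0; have e2 : 0 < e / 2 by lra.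
  have [N hN] := hz3 _ e2; exists (c N); have := hN N (leqnn _); lra.
- apply/coneP => e e0; have e3 : 0 < e / 3 by lra.
  have [N hN] := hz3 _ e3; have [N' hN'] := ps _ e3.
  pose n := maxn N N'; exists (p n - c n).
    move=> t; have [/(_ t) p0 _] := hp n; rewrite cfunB /c cminE {1}(ge0_rc p0) -rcB rc_ge0.
    by rewrite subr_ge0 ge_min lexx.
  have := hN n (leq_maxl _ _); have [i1 _] := hN' n (leq_maxr _ _) => i2.
  rewrite modB// subACA; have := nrmB (z1 - m (p n) x) (z3 - m (c n) x); lra.
- apply/coneP => e e0; have e3 : 0 < e / 3 by lra.
  have [N hN] := hz3 _ e3; have [N' hN'] := ps _ e3.
  pose n := maxn N N'; exists (q n - c n).
    move=> t; have [/(_ t) p0 _] := hq n; rewrite cfunB /c cminE {1}(ge0_rc p0) -rcB rc_ge0.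
    by rewrite subr_ge0 ge_min lexx orbT.
  have := hN n (leq_maxl _ _); have [_ i1] := hN' n (leq_maxr _ _) => i2.
  rewrite modB// subACA; have := nrmB (z2 - m (q n) x) (z3 - m (c n) x); lra.
- move=> a Da; apply/coneP => e e0.
  have M0 : 0 < M by exact: lt_le_trans M1.
  (* The errors below are d for z3 and 2 M d for each of two corrections, at most 5 M d
     altogether. *)
  pose d := e / (6 * M); have d0 : 0 < d by rewrite divr_gt0// mulr_gt0.
  have dM : e = d * (6 * M) by rewrite /d divfK// mulf_neq0// gt_eqF.
  have [N hN] := hz3 _ d0; have [N' hN'] := ps _ d0.
  pose n := maxn N N'.
  have /coneP/(_ _ d0)[r r0 hr] := h1 a Da; have /coneP/(_ _ d0)[s s0 hs] := h2 a Da.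
  (* The function c n - a need not be nonnegative. However p n - a >= - |p n - a - r| because r >=
     0, and similarly for q n and s, so the two absolute values repair the sign and move x only a
     little. *)
  exists (c n - a + (cabs (p n - a - r) + cabs (q n - a - s))).
    move=> t; have [/(_ t) p0 _] := hp n; have [/(_ t) q0 _] := hq n.
    have a0 := D0 a Da t; have {}r0 := r0 t; have {}s0 := s0 t.
    rewrite cfunD cfunB cfunD !cabsE !cfunB /c cminE (ge0_rc p0) (ge0_rc q0) (ge0_rc a0) (ge0_rc r0) (ge0_rc s0).
    rewrite -!rcB !nrm_rc !reK -!rcD rc_ge0.
    move: r0 s0; rewrite ge0_re => /andP[r0 _]; rewrite ge0_re => /andP[s0 _].
    have := ler_norm (- (re (p n t) - re (a t) - re (r t))); have := ler_norm (- (re (q n t) - re (a t) - re (s t))).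
    have := normr_ge0 (re (p n t) - re (a t) - re (r t)); have := normr_ge0 (re (q n t) - re (a t) - re (s t)).
    rewrite !normrN; case: (leP (re (p n t)) (re (q n t))) => _; lra.
  have i2 := hN n (leq_maxl _ _); have [i1 i1'] := hN' n (leq_maxr _ _).
  have j1 := cabs_mod (p n - a - r); have j2 := cabs_mod (q n - a - s).
  rewrite -/M !modB// in j1 j2.
  have k1 : nrm (m (p n) x - m a x - m r x) <= 2 * d.
    have := nrm_tri z1 (m (p n) x) (m a x + m r x); rewrite (nrmC (m (p n) x) z1).
    by rewrite !opprD !addrA; lra.
  have k2 : nrm (m (q n) x - m a x - m s x) <= 2 * d.
    have := nrm_tri z2 (m (q n) x) (m a x + m s x); rewrite (nrmC (m (q n) x) z2).
    by rewrite !opprD !addrA; lra.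
  rewrite (modD mm (c n - a)) (modD mm (cabs _)) (modB mm (c n)) opprD addrA opprB addrA subrK.
  set P := m (cabs _) x in j1 *; set Q := m (cabs _) x in j2 *.
  have := nrmB (z3 - m (c n) x) (P + Q); have := nrmD P Q.
  have := ler_wpM2l (ltW M0) k1; have := ler_wpM2l (ltW M0) k2.
  have : d * M >= d by rewrite ler_peMr// ltW.
  rewrite dM; lra.
Qed.
End FixX.

Section OrderContinuous.
Hypothesis oc : forall x, order_continuous_norm m x.

(** Since D x is not known to have a supremum, order continuity is applied to the net z - a x
    indexed by all upper bounds z of D x in the cyclic subspace and all a in D. Its infimum is 0: a
    lower bound w can be subtracted from an upper bound again and again, so x - n w stays an upper
    bound, and division by n shows that -w lies in the cone. *)
Lemma oc_cauchy (D : set CK) x (d : R) : 0 < d -> D !=set0 ->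
  (forall a, D a -> forall t, 0 <= a t <= 1) ->
  (forall a b, D a -> D b -> exists2 c, D c & (a <= c)%O /\ (b <= c)%O) ->
  exists2 a, D a & forall b, D b -> (a <= b)%O -> nrm (m b x - m a x) <= d.
Proof.
move=> d0 [a1 Da1] D01 Ddir.
have D0 a : D a -> forall t, 0 <= a t by move=> Da t; have /andP[] := D01 a Da t.
pose UB z := cyclic_subspace m x z /\ forall a, D a -> cyclic_cone m x (z - m a x).
pose I := {za : X * CK | UB za.1 /\ D za.2}.
pose le (i j : I) := cyclic_cone m x ((sval i).1 - (sval j).1) /\ ((sval i).2 <= (sval j).2)%O.
pose y (i : I) := (sval i).1 - m (sval i).2 x.
pose mk z a (h : UB z /\ D a) : I := exist (fun za : X * CK => UB za.1 /\ D za.2) (z, a) h.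
have UBx : UB x.
  split; first by rewrite -{2}(mod1 mm x); exact: cyc_mod.
  move=> a Da; rewrite -{2}(mod1 mm x) -modB//; apply: cone_mod => t.
  by rewrite cfunB cfun1 subr_ge0; have /andP[] := D01 a Da t.
have dir : directed le.
  split.
  - by constructor; exact: (mk x a1 (conj UBx Da1)).
  - by move=> i; split; rewrite ?subrr; [exact: cone0|exact: lexx].
  - move=> i j l [ij ij'] [jl jl']; split; last exact: le_trans jl'.
    rewrite -(subrK (sval j).1 (sval i).1) -addrA; exact: coneD.
  - move=> [[z1 b1] [[c1 u1] D1]] [[z2 b2] [[c2 u2] D2]].
    have [z3 [c3 h1 h2 h3]] := @cone_meet x D z1 z2 (ex_intro _ a1 Da1) D0 u1 u2.
    have [b Db [bb1 bb2]] := Ddir _ _ D1 D2.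
    by exists (mk z3 b (conj (conj c3 h3) Db)).
have ycyc i : cyclic_subspace m x (y i).
  by case: (svalP i) => -[_ uz] Da; apply/cone_cyc/uz.
have ymono i j : le i j -> cyclic_cone m x (y i - y j).
  move=> [h1 h2]; rewrite /y subACA -modB// -(opprB (sval j).2) modN// opprK.
  apply: coneD => //; apply: cone_mod => t; rewrite cfunB subr_ge0.
  by have /cfun_leP := h2; exact.
have ycone i : cyclic_cone m x (y i) by case: (svalP i) => -[_ uz] Da; exact: uz.
have yinf w : cyclic_subspace m x w -> (forall i, cyclic_cone m x (y i - w)) -> cyclic_cone m x (0 - w).
  move=> cw hw.
  have UBn n : UB (x - w *+ n).
    elim: n => [|n [c1 u1]]; first by rewrite mulr0n subr0.
    rewrite mulrSr opprD addrA; split; first exact: cycB.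
    move=> a Da; have := hw (mk (x - w *+ n) a (conj (conj c1 u1) Da)).
    by rewrite (_ : y _ - w = x - w *+ n - w - m a x)// /y /= addrAC.
  apply: cone_closed => e e0.
  pose v := x - m a1 x; pose n := Num.Def.archi_bound (nrm v / e).
  have v0 : 0 <= nrm v / e by rewrite divr_ge0 ?nrm_ge0// ltW.
  have hn := archi_boundP v0; rewrite -/n in hn.
  have n0 : 0 < n%:R :> R by exact: le_lt_trans hn.
  exists (rc k n%:R^-1 *: (x - w *+ n - m a1 x)).
    by apply: coneZ; [rewrite invr_ge0 ltW|have [_] := UBn n; exact].
  have -> : 0 - w - rc k n%:R^-1 *: (x - w *+ n - m a1 x) = - (rc k n%:R^-1 *: v).
    rewrite [x - _ - _]addrAC -/v scalerBr -(scaler_nat n w) scalerA.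
    have -> : n%:R = rc k n%:R :> F by elim: (n) => [|n' IH]; rewrite ?rc0// !mulrSr rcD IH rc1.
    by rewrite -rcM mulVf ?gt_eqF// rc1 scale1r sub0r opprB addKr.
  rewrite nrmN nrmZ nrm_rc gtr0_norm ?invr_gt0// mulrC ltr_pdivrMr//.
  by move: hn; rewrite ltr_pdivrMr// mulrC.
have := oc dir ycyc ymono ycone yinf.
have FT := tails_filter dir.
have d2 : 0 < d / 2 by lra.
move=> /cvg_nrmP/(_ _ d2)[[[z a] [uz Da]] _ hi].
have hz b : D b -> (a <= b)%O -> nrm (z - m b x) < d / 2.
  move=> Db ab; have := hi (mk z b (conj uz Db)).
  rewrite /= sub0r nrmN => /(_ _)/(le_lt_trans (cyclic_norm_ge _)); apply.
  by split => //=; rewrite subrr; exact: cone0.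
exists a => // b Db ab.
have := nrm_tri z (m b x) (m a x); rewrite (nrmC (m b x) z).
have := hz b Db ab; have := hz a Da (lexx _); lra.
Qed.

Hypothesis minj : injective m.
Hypothesis mcl : closed (range m : set (wot X)).

Lemma oc_normal : stonian K /\ forall U, open U -> bop_normal m U.
Proof.
(* Clopen subsets of U are not yet available, hence functions vanishing off U; a + b - a b is a
   common upper bound of a and b among them. *)
pose DU U := [set a : CK | (forall t, 0 <= a t <= 1) /\ forall t, ~ U t -> a t = 0].
have cov U : open U -> [/\ clopen (closure U) & forall x (e : R), 0 < e ->
    exists2 a, DU U a & nrm (m (ind R k (closure U) - a) x) <= e].
  move=> oU.
  have DU0 : DU U !=set0 by exists 0; split=> t; rewrite cfun0 ?lexx ?ler01.
  have DU01 a : DU U a -> forall t, 0 <= a t <= 1 by case.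
  have DUd a b : DU U a -> DU U b -> exists2 c, DU U c & (a <= c)%O /\ (b <= c)%O.
    move=> [a01 aU] [b01 bU].
    have ab t : 0 <= a t * b t by have /andP[? _] := a01 t; have /andP[? _] := b01 t; rewrite mulr_ge0.
    have ha t : a t <= (a + b - a * b) t.
      rewrite cfunB cfunD cfunM -addrA lerDl -{1}[b t]mul1r -mulrBl.
      by have /andP[_ ?] := a01 t; have /andP[? _] := b01 t; rewrite mulr_ge0// subr_ge0.
    have hb t : b t <= (a + b - a * b) t.
      rewrite cfunB cfunD cfunM addrAC lerDr -{1}[a t]mulr1 -mulrBr.
      by have /andP[? _] := a01 t; have /andP[_ ?] := b01 t; rewrite mulr_ge0// subr_ge0.
    exists (a + b - a * b); last by split; apply/cfun_leP.
    split=> t; last by move=> Ut; rewrite cfunB cfunD cfunM aU// bU// mul0r addr0 subr0.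
    apply/andP; split; first by apply: le_trans (ha t); have /andP[] := a01 t.
    rewrite -subr_ge0 cfunB cfunD cfunM.
    have -> : 1 - (a t + b t - a t * b t) = (1 - a t) * (1 - b t) by ring.
    by have /andP[_ ?] := a01 t; have /andP[_ ?] := b01 t; rewrite mulr_ge0// subr_ge0.
  apply: (directed_cover cK hK mm minj mcl oU) => //.
  - by move=> x e e0; exact: oc_cauchy.
  - by move=> a [].
  - move=> t Ut; have [h [h1 h01 hU]] := urysohn_bump R k cK hK (open_nbhs_nbhs (conj oU Ut)).
    by exists h.
have st : stonian K by split=> // U /cov[[]].
split=> // U oU; have [cl h] := cov U oU.
refine (cover_normal cK mm st oU _ _ h); by [move=> a []|move=> a []].
Qed.
End OrderContinuous.
End Cone.

(** * From normality to order continuity *)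

Section NormalOrderContinuous.
Context (R : realType) (k : scalar_kind) (K : topologicalType).
Local Notation F := (scalars R k).
Local Notation CK := (cfun K F).
Local Notation ind := (ind R k).
Context (X : completeNormedModType F) (m : CK -> bop X X).
Hypotheses (cK : compact [set: K]) (hK : hausdorff_space K).
Hypothesis mm : banach_module m.
Implicit Types (a b c : CK) (u v w x z : X).
Local Notation M := (modC cK mm).

Lemma nrm_01 (z : F) : 0 <= z <= 1 -> nrm (z : F^o) <= 1.
Proof. by move=> /andP[z0 z1]; rewrite -(nrm1 R k); exact: nrm_le_mono. Qed.
Lemma ge0_nrm_le1 (z : F) : 0 <= z -> nrm (z : F^o) <= 1 -> z <= 1.
Proof. by move=> z0; rewrite nrm_le rc1 ger0_norm. Qed.

(** With u close to a x and v - u close to b x, the multiplier c is the regularized quotient of a by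
    a + b from [cfun_div]. *)
Lemma cone_dom_approx x u v (e : R) : cyclic_cone m x u -> cyclic_cone m x (v - u) -> 0 < e ->
  exists c, (forall t, 0 <= c t <= 1) /\ nrm (u - m c v) <= e.
Proof.
move=> /coneP hu /coneP hvu e0; have M1 : 1 <= M := modC_ge1 cK mm.
have M0 : 0 < M by exact: lt_le_trans M1.
have nx0 : 0 < nrm x + 1 by rewrite ltr_wpDl// nrm_ge0.
pose e1 := e / (4 * M); have e10 : 0 < e1 by rewrite divr_gt0// mulr_gt0.
pose e2 := e / (4 * M * (nrm x + 1)); have e20 : 0 < e2 by rewrite divr_gt0// !mulr_gt0.
have [a a0 ha] := hu _ e10; have [b b0 hb] := hvu _ e10.
have [|g [g1 g2 g3]] := @cfun_div R k K a (a + b) e2 e20.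
  by move=> t; apply: nrm_le_mono => //; rewrite cfunD lerDl.
exists g; split.
  move=> t; have gt0 : 0 <= g t by apply: g3 => // s; rewrite cfunD addr_ge0.
  by rewrite gt0 ge0_nrm_le1.
have -> : u - m g v = (u - m a x) + (m (a - g * (a + b)) x + m g (m (a + b) x - v)).
  by rewrite bopB modB// modM// [X in _ = _ + X]addrA !subrK addrA subrK.
have h1 := @mod_le R k K X m cK mm (a - g * (a + b)) e2 x (ltW e20) g2.
have h2 := mod_le1 cK mm (m (a + b) x - v) g1.
have h3 : nrm (m (a + b) x - v) <= 2 * e1.
  have := nrmD (u - m a x) (v - u - m b x); rewrite modD// (nrmC (m a x + m b x) v).
  have -> : u - m a x + (v - u - m b x) = v - (m a x + m b x).
    by rewrite addrACA -opprD [u + _]addrC subrK.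
  lra.
have h4 := nrmD (u - m a x) (m (a - g * (a + b)) x + m g (m (a + b) x - v)).
have h5 := nrmD (m (a - g * (a + b)) x) (m g (m (a + b) x - v)).
have h6 : M * e2 * nrm x <= e / 4.
  have -> : e / 4 = M * e2 * (nrm x + 1).
    by rewrite /e2; field; rewrite !gt_eqF.
  by rewrite ler_wpM2l ?lerDl// mulr_ge0 ?ltW.
have h7 := ler_wpM2l (ltW M0) h3.
have h8 : M * e1 = e / 4 by rewrite /e1; field; rewrite gt_eqF.
have h9 : e1 <= M * e1 by rewrite ler_peMl// ltW.
lra.
Qed.

Lemma cone_normal x u v : cyclic_cone m x u -> cyclic_cone m x (v - u) -> nrm u <= M * nrm v.
Proof.
move=> hu hvu; apply/ler_addgt0Pr => e e0.
have [c [c01 hc]] := cone_dom_approx hu hvu e0.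
have := mod_le1 cK mm v (fun t => nrm_01 (c01 t)).
have := nrmD (u - m c v) (m c v); rewrite subrK; lra.
Qed.

Lemma cone_proper x z : cyclic_cone m x z -> cyclic_cone m x (0 - z) -> z = 0.
Proof.
move=> h1 h2; apply/nrm0_eq0/eqP; rewrite eq_le nrm_ge0 andbT.
by have := cone_normal h1 h2; rewrite nrm0 mulr0.
Qed.

Hypothesis st : stonian K.
Hypothesis nm : forall U, open U -> bop_normal m U.

Lemma increasing_cover (A : set K) (V : nat -> set K) : compact A ->
  (forall n, open (V n)) -> (forall i j, (i <= j)%N -> V i `<=` V j) ->
  A `<=` \bigcup_n V n -> exists n, A `<=` V n.
Proof.
move=> cA oV mV AV.
apply: (compact_ind (Q := fun S => exists n, S `<=` V n) cA).
- by exists 0%N.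
- move=> B C [i iB] [j jC]; exists (maxn i j) => t.
  by move=> [/iB|/jC]; apply: mV; rewrite ?leq_maxl ?leq_maxr.
- by move=> B C BC [i iC]; exists i; exact: subset_trans iC.
- move=> t /AV[n _ Vt]; exists (V n); last by exists n.
  exact: (open_nbhs_nbhs (conj (oV n) Vt)).
Qed.

Lemma open_nrm_gt c (r : R) : open [set t | r < nrm (c t : F^o)].
Proof.
rewrite openE => t /= ct; have d0' : 0 < nrm (c t : F^o) - r by rewrite subr_gt0.
have /cts_nrmP/(_ t _ d0') := cfun_cts c; apply: filterS => s /=.
by have := nrm_sub (c t : F^o) (c s : F^o); lra.
Qed.
Lemma closure_nrm_gt c (r : R) t : closure [set t | r < nrm (c t : F^o)] t -> r <= nrm (c t : F^o).
Proof.
move=> cVt; rewrite leNgt; apply/negP => ctr.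
have d0' : 0 < r - nrm (c t : F^o) by rewrite subr_gt0.
have /cts_nrmP/(_ t _ d0')/cVt[s /= []] := cfun_cts c.
by have := nrm_sub (c s : F^o) (c t : F^o); rewrite (nrmC (c s : F^o)); lra.
Qed.

(* If the clopen sets {c_k >= eta} did not shrink to nothing, some point would
   lie in more than C / eta of them. *)
Lemma bounded_sum_null (c : nat -> CK) (C : R) v (e : R) : 0 < e ->
  (forall n t, 0 <= c n t) ->
  (forall N t, \sum_(i < N) nrm (c i t : F^o) <= C) ->
  exists N, forall n, (N <= n)%N -> nrm (m (c n) v) <= e.
Proof.
move=> e0 c0 cC; have M0 : 0 < M := modC_gt0 cK mm.
have nv0 : 0 < nrm v + 1 by rewrite ltr_wpDl// nrm_ge0.
pose eta := e / (2 * M * (nrm v + 1)); have eta0 : 0 < eta by rewrite divr_gt0// !mulr_gt0.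
pose G n := closure [set t | eta < nrm (c n t : F^o)].
have cG n : clopen (G n) by apply: stonian_closure_clopen => //; exact: open_nrm_gt.
pose H N := closure (\bigcup_(n in [set n | (N <= n)%N]) G n).
have cH N : clopen (H N).
  by apply: stonian_closure_clopen => //; apply: bigcup_open => n _; case: (cG n).
have Hmono i j : (i <= j)%N -> ~` H i `<=` ~` H j.
  move=> ij; apply: subsetC; apply: closureS => t [n /= jn Gt].
  by exists n => //=; exact: leq_trans jn.
pose U := \bigcup_n ~` H n.
have oH n : open (~` H n) by apply: closed_openC; case: (cH n).
have oU : open U by apply: bigcup_open.
have sum_mono t i j : (i <= j)%N ->
    \sum_(n < i) nrm (c n t : F^o) <= \sum_(n < j) nrm (c n t : F^o).
  move=> /subnK <-; elim: (j - i)%N => // n IH.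
  by rewrite addSn big_ord_recr /=; apply: le_trans IH _; rewrite lerDl nrm_ge0.
have dU t : closure U t.
  apply: contrapT => ncU.
  pose W := ~` closure U; have oW : open W by exact/closed_openC/closed_closure.
  have WH n : W `<=` H n.
    by move=> s Ws; apply: contrapT => Hs; apply: Ws; apply: subset_closure; exists n.
  (* Each step intersects W' with a further [G n] of index at least N, which adds at least eta to
     the sum on a smaller nonempty open set. *)
  have step j : exists W' N, [/\ open W', W' !=set0, W' `<=` W &
      forall s, W' s -> j%:R * eta <= \sum_(n < N) nrm (c n s : F^o)].
    elim: j => [|j [W' [N [oW' [s Ws] sW hW]]]].
      exists W, 0%N; split=> //; first by exists t.
      by move=> s _; rewrite mul0r big_ord0.
    have /(_ W' (open_nbhs_nbhs (conj oW' Ws)))[s' [[n Nn Gs'] Ws']] := WH N s (sW s Ws).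
    exists (W' `&` G n), n.+1; split.
    - by apply: openI => //; case: (cG n).
    - by exists s'.
    - by move=> r [/sW].
    - move=> r [Wr Gr]; rewrite mulrSr mulrDl mul1r big_ord_recr /=.
      apply: lerD; last exact: closure_nrm_gt Gr.
      exact: le_trans (hW r Wr) (sum_mono r _ _ Nn).
  have Ce0 : 0 <= C / eta by rewrite divr_ge0 ?(ltW eta0)//; have := cC 0%N t; rewrite big_ord0.
  have [W' [N [_ [s Ws] _ /(_ s Ws)]]] := step (Num.Def.archi_bound (C / eta)).
  have := archi_boundP Ce0; rewrite ltr_pdivrMr// => h1 h2.
  have := lt_le_trans h1 h2; have := cC N s.
  by move=> h /(le_lt_trans h); rewrite ltxx.
have C0 : 0 < `|C| + 1 by rewrite ltr_wpDl.
have e10 : 0 < e / (2 * (`|C| + 1)) by rewrite divr_gt0// mulr_gt0.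
have [A [cA AU hA]] := nm oU v e10.
have [N AN] := increasing_cover (closed_compact cK cA.2) oH Hmono AU.
exists N => n Nn.
have cnC t : nrm (c n t : F^o) <= `|C|.
  apply: le_trans (ler_norm _); apply: le_trans (cC n.+1 t).
  by rewrite big_ord_recr /= lerDr sumr_ge0// => i _; exact: nrm_ge0.
(* Off [G n] the function c n is at most eta. Its part on [G n] vanishes on A, which is disjoint
   from [H N], so that normality makes it small. *)
have -> : m (c n) v = rc k (`|C| + 1) *: m (rc k (`|C| + 1)^-1 *: (c n * ind (G n))) v + m (c n * (1 - ind (G n))) v.
  rewrite modZ// scalerA -rcM mulfV ?gt_eqF// rc1 scale1r -modD//.
  by rewrite -mulrDr [ind _ + _]addrC subrK mulr1.
have h1 : nrm (m (rc k (`|C| + 1)^-1 *: (c n * ind (G n))) v) <= e / (2 * (`|C| + 1)).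
  apply: hA => t.
  - change (nrm (rc k (`|C| + 1)^-1 * (c n t * ind (G n) t) : F^o) <= 1).
    rewrite !nrmM nrm_rc gtr0_norm ?invr_gt0// mulrC ler_pdivrMr// mul1r.
    apply: le_trans (_ : `|C| * 1 <= _); last by rewrite mulr1 lerDl.
    by apply: ler_pM; rewrite ?nrm_ge0// nrm_ind.
  - move=> /AN Ht; rewrite cfunZ cfunM ind_out ?mulr0// => Gt; apply: Ht.
    by apply: subset_closure; exists n.
  - by move=> ncU; exfalso; apply: ncU.
have h2 : nrm (m (c n * (1 - ind (G n))) v) <= M * eta * nrm v.
  apply: mod_le; first exact: ltW.
  move=> t; rewrite cfunM cfunB cfun1; have [Gt|Gt] := pselect (G n t).
    by rewrite ind_in// subrr mulr0 nrm0 ltW.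
  rewrite ind_out// subr0 mulr1 leNgt; apply/negP => lt; apply: Gt; exact: subset_closure.
have h3 : M * eta * nrm v <= e / 2.
  have -> : e / 2 = M * eta * (nrm v + 1) by rewrite /eta; field; rewrite !gt_eqF.
  by rewrite ler_wpM2l ?lerDl// mulr_ge0 ?ltW.
apply: le_trans (nrmD _ _) _; rewrite nrmZ nrm_rc (gtr0_norm C0).
have h4 : (`|C| + 1) * (e / (2 * (`|C| + 1))) = e / 2 by field; rewrite gt_eqF.
have := ler_wpM2l (ltW C0) h1; rewrite h4; lra.
Qed.

(** Each u_n is close to c_n v with 0 <= c_n <= 1. On the closure of the set where some partial sum
    of the c_n exceeds 2 the vector v itself is small, because the sums of the u_n stay below v. Off
    that closure the partial sums are bounded by 2, and [bounded_sum_null] makes c_n v small for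
    late n. *)
Lemma normal_cauchy x (u : nat -> X) v (d : R) : 0 < d ->
  (forall n, cyclic_cone m x (u n)) ->
  (forall N, cyclic_cone m x (v - \sum_(i < N) u i)) ->
  (forall n, d < nrm (u n)) -> False.
Proof.
move=> d0 uc vs ud; have M1 : 1 <= M := modC_ge1 cK mm.
have M0 : 0 < M by exact: lt_le_trans M1.
(* The errors at the end, e + e + 3 M^2 e, stay below 8 M^2 e. *)
pose e := d / (8 * M ^+ 2); have e0 : 0 < e by rewrite divr_gt0// mulr_gt0// exprn_gt0.
have dE : d = 8 * M ^+ 2 * e by rewrite /e mulrC divfK// mulf_neq0// expf_neq0// gt_eqF.
have sumc N : cyclic_cone m x (\sum_(i < N) u i).
  elim: N => [|N IH]; first by rewrite big_ord0; exact: cone0.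
  by rewrite big_ord_recr /=; exact: coneD.
have vu n : cyclic_cone m x (v - u n).
  have -> : v - u n = (v - \sum_(i < n.+1) u i) + \sum_(i < n) u i.
    by rewrite big_ord_recr /= [_ + u n]addrC opprD addrA subrK.
  exact: coneD.
have en0 n : 0 < e * 2^-1 ^+ n.+1 by rewrite mulr_gt0// exprn_gt0// invr_gt0.
pose c n := sval (cid (cone_dom_approx (uc n) (vu n) (en0 n))).
have cP n : (forall t, 0 <= c n t <= 1) /\ nrm (u n - m (c n) v) <= e * 2^-1 ^+ n.+1.
  by rewrite /c; case: cid.
have c0 n t : 0 <= c n t by have [/(_ t)/andP[]] := cP n.
have geo N : \sum_(i < N) 2^-1 ^+ i.+1 <= 1 - 2^-1 ^+ N :> R.
  elim: N => [|N IH]; first by rewrite big_ord0 expr0 subrr.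
  by rewrite big_ord_recr /= exprSr; lra.
pose s N : CK := \sum_(i < N) c i.
have sE N t : nrm (s N t : F^o) = \sum_(i < N) nrm (c i t : F^o).
  elim: N => [|N IH]; first by rewrite /s !big_ord0 cfun0 nrm0.
  have sS : s N.+1 t = s N t + c N t by rewrite /s big_ord_recr.
  rewrite [RHS]big_ord_recr /= -IH sS.
  have s0 : 0 <= s N t by rewrite /s cfun_sum sumr_ge0.
  by rewrite !ge0_nrm ?reD// addr_ge0.
have sv N : nrm (\sum_(i < N) u i - m (s N) v) <= e.
  apply: le_trans (_ : e * \sum_(i < N) 2^-1 ^+ i.+1 <= _); last first.
    rewrite ler_piMr ?(ltW e0)//; apply: le_trans (geo N) _.
    by rewrite gerBl exprn_ge0// invr_ge0.
  elim: N => [|N IH]; first by rewrite /s !big_ord0 mod0// subr0 nrm0 mulr0.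
  rewrite /s !big_ord_recr /= -/(s N) modD// opprD addrACA mulrDr.
  apply: le_trans (nrmD _ _) _; apply: lerD => //; by have [] := cP N.
pose V N := [set t | 2 < nrm (s N t : F^o)].
pose U := \bigcup_n V n.
have oV n : open (V n) by exact: open_nrm_gt.
have oU : open U by apply: bigcup_open.
have mV i j : (i <= j)%N -> V i `<=` V j.
  move=> ij t; rewrite /V /= => h; apply: lt_le_trans h _; rewrite !sE.
  move: ij => /subnK <-; elim: (j - i)%N => // n IH.
  by rewrite addSn big_ord_recr /=; apply: le_trans IH _; rewrite lerDl nrm_ge0.
have cE := stonian_closure_clopen st oU.
(* On the compact set A one sum s N exceeds 2, while s N v is within 2 e of f v for some f between 0
   and 1. Hence |s N - f| >= 1 on A, and this function dominates the characteristic function of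
   A. *)
have Ev : nrm (m (ind (closure U)) v) <= 3 * M * e.
  have [A [cA AU hA]] := nm oU v e0.
  have [N AN] := increasing_cover (closed_compact cK cA.2) oV mV AU.
  have [f [f01 hf]] := cone_dom_approx (sumc N) (vs N) e0.
  have h1 : nrm (m (ind A) v) <= M * nrm (m (s N - f) v).
    apply: mod_dom => t; rewrite cfunB; have [At|At] := pselect (A t); last first.
      by rewrite ind_out// nrm0 nrm_ge0.
    rewrite ind_in// nrm1; have := AN t At; rewrite /V /=.
    by have := nrm_sub (s N t : F^o) (f t); have := nrm_01 (f01 t); lra.
  have h2 : nrm (m (s N - f) v) <= 2 * e.
    rewrite modB//; have := nrm_tri (\sum_(i < N) u i) (m (s N) v) (m f v).
    by rewrite (nrmC (m (s N) v) (\sum_(i < N) u i)); have := sv N; lra.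
  have h3 : nrm (m (ind (closure U) - ind A) v) <= e.
    apply: hA => t.
    - rewrite cfunB; have [At|At] := pselect (A t).
        by rewrite !ind_in ?subrr ?nrm0//; apply: subset_closure; exact: AU.
      by rewrite (ind_out R k cA)// subr0 nrm_ind.
    - by move=> At; rewrite cfunB !ind_in ?subrr//; apply: subset_closure; exact: AU.
    - by move=> Et; rewrite cfunB !ind_out ?subrr// => At; apply: Et; apply: subset_closure; exact: AU.
  have := nrmD (m (ind (closure U) - ind A) v) (m (ind A) v); rewrite -modD// subrK.
  have := ler_wpM2l (ltW M0) h2; have := ler_wpM2r (ltW e0) M1; lra.
have [||N hN] := @bounded_sum_null (fun n => c n * (1 - ind (closure U))) 2 v e e0.
- move=> n t; rewrite cfunM cfunB mulr_ge0// subr_ge0.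
  by have /andP[] := ind_01 R k t cE.
- move=> N t; have [Et|Et] := pselect (closure U t).
    rewrite big1 => // i _; by rewrite cfunM cfunB ind_in// cfun1 subrr mulr0 nrm0.
  rewrite (eq_bigr (fun i : 'I_N => nrm (c i t : F^o))); last first.
    by move=> i _; rewrite cfunM cfunB ind_out// cfun1 subr0 mulr1.
  rewrite -sE leNgt; apply/negP => lt; apply: Et; apply: subset_closure; by exists N.
have h1 := hN N (leqnn _).
have h2 : nrm (m (c N * ind (closure U)) v) <= M * (3 * M * e).
  rewrite modM//; apply: le_trans (mod_le1 cK mm _ (fun t => nrm_01 (andb_true_intro (conj (c0 N t) _)))) _.
    by move=> t; have [/(_ t)/andP[]] := cP N.
  by rewrite ler_wpM2l// ltW.
have [_ h3] := cP N.
have h4 : e * 2^-1 ^+ N.+1 <= e by rewrite ler_piMr ?(ltW e0)// exprn_ile1//; lra.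
have h5 : m (c N) v = m (c N * (1 - ind (closure U))) v + m (c N * ind (closure U)) v.
  by rewrite -modD// -mulrDr subrK mulr1.
have h6 := nrmD (m (c N * (1 - ind (closure U))) v) (m (c N * ind (closure U)) v).
rewrite -h5 in h6.
have h7 := nrmD (u N - m (c N) v) (m (c N) v); rewrite subrK in h7.
have h8 := ud N.
have h9 : M * (3 * M * e) = 3 * (M ^+ 2 * e) by ring.
have h10 : d = 8 * (M ^+ 2 * e) by rewrite dE; ring.
have h11 : e <= M ^+ 2 * e by rewrite ler_peMl ?(ltW e0)// exprn_ege1.
lra.
Qed.

(** If the net were not Cauchy, the differences along a chain of indices would contradict
    [normal_cauchy]. Its limit z lies in the cone and is a lower bound, so -z lies in the cone too,
    and z = 0. *)
Lemma normal_oc x : order_continuous_norm m x.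
Proof.
move=> I le y dir ycyc ymono ycone yinf.
have FT := tails_filter dir.
have ycau (d : R) : 0 < d -> exists i, forall j, le i j -> nrm (y i - y j) <= d.
  move=> d0; apply: contrapT => h.
  have next i : exists j, le i j /\ d < nrm (y i - y j).
    apply: contrapT => h2; apply: h; exists i => j ij; rewrite leNgt; apply/negP => lt.
    by apply: h2; exists j.
  pose f i := sval (cid (next i)).
  have fP i : le i (f i) /\ d < nrm (y i - y (f i)) by rewrite /f; case: cid.
  have [i0] := directed_inhabited dir.
  pose s n := iter n f i0.
  apply: (@normal_cauchy x (fun n => y (s n) - y (s n.+1)) (y (s 0%N)) d d0).
  - by move=> n; apply: ymono; have [] := fP (s n).
  - move=> N; rewrite (_ : _ - _ = y (s N)); first exact: ycone.
    elim: N => [|N IH]; first by rewrite big_ord0 subr0.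
    by rewrite big_ord_recr /= opprD addrA IH opprB addrCA subrr addr0.
  - by move=> n; have [] := fP (s n).
have PF : ProperFilter (y @ tails le) by exact: fmap_proper_filter.
have : cauchy (y @ tails le).
  apply/cauchyP => e e0; have ee := ge0_rc (ltW e0).
  have re0 : 0 < re e / 2 by rewrite divr_gt0// -(ltr_rc k) rc0 -ee.
  have [i hi] := ycau _ re0; exists (y i); exists i => // j ij.
  rewrite -ball_normE /= ee -nrm_lt; apply: le_lt_trans (hi _ ij) _; lra.
move=> /cauchy_cvg/cvg_ex[z /cvg_nrmP yz].
have zP i (e : R) : 0 < e -> exists2 j, le i j & nrm (z - y j) < e.
  move=> /yz[j _ hj]; have [l [il jl]] := directed_ub dir i j.
  by exists l => //; exact: hj.
have [i0] := directed_inhabited dir.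
have zc : cyclic_cone m x z.
  by apply: cone_closed => e e0; have [j _ hj] := zP i0 e e0; exists (y j).
have yzc i : cyclic_cone m x (y i - z).
  apply: cone_closed => e e0; have [j ij hj] := zP i e e0; exists (y i - y j); first exact: ymono.
  by rewrite subACA subrr sub0r nrmN.
have z0 : z = 0.
  by apply: (cone_proper zc); apply: yinf => //; exact: cone_cyc.
apply/cvg_nrmP => e e0; have M0 : 0 < M := modC_gt0 cK mm.
have eM : 0 < e / M by rewrite divr_gt0.
have [i _ hi] := yz _ eM; exists i => // j ij; rewrite /= sub0r nrmN.
apply: le_lt_trans (cyclic_norm_le cK mm _) _; rewrite mulrC -ltr_pdivlMr//.
by have := hi j ij; rewrite /= z0 sub0r nrmN.
Qed.
End NormalOrderContinuous.

(** * Hahn-Banach extension *)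

Section HahnBanach.
Context (R : realType) (k : scalar_kind).
Local Notation F := (scalars R k).
Local Notation iu := (iu R k).
Context (X : normedModType F).
Implicit Types (x y : X) (r s : R).

Section RealExtension.
Variables (p : X -> R) (G0 : set (X * R)).
Hypothesis p_tri : forall x y, p (x + y) <= p x + p y.
Hypothesis p_hom : forall r x, 0 <= r -> p (rc k r *: x) = r * p x.

(** A real-linear functional on a subspace, given by its graph so that Zorn's lemma can be applied
    to unions; domination by p forces the graph to be single-valued. *)
Definition dominated_graph (G : set (X * R)) :=
  (forall r x y a b, G (x, a) -> G (y, b) -> G (rc k r *: x + y, r * a + b)) /\
  (forall x a, G (x, a) -> a <= p x).

Hypothesis G00 : G0 (0, 0).
Hypothesis G0P : dominated_graph G0.

Lemma dominated_graph_fun G x a b : dominated_graph G -> G (x, a) -> G (x, b) -> a <= b.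
Proof.
move=> [lG dG] Ga Gb.
have := lG (-1) x x b a Gb Ga; rewrite mulN1r rcN rc1 scaleN1r addNr.
move=> /dG; have p0 : p 0 = 0 by rewrite -(scaler0 _ (rc k 0)) p_hom// mul0r.
by rewrite p0 addrC subr_le0.
Qed.

Lemma maximal_extension : exists H, [/\ dominated_graph H, G0 `<=` H & forall x, exists a, H (x, a)].
Proof.
(* Adjoining G0 makes the property hold for the union of the empty chain as well. *)
pose P G := dominated_graph (G `|` G0).
have [A [PA maxA]] : exists A, P A /\ forall B, A `<` B -> ~ P B.
  apply: Zorn_bigcup => C CP Ctot.
  have pair u v : ((\bigcup_(A in C) A) `|` G0) u -> ((\bigcup_(A in C) A) `|` G0) v ->
      (G0 u /\ G0 v) \/ exists A, [/\ C A, (A `|` G0) u & (A `|` G0) v].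
    move=> [[A CA Au]|u0] [[B CB Bv]|v0].
    - right; have [AB|BA] := Ctot _ _ CA CB.
        by exists B; split=> //; left=> //; exact: AB.
      by exists A; split=> //; left=> //; exact: BA.
    - by right; exists A; split=> //; [left|right].
    - by right; exists B; split=> //; [right|left].
    - by left.
  split.
  - move=> r x y a b h1 h2; have [[g1 g2]|[A [CA A1 A2]]] := pair _ _ h1 h2.
      by right; apply: G0P.1.
    by have [/(_ r _ _ _ _ A1 A2)[?|?] _] := CP _ CA; [left; exists A|right].
  - move=> x a [[A CA Aa]|?]; last exact: G0P.2.
    by have [_] := CP _ CA; apply; left.
pose H := A `|` G0.
have PH : dominated_graph H by [].
have maxH H' : dominated_graph H' -> H `<=` H' -> H' `<=` H.
  move=> dH' HH'; apply: contrapT => nsub; apply: (maxA H').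
    split; first by move=> u Au; apply: HH'; left.
    by move=> h; apply: nsub => u /h; left.
  rewrite /P (_ : H' `|` G0 = H')//; apply/setUidPl => u G0u; apply: HH'; by right.
exists H; split=> // => [u|x0]; first by right.
apply: contrapT => nx0.
have [lH dH] := PH.
(* A value at x0 is admissible if it lies between all a - p (y - x0) and all p (y + x0) - a; the
   supremum of the former is taken. *)
pose S := [set q | exists y a, H (y, a) /\ q = a - p (y - x0)].
have Sub y' a' : H (y', a') -> ubound S (p (y' + x0) - a').
  move=> Ha' _ [y [a [Ha ->]]].
  have := lH 1 y y' a a' Ha Ha'; rewrite rc1 scale1r mul1r => /dH.
  have := p_tri (y - x0) (y' + x0); rewrite addrACA addNr addr0; lra.
have H00 : H (0, 0) by right.
have S0 : S !=set0 by exists (0 - p (0 - x0)), 0, 0.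
have hS : has_sup S by split=> //; exists (p (0 + x0) - 0); exact: Sub H00.
pose al := sup S.
have al1 y a : H (y, a) -> a - p (y - x0) <= al.
  by move=> Ha; apply: sup_upper_bound => //; exists y, a.
have al2 y a : H (y, a) -> al <= p (y + x0) - a.
  by move=> Ha; apply: ge_sup => //; exact: Sub.
have Hscale r y a : H (y, a) -> H (rc k r *: y, r * a).
  by move=> Ha; have := lH r _ _ _ _ Ha H00; rewrite !addr0.
pose H' := [set u : X * R | exists y a t, H (y, a) /\ u = (y + rc k t *: x0, a + t * al)].
have dH' : dominated_graph H'.
  split=> [r x y a b [x1 [a1 [t1 [h1 [-> ->]]]]] [y1 [b1 [t2 [h2 [-> ->]]]]]|x a].
    exists (rc k r *: x1 + y1), (r * a1 + b1), (r * t1 + t2); split; first exact: lH.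
    congr (_, _); last by ring.
    by rewrite scalerDr scalerA addrACA rcD rcM scalerDl.
  move=> [y [b [t [Hb [-> ->]]]]].
  have [t0|t0|->] := ltgtP t 0; last by rewrite rc0 scale0r mul0r !addr0; exact: dH.
  - have nt0 : 0 < - t by lra.
    have := al1 _ _ (Hscale (- t)^-1 _ _ Hb).
    have -> : y + rc k t *: x0 = rc k (- t) *: (rc k (- t)^-1 *: y - x0).
      by rewrite scalerBr scalerA -rcM mulfV ?gt_eqF// rc1 scale1r rcN scaleNr opprK.
    rewrite p_hom ?(ltW nt0)// => h.
    have : (- t) * ((- t)^-1 * b - p (rc k (- t)^-1 *: y - x0)) <= (- t) * al.
      by rewrite ler_pM2l.
    rewrite mulrBr mulrA mulfV ?gt_eqF// mul1r; lra.
  - have := al2 _ _ (Hscale t^-1 _ _ Hb).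
    have -> : y + rc k t *: x0 = rc k t *: (rc k t^-1 *: y + x0).
      by rewrite scalerDr scalerA -rcM mulfV ?gt_eqF// rc1 scale1r.
    rewrite p_hom ?(ltW t0)// => h.
    have : t * al <= t * (p (rc k t^-1 *: y + x0) - t^-1 * b) by rewrite ler_pM2l.
    rewrite mulrBr mulrA mulfV ?gt_eqF// mul1r; lra.
apply: nx0; exists al; apply: (maxH _ dH').
  by move=> [y a] Ha; exists y, a, 0; split=> //; rewrite rc0 scale0r mul0r !addr0.
by exists 0, 0, 1; split=> //; rewrite rc1 scale1r mul1r !add0r.
Qed.
End RealExtension.

Lemma iu_sqr : iu = 0 \/ iu * iu = -1.
Proof.
case: (k); [by left|right]; apply: reim_eq; rewrite ?reM ?imM re_iu !im_iu ?reN ?imN ?re1 ?im1; ring.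
Qed.

Lemma hahn_banach (Y : set X) (g : X -> F) (C : R) : 0 <= C -> Y 0 ->
  (forall (z : F) x y, Y x -> Y y -> Y (z *: x + y)) ->
  (forall (z : F) x y, Y x -> Y y -> g (z *: x + y) = z * g x + g y) ->
  (forall y, Y y -> nrm (g y : F^o) <= C * nrm y) ->
  exists f : dual X, (forall y, Y y -> f y = g y) /\ forall x, nrm (f x) <= C * nrm x.
Proof.
move=> C0 Y0 Ylin glin gC.
pose p x := C * nrm x.
pose G0 := [set u : X * R | Y u.1 /\ u.2 = re (g u.1)].
have g0 : g 0 = 0.
  by have := glin (-1) 0 0 Y0 Y0; rewrite scaler0 addr0 mulN1r addNr.
have [||||H [dH GH tH]] := @maximal_extension p G0.
- by move=> x y; rewrite /p -mulrDr ler_wpM2l// nrmD.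
- by move=> r x r0; rewrite /p nrmZ nrm_rc ger0_norm// mulrCA.
- by split=> //=; rewrite g0 re0.
- split=> [r x y a b [/= Yx ->] [/= Yy ->]|x a [/= Yx ->]].
    by split=> /=; [exact: Ylin|rewrite glin// reD re_rcM].
  by apply: le_trans (ler_norm _) _; apply: le_trans (nrm_re _) _; exact: gC.
have p_hom r x : 0 <= r -> p (rc k r *: x) = r * p x.
  by move=> r0; rewrite /p nrmZ nrm_rc ger0_norm// mulrCA.
pose u x := sval (cid (tH x)).
have uH x : H (x, u x) by rewrite /u; case: cid.
have uE x a : H (x, a) -> u x = a.
  by move=> Ha; apply/eqP; rewrite eq_le !(dominated_graph_fun p_hom dH (x := x)).
have ulin r x y : u (rc k r *: x + y) = r * u x + u y by apply: uE; exact: dH.1.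
have up x : u x <= p x by apply: dH.2.
have uY y : Y y -> u y = re (g y) by move=> Yy; apply: uE; exact: GH.
have u0 : u 0 = 0 by have := uY 0 Y0; rewrite g0 re0.
have uD x y : u (x + y) = u x + u y by rewrite -{1}[x]scale1r -(rc1 R k) ulin mul1r.
have uZ r x : u (rc k r *: x) = r * u x by rewrite -[_ *: _]addr0 ulin u0 addr0.
(* The scalar-linear functional with real part u; over the reals it is u itself. *)
pose f x : F := rc k (u x) - iu * rc k (u (iu *: x)).
have fD x y : f (x + y) = f x + f y.
  by rewrite /f scalerDr !uD !rcD mulrDr opprD addrACA.
have frc r x : f (rc k r *: x) = rc k r * f x.
  by rewrite /f scalerA (mulrC iu (rc k r)) -scalerA !uZ !rcM mulrBr (mulrCA iu).
have fiu x : f (iu *: x) = iu * f x.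
  rewrite /f scalerA; have [->|i2] := iu_sqr.
    by rewrite !scale0r !mul0r u0 rc0 subr0.
  rewrite i2 scaleN1r -[- x]scale1r scalerN -scaleNr -(rc1 R k) -rcN uZ mulN1r rcN mulrN opprK.
  by rewrite mulrBr mulrA i2 mulN1r opprK addrC.
have fZ z x : f (z *: x) = z * f x.
  rewrite {1}(reim z) scalerDl fD frc -scalerA fiu frc mulrA -mulrDl.
  by rewrite -reim.
have lf : linear (f : X -> F^o) by move=> z x y; rewrite fD fZ.
have ref x : re (f x) = u x by rewrite /f reB reM !reK im_rc re_iu mul0r mulr0 !subr0.
have fC x : nrm (f x : F^o) <= C * nrm x.
  have [->|f0] := eqVneq (f x) 0; first by rewrite nrm0 mulr_ge0 ?nrm_ge0.
  have nf0 : 0 < nrm (f x : F^o) by rewrite nrm_gt0.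
  (* Multiplying x by the conjugate of f x makes the value |f x|^2 real, where u and f agree. *)
  have := up (cj (f x) *: x).
  by rewrite -ref fZ mulrC mulrcj reK expr2 /p nrmZ nrm_cj mulrCA ler_pM2l.
exists (mkbop (f : X -> F^o)); rewrite (mkbopE lf fC); split=> // y Yy.
apply: reim_eq; first by rewrite ref uY.
rewrite /f imB im_rc sub0r imM re_iu mul0r add0r reK im_iu.
have Yi : Y (iu *: y) by rewrite -[_ *: _]addr0; exact: Ylin.
have gi : g (iu *: y) = iu * g y by rewrite -[_ *: _]addr0 glin// g0 addr0.
rewrite uY// gi reM re_iu mul0r sub0r im_iu.
case: (k) (g y) => z; first by rewrite mul0r oppr0.
by rewrite !mul1r opprK.
Qed.

Lemma dual_separates x : x != 0 -> exists f : dual X, f x != 0.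
Proof.
move=> x0.
pose Y := [set y : X | exists z : F, y = z *: x].
pose g y := xget 0 [set z : F | y = z *: x].
have gE z : g (z *: x) = z.
  rewrite /g; case: xgetP => [w _ /= /eqP|/(_ z)]; last by case.
  by rewrite -subr_eq0 -scalerBl scaler_eq0 (negbTE x0) orbF subr_eq0 => /eqP.
have nx : 0 < nrm x by rewrite nrm_gt0.
have [|||||f [fY _]] := @hahn_banach Y g (nrm x)^-1.
- by rewrite invr_ge0 ltW.
- by exists 0; rewrite scale0r.
- by move=> z _ _ [a ->] [b ->]; exists (z * a + b); rewrite scalerDl scalerA.
- by move=> z _ _ [a ->] [b ->]; rewrite scalerA -scalerDl !gE.
- by move=> _ [a ->]; rewrite gE nrmZ mulrC mulfK ?gt_eqF.
exists f; rewrite fY; last by exists 1; rewrite scale1r.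
by rewrite -{1}[x]scale1r gE oner_neq0.
Qed.
End HahnBanach.

(** * Normal functionals and the predual *)

Section NormalFunctionals.
Context (R : realType) (k : scalar_kind) (K : topologicalType).
Local Notation F := (scalars R k).
Local Notation CK := (cfun K F).

Definition fun_normal (f : CK -> F) := forall (U : set K) (e : R), open U -> 0 < e ->
  exists A, [/\ clopen A, A `<=` U & forall b : CK, (forall t, nrm (b t : F^o) <= 1) ->
    (forall t, A t -> b t = 0) -> (forall t, ~ closure U t -> b t = 0) ->
    nrm (f b : F^o) <= e].

Definition nfpred : {pred CK -> F^o} := mem [set f : CK -> F^o |
  [/\ linear f, exists C : R, forall b : CK, (forall t, nrm (b t : F^o) <= 1) -> nrm (f b : F^o) <= C
    & fun_normal f]].

(** Compactness is a parameter of the type because the norm attached to it below separates points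
    through the boundedness of continuous functions. *)
Record nfun (cK : compact [set: K]) := NFun { nf_val :> CK -> F^o; _ : nf_val \in nfpred }.

HB.instance Definition _ (cK : compact [set: K]) := [isSub for (@nf_val cK)].
HB.instance Definition _ (cK : compact [set: K]) := [Choice of nfun cK by <:].

Lemma fun_normalD (f g : CK -> F) : fun_normal f -> fun_normal g ->
  fun_normal (fun b => f b + g b).
Proof.
move=> nf ng U e oU e0; have e2 : 0 < e / 2 by lra.
have [A [cA AU hA]] := nf U _ oU e2; have [B [cB BU hB]] := ng U _ oU e2.
exists (A `|` B); split; [exact: clopenU|by move=> t [/AU|/BU]|].
move=> b b1 bA bU; have h1 := hA b b1 (fun t h => bA t (or_introl h)) bU.
have h2 := hB b b1 (fun t h => bA t (or_intror h)) bU.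
by have := nrmD (f b : F^o) (g b); lra.
Qed.
Lemma fun_normalZ (z : F) (f : CK -> F) : fun_normal f -> fun_normal (fun b => z * f b).
Proof.
move=> nf U e oU e0.
have z0 : 0 < nrm (z : F^o) + 1 by rewrite ltr_wpDl// nrm_ge0.
have ez : 0 < e / (nrm (z : F^o) + 1) by rewrite divr_gt0.
have [A [cA AU hA]] := nf U _ oU ez; exists A; split=> // b b1 bA bU.
rewrite nrmM; have := hA b b1 bA bU; rewrite ler_pdivlMr// mulrC; apply: le_trans.
by rewrite ler_wpM2r ?nrm_ge0// lerDl.
Qed.

Lemma nfpred_subsemimod : subsemimod_closed nfpred.
Proof.
split=> [|c f].
  split=> [|f g]; rewrite !inE /=.
    split.
    - by move=> c x y; rewrite scaler0 addr0.
    - by exists 0 => b _; rewrite nrm0.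
    - by move=> U e oU e0; exists set0; split=> [||b _ _ _]; [exact: clopen0|by []|rewrite nrm0 ltW].
  move=> [lf [Cf hf] nf] [lg [Cg hg] ng]; split.
  - by move=> c x y; rewrite !fctE lf lg scalerDr addrACA.
  - by exists (Cf + Cg) => b b1; apply: le_trans (nrmD _ _) _; apply: lerD; [exact: hf|exact: hg].
  - exact: fun_normalD.
rewrite !inE /= => -[lf [Cf hf] nf]; split.
- by move=> d x y; rewrite !fctE lf scalerDr !scalerA mulrC.
- exists (nrm (c : F^o) * Cf) => b b1.
  change (nrm (c * f b : F^o) <= nrm (c : F^o) * Cf).
  by rewrite nrmM ler_wpM2l ?nrm_ge0// hf.
- exact: fun_normalZ.
Qed.

HB.instance Definition _ (cK : compact [set: K]) :=
  GRing.SubChoice_isSubLmodule.Build _ _ _ (nfun cK) nfpred_subsemimod.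

Section CompactNorm.
Variable cK : compact [set: K].
Local Notation NF := (nfun cK).
Implicit Types (f g : NF) (b c : CK).

Lemma nfP f : [/\ linear f, exists C : R, forall b, (forall t, nrm (b t : F^o) <= 1) -> nrm (f b : F^o) <= C
    & fun_normal f].
Proof. by case: f => f /=; rewrite inE. Qed.
Lemma nf_lin f : linear f. Proof. by have [] := nfP f. Qed.
Lemma nfD f b c : f (b + c) = f b + f c.
Proof. by have := nf_lin f 1 b c; rewrite !scale1r. Qed.
Lemma nf0 f : f 0 = 0. Proof. by apply: (@addrI _ (f 0)); rewrite -nfD !addr0. Qed.
Lemma nfZ f (z : F) b : f (z *: b) = z * f b.
Proof. by have := nf_lin f z b 0; rewrite !addr0 nf0 addr0. Qed.
Lemma nfN f b : f (- b) = - f b. Proof. by rewrite -scaleN1r nfZ mulN1r. Qed.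
Lemma nfB f b c : f (b - c) = f b - f c. Proof. by rewrite nfD nfN. Qed.
Lemma nf_addE f g b : (f + g) b = f b + g b. Proof. by []. Qed.
Lemma nf_scaleE z f b : (z *: f) b = z * f b. Proof. by []. Qed.
Lemma nf_subE f g b : (f - g) b = f b - g b. Proof. by []. Qed.
Lemma nf_oppE f b : (- f) b = - f b. Proof. by []. Qed.
Lemma nf_eq f g : (forall b, f b = g b) -> f = g.
Proof. by move=> fg; apply/val_inj/funext. Qed.

Definition nfnorm f : F := fsup [set `|f b| | b in [set b : CK | forall t, nrm (b t : F^o) <= 1]].
Lemma zero_ball : [set b : CK | forall t, nrm (b t : F^o) <= 1] 0.
Proof. by move=> t; rewrite cfun0 nrm0. Qed.
Lemma nfnorm_sup f :
  supremums [set `|f b| | b in [set b : CK | forall t, nrm (b t : F^o) <= 1]] (nfnorm f).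
Proof.
apply: scalars_fsup.
- by exists `|f 0|, 0 => //; exact: zero_ball.
- by move=> _ [b _ <-].
- have [_ [C hC] _] := nfP f; exists (rc k C) => _ [b b1 <-].
  by rewrite -(nrm_le (f b : F^o)); exact: hC.
Qed.
Lemma nfnorm_ge0 f : 0 <= nfnorm f.
Proof.
have [ub _] := nfnorm_sup f; apply: le_trans (ub `|f 0| _) => //.
by exists 0 => //; exact: zero_ball.
Qed.
Lemma nfnorm_ub f b : (forall t, nrm (b t : F^o) <= 1) -> nrm (f b : F^o) <= re (nfnorm f).
Proof.
move=> b1; rewrite nrm_le -ge0_rc ?nfnorm_ge0//.
by have [ub _] := nfnorm_sup f; apply: ub; exists b.
Qed.
Lemma nfnorm_lub f (r : R) : (forall b, (forall t, nrm (b t : F^o) <= 1) -> nrm (f b : F^o) <= r) ->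
  re (nfnorm f) <= r.
Proof.
move=> h; rewrite -(ler_rc k) -ge0_rc ?nfnorm_ge0//.
have [_ lb] := nfnorm_sup f; apply: lb => _ [b b1 <-].
by rewrite -(nrm_le (f b : F^o)); exact: h.
Qed.

Lemma nfnormD f g : nfnorm (f + g) <= nfnorm f + nfnorm g.
Proof.
rewrite (ge0_rc (nfnorm_ge0 _)) (ge0_rc (nfnorm_ge0 f)) (ge0_rc (nfnorm_ge0 g)) -rcD ler_rc.
apply: nfnorm_lub => b b1; rewrite nf_addE; apply: le_trans (nrmD _ _) _.
by apply: lerD; exact: nfnorm_ub.
Qed.
Lemma nfnormZ (z : F) f : nfnorm (z *: f) = `|z| * nfnorm f.
Proof.
rewrite (ge0_rc (nfnorm_ge0 _)) (ge0_rc (nfnorm_ge0 f)) (nrmE (z : F^o)) -rcM; congr rc.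
have leZ (w : F) g : re (nfnorm (w *: g)) <= nrm (w : F^o) * re (nfnorm g).
  apply: nfnorm_lub => b b1; rewrite nf_scaleE nrmM ler_wpM2l ?nrm_ge0//.
  exact: nfnorm_ub.
apply/eqP; rewrite eq_le leZ /=.
have [->|z0] := eqVneq z 0.
  rewrite nrm0 mul0r; have := nfnorm_ge0 (0 *: f).
  by rewrite ge0_re => /andP[].
have nz : 0 < nrm (z : F^o) by rewrite nrm_gt0.
have := leZ z^-1 (z *: f).
by rewrite scalerA mulVf// scale1r nrmV mulrC ler_pdivlMr// mulrC.
Qed.
Lemma nf_scale_ball f b (r : R) : (forall t, nrm (b t : F^o) <= r) -> 0 < r ->
  nrm (f b : F^o) <= re (nfnorm f) * r.
Proof.
move=> br r0; have := @nfnorm_ub f (rc k r^-1 *: b).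
rewrite nfZ nrmM nrm_rc gtr0_norm ?invr_gt0// mulrC ler_pdivrMr//; apply => t.
change (nrm (rc k r^-1 * b t : F^o) <= 1).
by rewrite nrmM nrm_rc gtr0_norm ?invr_gt0// mulrC ler_pdivrMr// mul1r.
Qed.
Lemma nfnorm_eq0 f : nfnorm f = 0 -> f = 0.
Proof.
move=> f0; apply: nf_eq => b; have [C C0 bC] := cfun_bounded b cK.
have C1 : 0 < C + 1 by lra.
have bC1 t : nrm (b t : F^o) <= C + 1 by have := bC t; lra.
have := nf_scale_ball f bC1 C1.
rewrite f0 re0 mul0r => h; apply: (@nrm0_eq0 R k F^o); apply/eqP.
by rewrite eq_le h nrm_ge0.
Qed.
End CompactNorm.

HB.instance Definition _ (cK : compact [set: K]) := Lmodule_isNormed.Build F (nfun cK)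
  (@nfnormD cK) (@nfnormZ cK) (@nfnorm_eq0 cK).

Section Complete.
Variable cK : compact [set: K].
Local Notation NF := (nfun cK).
Implicit Types (f g : NF) (b c : CK).

Lemma nf_ub1 f b : (forall t, nrm (b t : F^o) <= 1) -> nrm (f b : F^o) <= nrm f.
Proof. exact: nfnorm_ub. Qed.
Lemma nf_lub f (r : R) : (forall b, (forall t, nrm (b t : F^o) <= 1) -> nrm (f b : F^o) <= r) ->
  nrm f <= r.
Proof. exact: nfnorm_lub. Qed.
Lemma nf_ub f b (r : R) : 0 <= r -> (forall t, nrm (b t : F^o) <= r) -> nrm (f b : F^o) <= nrm f * r.
Proof.
move=> r0 br; apply/ler_addgt0Pr => e e0.
have n0 : 0 < nrm f + 1 by rewrite ltr_wpDl// nrm_ge0.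
have d0 : 0 < e / (nrm f + 1) by rewrite divr_gt0.
have rd : 0 < r + e / (nrm f + 1) by lra.
have brd t : nrm (b t : F^o) <= r + e / (nrm f + 1) by have := br t; lra.
have := nf_scale_ball f brd rd.
move=> /le_trans; apply; rewrite -/(nrm f) mulrDr lerD2l.
rewrite mulrCA ger_pMr// ler_pdivrMr// mul1r; lra.
Qed.

Definition mknf (h : CK -> F) : NF :=
  if pselect ((h : CK -> F^o) \in nfpred) is left p then NFun cK p else 0.
Lemma mknfE (h : CK -> F) (C : R) : linear (h : CK -> F^o) ->
  (forall b, (forall t, nrm (b t : F^o) <= 1) -> nrm (h b : F^o) <= C) ->
  fun_normal h -> mknf h = h :> (CK -> F).
Proof.
move=> lh hC nh; rewrite /mknf; case: pselect => // -[]; rewrite inE /=.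
by split=> //; exists C.
Qed.

(** The filter converges at every function, since functions are bounded; convergence is uniform on
    the unit ball, which carries normality over to the limit. *)
Lemma nfun_complete (G : set_system NF) : ProperFilter G -> cauchy G -> cvg G.
Proof.
move=> PG cG.
have hG (e : R) : 0 < e -> exists f, G [set g | nrm (f - g) < e].
  move=> e0; have := (@cauchyP _ _ G PG).1 cG (rc k e); rewrite -(rc0 R k) ltr_rc => /(_ e0)[f hf].
  by exists f; apply: filterS hf => g; rewrite -ball_normE /= -nrm_lt.
have lim b : exists l : F^o, (fun f : NF => f b : F^o) @ G --> l.
  have [C C0 bC] := cfun_bounded b cK.
  have C1 : 0 < C + 1 by lra.
  apply: scalar_cauchy => e e0.
  have [f hf] := hG _ (divr_gt0 e0 C1); exists (f b).
  change (G [set g | nrm (g b - f b : F^o) <= e]).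
  apply: filterS hf => g /=; rewrite -nf_subE nrmC => h.
  apply: le_trans (nf_ub (g - f) C0 bC) _.
  move: h; rewrite ltr_pdivlMr// => /ltW; apply: le_trans.
  by rewrite ler_wpM2l ?nrm_ge0//; lra.
pose L b : F := sval (cid (lim b)).
have LE b (e : R) : 0 < e -> G [set f | nrm (L b - f b : F^o) < e].
  rewrite /L; case: cid => l /= hl e0.
  by move/cvg_nrmP: hl => /(_ e e0).
have close (e : R) : 0 < e -> exists f, G [set g | nrm (f - g) < e] /\
    forall b, (forall t, nrm (b t : F^o) <= 1) -> nrm (L b - f b : F^o) <= e.
  move=> e0; have [f hf] := hG _ e0; exists f; split=> // b b1.
  apply/ler_addgt0Pr => d d0; have [g [h1 h2]] := filter_ex (filterI hf (LE b d d0)).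
  rewrite /= in h1 h2; have := nf_ub1 (f - g) b1; rewrite nf_subE (nrmC (f b : F^o)).
  by have := nrm_tri (g b : F^o) (L b) (f b); lra.
have linL : linear (L : CK -> F^o).
  move=> z b c; apply/eqP; rewrite -subr_eq0; apply/eqP/(@nrm_small R k F^o) => e e0.
  have z0 : 0 < nrm (z : F^o) + 1 by rewrite ltr_wpDl// nrm_ge0.
  have e3 : 0 < e / 3 / (nrm (z : F^o) + 1) by rewrite divr_gt0//; lra.
  have e3' : 0 < e / 3 by lra.
  have [g [[h1 h2] h3]] := filter_ex (filterI (filterI (LE b _ e3) (LE c _ e3')) (LE (z *: b + c) _ e3')).
  rewrite /= in h1 h2 h3.
  have -> : L (z *: b + c) - (z *: (L b : F^o) + L c) =
      (L (z *: b + c) - g (z *: b + c)) - (z * (L b - g b) + (L c - g c)).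
    by rewrite nfD nfZ; change (L (z *: b + c) - (z * L b + L c) = L (z *: b + c) - (z * g b + g c) - (z * (L b - g b) + (L c - g c))); ring.
  have h4 := nrmB (L (z *: b + c) - g (z *: b + c) : F^o) (z * (L b - g b) + (L c - g c)).
  have h5 := nrmD (z * (L b - g b) : F^o) (L c - g c); rewrite nrmM in h5.
  have : nrm (z : F^o) * nrm (L b - g b : F^o) <= e / 3.
    have h : (nrm (z : F^o) + 1) * nrm (L b - g b : F^o) <= e / 3.
      by rewrite mulrC -ler_pdivlMr// ltW.
    by apply: le_trans h; rewrite ler_wpM2r ?nrm_ge0// lerDl.
  move=> hz; apply: le_trans h4 _; rewrite (_ : e = e / 3 + (e / 3 + e / 3)); last by rewrite -!mulrDr; field.
  by apply: lerD; [exact: ltW|apply: le_trans h5 _; apply: lerD; [exact: hz|exact: ltW]].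
have [f1 [_ hf1]] := close 1 ltr01.
have bL b : (forall t, nrm (b t : F^o) <= 1) -> nrm (L b : F^o) <= nrm f1 + 1.
  move=> b1; have := hf1 b b1; have := nf_ub1 f1 b1.
  by have := nrm_sub (L b : F^o) (f1 b); lra.
have nL : fun_normal L.
  move=> U e oU e0; have e2 : 0 < e / 2 by lra.
  have [f [_ hf]] := close _ e2.
  have [_ _ nf] := nfP f; have [A [cA AU hA]] := nf U _ oU e2.
  exists A; split=> // b b1 bA bU; have := hA b b1 bA bU; have := hf b b1.
  by have := nrm_sub (L b : F^o) (f b); lra.
have LK := mknfE linL bL nL.
apply/cvg_ex; exists (mknf L); apply/cvg_nrmP => e e0; have e4 : 0 < e / 4 by lra.
have [f [hf hf2]] := close _ e4; apply: filterS hf => g hg.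
have h1 : nrm (mknf L - f) <= e / 4.
  by apply: nf_lub => b b1; rewrite nf_subE LK; exact: hf2.
rewrite /= in hg *; apply: le_lt_trans (nrm_tri f (mknf L) g) _.
by move: h1 hg; set u := nrm _; set v := nrm _; lra.
Qed.
End Complete.
HB.instance Definition _ (cK : compact [set: K]) :=
  Uniform_isComplete.Build (nfun cK) (@nfun_complete cK).
End NormalFunctionals.

(** * Hahn decomposition and Radon-Nikodym on clopen sets *)

Lemma clopen_setD (T : topologicalType) (A B : set T) : clopen A -> clopen B -> clopen (A `\` B).
Proof. by move=> cA cB; rewrite setDE; apply: clopenI => //; exact: clopenC. Qed.

Section SetFunctions.
Context (R : realType) (K : topologicalType).
Hypotheses (cK : compact [set: K]) (hK : hausdorff_space K) (st : stonian K).
Implicit Types (A B D E : set K) (kap : set K -> R).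

Definition set_additive kap := forall A B, clopen A -> clopen B -> A `&` B = set0 ->
  kap (A `|` B) = kap A + kap B.

Definition set_normal kap := forall U (e : R), open U -> 0 < e ->
  exists A, [/\ clopen A, A `<=` U & forall B, clopen B -> B `<=` closure U ->
    A `&` B = set0 -> `|kap B| <= e].

(** Positive sets in the sense of the Hahn decomposition. *)
Definition posset kap A := forall B, clopen B -> B `<=` A -> 0 <= kap B.

Lemma set_additive0 kap : set_additive kap -> kap set0 = 0.
Proof.
move=> ak; have := ak set0 set0 clopen0 clopen0 (setI0 _).
by rewrite setU0 => h; apply: (@addrI _ (kap set0)); rewrite addr0 -h.
Qed.

Lemma set_additive_split kap A B : set_additive kap -> clopen A -> clopen B ->
  kap A = kap (A `&` B) + kap (A `\` B).
Proof.
move=> ak cA cB; rewrite -ak ?setUIDK//; first exact: clopenI.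
- exact: clopen_setD.
- by apply/seteqP; split=> t // -[[_ Bt] [_]].
Qed.

Lemma set_additiveB kap la (r : R) : set_additive kap -> set_additive la ->
  set_additive (fun A => kap A - r * la A).
Proof. by move=> ak al A B cA cB AB; rewrite ak// al//; lra. Qed.

Lemma set_normalB kap la (r : R) : set_normal kap -> set_normal la ->
  set_normal (fun A => kap A - r * la A).
Proof.
move=> nk nl U e oU e0; have e2 : 0 < e / 2 by lra.
have r1 : 0 < `|r| + 1 by have := normr_ge0 r; lra.
have er : 0 < e / 2 / (`|r| + 1) by rewrite divr_gt0.
have [A [cA AU hA]] := nk U _ oU e2; have [B [cB BU hB]] := nl U _ oU er.
exists (A `|` B); split; [exact: clopenU|by move=> t [/AU|/BU]|].
move=> E cE EU AE.
have AE0 : A `&` E = set0.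
  by apply/seteqP; split=> t // [At Et]; rewrite -AE; split=> //; left.
have BE0 : B `&` E = set0.
  by apply/seteqP; split=> t // [At Et]; rewrite -AE; split=> //; right.
have h1 := hA E cE EU AE0; have h2 := hB E cE EU BE0.
have h3 : `|r| * `|la E| <= e / 2.
  apply: le_trans (_ : (`|r| + 1) * `|la E| <= _); first by rewrite ler_wpM2r// lerDl.
  by rewrite mulrC -ler_pdivlMr.
have := ler_normB (kap E) (r * la E); rewrite normrM.
by move: h1 h3; lra.
Qed.

Lemma posset_cover kap (N : set (set K)) A : set_additive kap -> clopen A ->
  (forall D, N D -> clopen D /\ posset kap D) -> A `<=` \bigcup_(D in N) D -> posset kap A.
Proof.
move=> ak cA hN AN.
suff [D [cD AD pD]] : exists D, [/\ clopen D, A `<=` D & posset kap D].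
  by move=> B cB BA; apply: pD => //; apply: subset_trans BA AD.
apply: (compact_ind (Q := fun S => exists D, [/\ clopen D, S `<=` D & posset kap D])
  (closed_compact cK cA.2)).
- exists set0; split=> [||B cB]; [exact: clopen0|by []|].
  by rewrite subset0 => ->; rewrite set_additive0.
- move=> S1 S2 [D1 [cD1 SD1 p1]] [D2 [cD2 SD2 p2]]; exists (D1 `|` D2); split.
  + exact: clopenU.
  + by apply: setUSS.
  + move=> B cB BD; rewrite (set_additive_split ak cB cD1) addr_ge0//.
      by apply: p1; [exact: clopenI|move=> t []].
    by apply: p2; [exact: clopen_setD|move=> t [/BD[]]].
- by move=> S1 S2 S12 [D [cD SD pD]]; exists D; split=> //; apply: subset_trans S12 SD.
- move=> t /AN [D ND Dt]; have [cD pD] := hN D ND.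
  by exists D; [exact: open_nbhs_nbhs (conj cD.1 Dt)|exists D; split].
Qed.

(** Up to a part of mass at most e, a clopen subset of the closure lies in a compact set covered by
    members of N. *)
Lemma posset_closure kap (N : set (set K)) : set_additive kap -> set_normal kap ->
  (forall D, N D -> clopen D /\ posset kap D) -> posset kap (closure (\bigcup_(D in N) D)).
Proof.
move=> ak nk hN B cB BU; apply/ler_addgt0Pr => e e0.
have oU : open (\bigcup_(D in N) D) by apply: bigcup_open => D /hN[[]].
have [A [cA AU hA]] := nk _ e oU e0.
have h1 : 0 <= kap (B `&` A).
  by apply: (posset_cover ak cA hN AU); [exact: clopenI|move=> t []].
have h2 : `|kap (B `\` A)| <= e.
  apply: hA; [exact: clopen_setD|by move=> t [/BU]|].
  by apply/seteqP; split=> t // [At []].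
rewrite (set_additive_split ak cB cA); have := ler_norm (- kap (B `\` A)); rewrite normrN.
by lra.
Qed.

(* Remove from [B] a maximal disjoint family of clopen sets of negative mass. *)
Lemma posset_inside kap B : set_additive kap -> set_normal kap -> clopen B -> 0 < kap B ->
  exists C, [/\ clopen C, C `<=` B, posset kap C & 0 < kap C].
Proof.
move=> ak nk cB kB.
have [N [NB tN maxN]] := ex_maximal_disjoint_subcollection id
  [set D : set K | [/\ clopen D, D `<=` B & kap D < 0]].
pose U := \bigcup_(D in N) D.
have oU : open U by apply: bigcup_open => D /NB[[]].
have cU := stonian_closure_clopen st oU.
have UB : closure U `<=` B.
  by apply: closure_sub_closed; [exact: cB.2|move=> t [D /NB[_ DB _] Dt]; exact: DB].
have kU : kap (closure U) <= 0.
  apply/ler_addgt0Pr => e e0; rewrite add0r.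
  have [A [cA AU hA]] := nk _ e oU e0.
  (* A is enclosed in a clopen V that contains or misses each member of N. The bound is asked of V
     minus any such W, which lets the compactness induction split a union into disjoint parts. *)
  pose sat W := forall D, N D -> D `<=` W \/ D `&` W = set0.
  have satU W V : sat W -> sat V -> sat (W `|` V).
    move=> sW sV D ND; case: (sW D ND) => [h|h]; first by left=> t /h; left.
    case: (sV D ND) => [h'|h']; first by left=> t /h'; right.
    by right; rewrite setIUr h h' setU0.
  have [V [cV AV sV VU hV]] : exists V, [/\ clopen V, A `<=` V, sat V, V `<=` U &
      forall W, clopen W -> sat W -> kap (V `\` W) <= 0].
    apply: (compact_ind (Q := fun S => exists V, [/\ clopen V, S `<=` V, sat V, V `<=` U &
      forall W, clopen W -> sat W -> kap (V `\` W) <= 0]) (closed_compact cK cA.2)).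
    - exists set0; split=> //; first exact: clopen0.
        by move=> D _; right; rewrite setI0.
      by move=> W _ _; rewrite set0D set_additive0.
    - move=> S1 S2 [V1 [c1 SV1 s1 U1 h1]] [V2 [c2 SV2 s2 U2 h2]]; exists (V1 `|` V2); split.
      + exact: clopenU.
      + exact: setUSS.
      + exact: satU.
      + by move=> t [/U1|/U2].
      + move=> W cW sW.
        rewrite (_ : (V1 `|` V2) `\` W = (V1 `\` W) `|` (V2 `\` (V1 `|` W))); last first.
          apply/seteqP; split=> t /=; last by tauto.
          by move=> [hV nW]; case: (pselect (V1 t)); tauto.
        rewrite ak; [|exact: clopen_setD|apply: clopen_setD => //; exact: clopenU|].
          have a1 := h1 W cW sW.
          have a2 := h2 _ (clopenU c1 cW) (satU _ _ s1 sW).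
          by lra.
        by apply/seteqP; split=> t //= [[h _] [_ ]]; tauto.
    - move=> S1 S2 S12 [V [cV SV sV VU hV]]; exists V; split=> //.
      exact: subset_trans S12 SV.
    - move=> t /AU [D ND Dt]; have [cD DB kD] := NB D ND.
      have dis D' : N D' -> D' = D \/ D' `&` D = set0.
        move=> ND'; case: (pselect (D' `&` D = set0)); first by right.
        by move=> /eqP/set0P h; left; exact: tN.
      exists D; first by apply: open_nbhs_nbhs; split=> //; exact: cD.1.
      exists D; split=> //.
      + by move=> D' /dis[->|]; [left|right].
      + by move=> s Ds; exists D.
      + move=> W cW sW; case: (sW D ND) => h.
          by rewrite (_ : D `\` W = set0) ?set_additive0//; apply/seteqP; split=> s // [/h].
        rewrite (_ : D `\` W = D) ?ltW//; apply/seteqP; split=> s; first by case.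
        by move=> Ds; split=> // Ws; have : (D `&` W) s by []; rewrite h.
  have VcU : V `<=` closure U by apply: subset_trans VU _; exact: subset_closure.
  rewrite (set_additive_split ak cU cV) (_ : closure U `&` V = V `\` set0); last first.
    by rewrite setD0; apply/setIidPr.
  have h1 := hV set0 clopen0 (fun D _ => or_intror (setI0 D)).
  have h2 : `|kap (closure U `\` V)| <= e.
    apply: hA; [exact: clopen_setD|by move=> t []|].
    by apply/seteqP; split=> t // [/AV Vt []].
  by have := ler_norm (kap (closure U `\` V)); lra.
exists (B `\` closure U); split.
- exact: clopen_setD.
- by move=> t [].
- move=> D cD DB; rewrite leNgt; apply/negP => kD.
  have DU t : D t -> ~ U t by move=> /DB[_ h] /subset_closure.
  apply: (maxN (N `|` [set D])).
  + split; first by move=> E NE; left.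
    move=> h; have ND : N D by apply: h; right.
    have D0 : D = set0 by apply/seteqP; split=> t // Dt; apply: (DU t Dt); exists D.
    by move: kD; rewrite D0 set_additive0// ltxx.
  + move=> E [/NB//|->]; split=> //; by move=> t /DB[].
  + move=> E E' [NE|->] [NE'|->] [t [Et E't]] //.
    * by apply: tN => //; exists t.
    * by case: (DU t E't); exists E.
    * by case: (DU t Et); exists E'.
- have := set_additive_split ak cB cU; rewrite (_ : B `&` closure U = closure U); last exact/setIidPr.
  by lra.
Qed.

Section Family.
Context (I : Type) (kap : I -> set K -> R).
Hypotheses (ak : forall i, set_additive (kap i)) (nk : forall i, set_normal (kap i)).
Hypothesis transfer : forall i D, clopen D -> posset (kap i) D -> 0 < kap i D ->
  exists D', [/\ clopen D', D' `<=` D, D' !=set0 & forall j, posset (kap j) D'].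

(** The largest clopen set that is positive for all indices at once. Through [transfer] it also
    serves as the positive part in the Hahn decomposition of each single [kap i]. *)
Definition common_pos := closure (\bigcup_(D in [set D | clopen D /\ forall j, posset (kap j) D]) D).

Lemma common_pos_clopen : clopen common_pos.
Proof. by apply: stonian_closure_clopen => //; apply: bigcup_open => D [[]]. Qed.

Lemma common_pos_ge0 j : posset (kap j) common_pos.
Proof. by apply: posset_closure => // D [cD hD]. Qed.

Lemma common_pos_sub D : clopen D -> (forall j, posset (kap j) D) -> D `<=` common_pos.
Proof. by move=> cD hD t Dt; apply: subset_closure; exists D. Qed.

(** A part of positive mass outside would contain a set positive for i, by [posset_inside], and then
    by [transfer] a nonempty set positive for all indices. *)
Lemma common_pos_out i B : clopen B -> B `&` common_pos = set0 -> kap i B <= 0.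
Proof.
move=> cB B0; rewrite leNgt; apply/negP => kB.
have [C [cC CB pC kC]] := posset_inside (ak i) (nk i) cB kB.
have [D [cD DC [t Dt] hD]] := transfer cC pC kC.
have : (B `&` common_pos) t by split; [exact/CB/DC|exact: common_pos_sub hD t Dt].
by rewrite B0.
Qed.
End Family.

Lemma set_hahn_decomposition kap : set_additive kap -> set_normal kap ->
  exists P, [/\ clopen P, posset kap P & forall B, clopen B -> B `&` P = set0 -> kap B <= 0].
Proof.
move=> ak nk; exists (common_pos (fun _ : unit => kap)); split.
- exact: common_pos_clopen.
- by apply: (common_pos_ge0 (kap := fun _ : unit => kap)) => [i|i|]//; exact: tt.
- move=> B cB B0; apply: (@common_pos_out unit (fun _ => kap) _ _ _ tt) => // _ D cD pD kD.
  exists D; split=> //; apply/set0P/eqP => D0.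
  by move: kD; rewrite D0 set_additive0// ltxx.
Qed.

(* The hypothesis [transfer] makes the sets {a >= r} independent of the index, so
   that one density serves all pairs [(nu i, la i)]. *)
Section RadonNikodym.
Context (I : Type) (nu la : I -> set K -> R) (c C : R).
Hypotheses (an : forall i, set_additive (nu i)) (nn : forall i, set_normal (nu i)).
Hypotheses (al : forall i, set_additive (la i)) (nl : forall i, set_normal (la i)).
Hypothesis la0 : forall i A, clopen A -> 0 <= la i A.
Hypothesis dom : forall i A, clopen A -> c * la i A <= nu i A <= C * la i A.
Hypothesis cC : c <= C.
Let kap r i A := nu i A - r * la i A.
Hypothesis transfer : forall r i D, clopen D -> posset (kap r i) D -> 0 < kap r i D ->
  exists D', [/\ clopen D', D' `<=` D, D' !=set0 & forall j, posset (kap r j) D'].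

Let P r := common_pos (kap r).
Let ak r i : set_additive (kap r i). Proof. exact: set_additiveB. Qed.
Let nk r i : set_normal (kap r i). Proof. exact: set_normalB. Qed.

Let P_mono r s : r <= s -> P s `<=` P r.
Proof.
move=> rs; apply: common_pos_sub; first exact: common_pos_clopen.
move=> j B cB BP; have := common_pos_ge0 (ak s) (nk s) j cB BP; rewrite /kap.
have := ler_wpM2r (la0 j cB) rs; lra.
Qed.

Let S t := [set r | c <= r <= C /\ P r t].
Let S_sup t : has_sup (S t).
Proof.
split; last by exists C => r [/andP[]].
exists c; split; first by rewrite lexx.
apply: (@common_pos_sub _ (kap c) setT) => //; first exact: clopenT.
by move=> j B cB _; rewrite /kap subr_ge0; have /andP[] := dom j cB.
Qed.

(** The density is recovered from its level sets: a t is the supremum of the r in [c, C] with t in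
    [P r]. These sets are clopen and decrease in r, which makes a continuous. *)
Lemma radon_nikodym : exists a : K -> R, [/\ forall t, c <= a t <= C,
  forall t (e : R), 0 < e -> \forall s \near t, `|a t - a s| < e,
  forall i A (r : R), clopen A -> (forall t, A t -> a t <= r) -> nu i A <= r * la i A
  & forall i A (r : R), clopen A -> (forall t, A t -> r <= a t) -> r * la i A <= nu i A].
Proof.
pose a t := sup (S t).
have aP t r : c <= r <= C -> P r t -> r <= a t.
  by move=> h1 h2; apply: (sup_upper_bound (S_sup t)); split.
have Pa t r : r < a t -> P r t.
  move=> /(sup_gt (S_sup t).1) [s [_ Ps] rs]; exact: P_mono (ltW rs) t Ps.
have ale t r : (forall s, c <= s <= C -> P s t -> s <= r) -> a t <= r.
  by move=> h; apply: ge_sup; [exact: (S_sup t).1|move=> s [h1 h2]; exact: h].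
have aC t : c <= a t <= C.
  apply/andP; split; last by apply: ale => s /andP[].
  have [[r [h Pr]] _] := S_sup t; apply: le_trans (aP t r h Pr); by case/andP: h.
exists a; split.
- by [].
- move=> t e e0.
  have h1 : \forall s \near t, a t - e / 2 <= a s.
    case: (ltP (a t - e / 2) c) => h.
      by near=> s; have /andP[h' _] := aC s; lra.
    have hP : P (a t - e / 2) t by apply: Pa; lra.
    have oP : nbhs t (P (a t - e / 2)).
      by apply: open_nbhs_nbhs; split=> //; exact: (common_pos_clopen _).1.
    apply: filterS oP => s; apply: aP; have := aC t; lra.
  have h2 : \forall s \near t, a s <= a t + e / 2.
    case: (ltP C (a t + e / 2)) => h.
      by near=> s; have /andP[_ h'] := aC s; lra.
    have hP : ~ P (a t + e / 2) t.
      move=> /aP h'; have : a t + e / 2 <= a t by apply: h'; have := aC t; lra.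
      by lra.
    have oP : nbhs t (~` P (a t + e / 2)).
      apply: open_nbhs_nbhs; split=> //; apply: (clopenC set0 _).1; exact: common_pos_clopen.
    apply: filterS oP => s nP; apply: ale => r _ Pr; rewrite leNgt; apply/negP => hr.
    by apply: nP; exact: P_mono (ltW hr) s Pr.
  apply: filterS2 h1 h2 => s h1 h2; rewrite ltr_norml; lra.
- move=> i A r cA hA.
  (* From a t <= r it follows that t is outside [P s] for s > r only; the bound with r itself is
     reached in the limit. *)
  have key s : r < s -> nu i A <= s * la i A.
    move=> rs; case: (ltP C s) => Cs.
      have := dom i cA; have := ler_wpM2r (la0 i cA) (ltW Cs); lra.
    case: (ltP s c) => Cs'.
      have A0 : A = set0 by apply/seteqP; split=> t // /hA; have := aC t; lra.
      by rewrite A0 !set_additive0// mulr0.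
    suff : kap s i A <= 0 by rewrite /kap; lra.
    apply: (@common_pos_out I (kap s) (ak s) (nk s) (@transfer s) i A cA).
    apply/seteqP; split=> t // [/hA h Pt].
    have := aP t s _ Pt; rewrite Cs Cs' => /(_ isT); lra.
  apply/ler_addgt0Pr => e e0.
  have l1 : 0 < la i A + 1 by have := la0 i cA; lra.
  have := key (r + e / (la i A + 1)); rewrite ltrDl divr_gt0// => /(_ isT) h.
  apply: le_trans h _; rewrite mulrDl lerD2l mulrAC ler_pdivrMr// ler_wpM2l ?ltW//; lra.
- move=> i A r cA hA.
  have key s : s < r -> s * la i A <= nu i A.
    move=> sr; suff : 0 <= kap s i A by rewrite /kap; lra.
    apply: (common_pos_ge0 (ak s) (nk s) i cA) => t /hA h; apply: Pa; lra.
  apply/ler_addgt0Pr => e e0.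
  have l1 : 0 < la i A + 1 by have := la0 i cA; lra.
  have d0 : 0 < e / (la i A + 1) by rewrite divr_gt0.
  have := key (r - e / (la i A + 1)); rewrite gtrBl d0 => /(_ isT) h.
  have : e / (la i A + 1) * la i A <= e.
    rewrite mulrAC ler_pdivrMr// ler_wpM2l ?ltW//; lra.
  by move: h; rewrite mulrBl; lra.
Unshelve. all: by end_near. Qed.
End RadonNikodym.
End SetFunctions.

(** * Real parts and positive normal functionals *)

Section RealParts.
Context (R : realType) (k : scalar_kind) (K : topologicalType).
Local Notation F := (scalars R k).
Local Notation CK := (cfun K F).
Implicit Types (b c : CK).

Lemma im_iuM (z : F) : im z * im (iu R k) = im z.
Proof. by rewrite im_iu; case: k z => z /=; rewrite ?mulr1 ?mulr0. Qed.

Lemma rc_fun_cts (h : K -> R) :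
  (forall t (e : R), 0 < e -> \forall s \near t, `|h t - h s| < e) ->
  continuous (fun t => rc k (h t) : F^o).
Proof.
move=> ch; apply/cts_nrmP => t e e0; apply: filterS (ch t e e0) => s hs.
change (nrm (rc k (h t) - rc k (h s) : F^o) < e).
by rewrite -rcB nrm_rc.
Qed.

Definition cre b : CK := cf (fun t => rc k (re (b t))).
Definition cim b : CK := cf (fun t => rc k (im (b t))).
Lemma creE b t : cre b t = rc k (re (b t)).
Proof.
rewrite /cre cfE//; apply: rc_fun_cts => {}t e e0.
have /cts_nrmP h := cfun_cts b; apply: filterS (h t e e0) => s.
by apply: le_lt_trans; rewrite -reB; exact: nrm_re.
Qed.
Lemma cimE b t : cim b t = rc k (im (b t)).
Proof.
rewrite /cim cfE//; apply: rc_fun_cts => {}t e e0.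
have /cts_nrmP h := cfun_cts b; apply: filterS (h t e e0) => s.
by apply: le_lt_trans; rewrite -imB; exact: nrm_im.
Qed.
Lemma cre_cim b : b = cre b + iu R k *: cim b.
Proof. by apply: cfun_eq => t; rewrite cfunD cfunZ creE cimE -reim. Qed.
Lemma nrm_cre b t : nrm (cre b t : F^o) <= nrm (b t : F^o).
Proof. by rewrite creE nrm_rc nrm_re. Qed.
Lemma nrm_cim b t : nrm (cim b t : F^o) <= nrm (b t : F^o).
Proof. by rewrite cimE nrm_rc nrm_im. Qed.
Lemma cre_real b : (forall t, im (b t) = 0) -> cre b = b /\ cim b = 0.
Proof.
move=> b0; split; apply: cfun_eq => t.
  by rewrite creE; apply: reim_eq; rewrite ?reK ?im_rc ?b0.
by rewrite cimE b0 rc0 cfun0.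
Qed.
Lemma creZD (z : F) b c : cre (z *: b + c) = rc k (re z) *: cre b - rc k (im z) *: cim b + cre c.
Proof.
apply: cfun_eq => t; rewrite !(cfunD, cfunN, cfunZ, creE, cimE) -!rcM -rcB -rcD; congr rc.
by rewrite reD reM.
Qed.
Lemma cimZD (z : F) b c : cim (z *: b + c) = rc k (re z) *: cim b + rc k (im z) *: cre b + cim c.
Proof.
apply: cfun_eq => t; rewrite !(cfunD, cfunN, cfunZ, creE, cimE) -!rcM -!rcD; congr rc.
by rewrite imD imM.
Qed.
End RealParts.

Lemma cfun_scaleAl (R : realType) (k : scalar_kind) (K : topologicalType) (z : scalars R k)
  (a b : cfun K (scalars R k)) : (z *: a) * b = z *: (a * b).
Proof. by apply: cfun_eq => t; rewrite !(cfunM, cfunZ) mulrA. Qed.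
Lemma cfun_scaleAr (R : realType) (k : scalar_kind) (K : topologicalType) (z : scalars R k)
  (a b : cfun K (scalars R k)) : a * (z *: b) = z *: (a * b).
Proof. by rewrite mulrC cfun_scaleAl mulrC. Qed.

Lemma inverse_on (R : realType) (k : scalar_kind) (K : topologicalType) (a : cfun K (scalars R k))
  (A : set K) : clopen A -> (forall t, A t -> a t != 0) ->
  exists v : cfun K (scalars R k), (forall t, A t -> v t = (a t)^-1) /\ forall t, ~ A t -> v t = 0.
Proof.
move=> cA a0; pose h t : scalars R k := if t \in A then (a t)^-1 else 0.
suff ch : continuous (h : K -> (scalars R k)^o).
  exists (cf h); split=> t At; rewrite cfE// /h; first by rewrite mem_set.
  by rewrite memNset.
apply: (@cts_nrmP R k K _).2 => t d d0; case: (pselect (A t)) => At.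
  have hV : (fun u => (a u)^-1 : (scalars R k)^o) @ t --> ((a t)^-1 : (scalars R k)^o).
    by apply: cvgV; [exact: a0|exact: cfun_cts].
  have hV' : \forall u \near t, nrm ((a t)^-1 - (a u)^-1 : (scalars R k)^o) < d.
    by move/cvg_nrmP: hV => /(_ d d0).
  apply: filterS2 hV' (open_nbhs_nbhs (conj cA.1 At)) => u hu Au.
  by rewrite /h !mem_set.
apply: filterS (open_nbhs_nbhs (conj (clopenC set0 cA).1 At)) => u Au.
by rewrite /h !memNset// subrr nrm0.
Qed.

Section Positive.
Context (R : realType) (k : scalar_kind) (K : topologicalType).
Hypotheses (cK : compact [set: K]) (hK : hausdorff_space K) (st : stonian K).
Local Notation F := (scalars R k).
Local Notation CK := (cfun K F).
Local Notation ind := (ind R k).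
Local Notation NF := (@nfun R k K cK).
Implicit Types (b c p a : CK) (f g : NF) (A B D : set K).

(** Step functions enter only through the closure properties of [Good], to be instantiated by the
    property to be shown. The coefficients are values of b, so that they are nonnegative if b is.
    The induction keeps an approximant on a clopen set and 0 off it. *)
Lemma simple_approx (Good : CK -> Prop) b (d : R) : 0 < d -> Good 0 ->
  (forall s s', Good s -> Good s' -> Good (s + s')) ->
  (forall s A, clopen A -> Good s -> Good (s * ind A)) ->
  (forall t A, clopen A -> Good (b t *: ind A)) ->
  exists s, Good s /\ forall t, nrm (b t - s t : F^o) <= d.
Proof.
move=> d0 G0 GD GM Gi.
suff [A [s [cA TA Gs As _]]] : exists A s, [/\ clopen A, setT `<=` A, Good s,
    forall t, A t -> nrm (b t - s t : F^o) <= d & forall t, ~ A t -> s t = 0].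
  by exists s; split=> // t; exact/As/TA.
apply: (compact_ind (Q := fun S => exists A s, [/\ clopen A, S `<=` A, Good s,
    forall t, A t -> nrm (b t - s t : F^o) <= d & forall t, ~ A t -> s t = 0]) cK).
- by exists set0, 0; split=> //; exact: clopen0.
- move=> S1 S2 [A1 [s1 [c1 SA1 g1 h1 o1]]] [A2 [s2 [c2 SA2 g2 h2 o2]]].
  have c1' := clopenC set0 c1.
  exists (A1 `|` A2), (s1 + s2 * ind (~` A1)); split.
  + exact: clopenU.
  + exact: setUSS.
  + exact/GD/GM.
  + move=> t At; rewrite cfunD cfunM; case: (pselect (A1 t)) => A1t.
      by rewrite (ind_out R k c1')// mulr0 addr0; exact: h1.
    rewrite ind_in// mulr1 o1// add0r; apply: h2; by case: At.
  + by move=> t /not_orP[n1 n2]; rewrite cfunD cfunM o1// o2// mul0r addr0.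
- move=> S1 S2 S12 [A [s [cA SA gs hs os]]]; exists A, s; split=> //.
  exact: subset_trans S12 SA.
- move=> t _; have /cts_nrmP h := cfun_cts b.
  have [A [cA At AW]] := zd_basis cK hK (stonian_zd hK st) (h t d d0).
  exists A; first exact: open_nbhs_nbhs (conj cA.1 At).
  exists A, (b t *: ind A); split=> //; first exact: Gi.
    by move=> s As; rewrite cfunZ ind_in// mulr1 nrmC ltW//; exact: AW.
  by move=> s As; rewrite cfunZ ind_out// mulr0.
Qed.

Lemma nf_ind0 f : (forall A, clopen A -> f (ind A) = 0) -> f = 0.
Proof.
move=> f0; apply: nf_eq => b; apply/(@nrm_small R k F^o) => e e0.
have n1 : 0 < nrm f + 1 by rewrite ltr_wpDl// nrm_ge0.
have d0 : 0 < e / (nrm f + 1) by rewrite divr_gt0.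
(* Quantifying over A makes the property stable under restriction to clopen sets; A = K is used in
   the end. *)
have [|s s' h h' A cA|s A cA h B cB|t A cA B cB|s [Gs hs]] :=
  @simple_approx (fun s => forall A, clopen A -> f (s * ind A) = 0) b _ d0.
- by move=> A _; rewrite mul0r nf0.
- by rewrite mulrDl nfD h// h'// addr0.
- by rewrite -mulrA ind_mul// h//; exact: clopenI.
- by rewrite cfun_scaleAl ind_mul// nfZ f0 ?mulr0//; exact: clopenI.
have fs : f s = 0 by have := Gs setT clopenT; rewrite indT mulr1.
have := @nf_ub R k K cK f (b - s) _ (ltW d0) hs; rewrite nfB fs subr0 => /le_trans; apply.
by rewrite mulrCA ger_pMr// ler_pdivrMr// mul1r lerDl.
Qed.

Definition nfpos f := forall b, (forall t, 0 <= b t) -> 0 <= f b.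

Lemma nf_pos_ind f : (forall A, clopen A -> 0 <= f (ind A)) -> nfpos f.
Proof.
move=> f0 b b0; apply: ge0_closed_nrm => e e0.
have n1 : 0 < nrm f + 1 by rewrite ltr_wpDl// nrm_ge0.
have d0 : 0 < e / 2 / (nrm f + 1) by rewrite !divr_gt0.
have [|s s' h h' A cA|s A cA h B cB|t A cA B cB|s [Gs hs]] :=
  @simple_approx (fun s => forall A, clopen A -> 0 <= f (s * ind A)) b _ d0.
- by move=> A _; rewrite mul0r nf0.
- by rewrite mulrDl nfD addr_ge0// ?h// h'.
- by rewrite -mulrA ind_mul// h//; exact: clopenI.
- by rewrite cfun_scaleAl ind_mul// nfZ mulr_ge0//; apply: f0; exact: clopenI.
exists (f s); first by have := Gs setT clopenT; rewrite indT mulr1.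
have := @nf_ub R k K cK f (b - s) _ (ltW d0) hs; rewrite nfB => /le_lt_trans; apply.
apply: le_lt_trans (_ : e / 2 < e); last by lra.
rewrite mulrCA ger_pMr//; last by lra.
by rewrite ler_pdivrMr// mul1r lerDl.
Qed.

(** For a real b bounded by C, both C and C + b are nonnegative functions. *)
Lemma nfpos_real f b : nfpos f -> (forall t, im (b t) = 0) -> im (f b) = 0.
Proof.
move=> pf b0; have [C C0 bC] := cfun_bounded b cK.
have h1 : 0 <= f (rc k C *: (1 : CK)).
  by apply: pf => t; rewrite cfunZ cfun1 mulr1 rc_ge0.
have h2 : 0 <= f (rc k C *: (1 : CK) + b).
  apply: pf => t; rewrite cfunD cfunZ cfun1 mulr1 ge0_re reD imD b0 im_rc addr0 eqxx andbT reK.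
  by have := nrm_re (b t); have := bC t; rewrite ler_norml; lra.
move: h1 h2; rewrite nfD !ge0_re imD => /andP[_ /eqP ->] /andP[_ /eqP].
by rewrite add0r.
Qed.

Definition mass f A : R := re (f (ind A)).

Lemma mass_ge0 f A : nfpos f -> clopen A -> 0 <= mass f A.
Proof.
move=> pf cA; have : 0 <= f (ind A) by apply: pf => t; have /andP[] := ind_01 R k t cA.
by rewrite ge0_re => /andP[].
Qed.

Lemma nfpos_le f b (ar : R) A : nfpos f -> clopen A -> (forall t, im (b t) = 0) ->
  (forall t, A t -> re (b t) <= ar) -> (forall t, ~ A t -> b t = 0) ->
  re (f b) <= ar * mass f A.
Proof.
move=> pf cA b0 bA bo; have : 0 <= f (rc k ar *: ind A - b).
  apply: pf => t; rewrite cfunB cfunZ; case: (pselect (A t)) => At.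
    by rewrite ind_in// mulr1 ge0_re reB imB b0 im_rc subr0 eqxx andbT reK subr_ge0 bA.
  by rewrite ind_out// mulr0 bo// subr0.
by rewrite ge0_re nfB nfZ reB re_rcM subr_ge0 => /andP[].
Qed.

Lemma nfpos_ge f b (ar : R) A : nfpos f -> clopen A -> (forall t, im (b t) = 0) ->
  (forall t, A t -> ar <= re (b t)) -> (forall t, ~ A t -> b t = 0) ->
  ar * mass f A <= re (f b).
Proof.
move=> pf cA b0 bA bo.
have := @nfpos_le f (- b) (- ar) A pf cA; rewrite nfN reN mulNr lerN2; apply.
- by move=> t; rewrite cfunN imN b0 oppr0.
- by move=> t At; rewrite cfunN reN lerN2 bA.
- by move=> t At; rewrite cfunN bo// oppr0.
Qed.

(** The factor 2 accounts for the real and the imaginary part of b. *)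
Lemma nfpos_bound f b A : nfpos f -> clopen A -> (forall t, nrm (b t : F^o) <= 1) ->
  (forall t, ~ A t -> b t = 0) -> nrm (f b : F^o) <= 2 * mass f A.
Proof.
move=> pf cA b1 bo.
have key c : (forall t, im (c t) = 0) -> (forall t, nrm (c t : F^o) <= 1) ->
    (forall t, ~ A t -> c t = 0) -> nrm (f c : F^o) <= mass f A.
  move=> c0 c1 co; rewrite (reim (f c)) (nfpos_real pf c0) rc0 mulr0 addr0 nrm_rc ler_norml.
  have hc t : -1 <= re (c t) <= 1 by rewrite -ler_norml; apply: le_trans (nrm_re _) (c1 t).
  have h1 : re (f c) <= 1 * mass f A by apply: nfpos_le => // t _; have /andP[] := hc t.
  have h2 : -1 * mass f A <= re (f c) by apply: nfpos_ge => // t _; have /andP[] := hc t.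
  by lra.
have h1 : nrm (f (cre b) : F^o) <= mass f A.
  apply: key => t; rewrite ?creE ?im_rc//; last by move=> /bo->; rewrite re0 rc0.
  by rewrite -creE; exact: le_trans (nrm_cre _ _) (b1 t).
have h2 : nrm (f (cim b) : F^o) <= mass f A.
  apply: key => t; rewrite ?cimE ?im_rc//; last by move=> /bo->; rewrite im0 rc0.
  by rewrite -cimE; exact: le_trans (nrm_cim _ _) (b1 t).
rewrite {1}(cre_cim b) nfD nfZ; have := nrmD (f (cre b) : F^o) (iu R k * f (cim b)).
rewrite nrmM; have := ler_wpM2r (nrm_ge0 (f (cim b) : F^o)) (nrm_iu R k).
by move: h1 h2; set u := nrm _; set v := nrm (f (cim b) : F^o); set w := nrm (iu _ _ : F^o); lra.
Qed.

(** The action of C(K) on the normal functionals; for p = [ind A] it restricts f to A. *)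
Definition nf_cut p f : NF := mknf cK (fun b => f (p * b)).
Lemma nf_cutE p f b : nf_cut p f b = f (p * b).
Proof.
have [C C0 pC] := cfun_bounded p cK.
have C1 : 0 < C + 1 by lra.
rewrite /nf_cut (@mknfE R k K cK _ (nrm f * C))//.
- move=> z x y; rewrite mulrDr cfun_scaleAr nfD nfZ //.
- move=> c c1; apply: nf_ub => // t; rewrite cfunM nrmM.
  by apply: le_trans (ler_piMr _ (c1 t)) (pC t); rewrite nrm_ge0.
- move=> U e oU e0; have [_ _ nf] := nfP f.
  have [A [cA AU hA]] := nf U _ oU (divr_gt0 e0 C1).
  exists A; split=> // c c1 cA0 cU.
  have := hA (rc k (C + 1)^-1 *: (p * c)); rewrite nfZ nrmM nrm_rc gtr0_norm ?invr_gt0//.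
  rewrite [e / _]mulrC ler_pM2l ?invr_gt0//; apply.
  + move=> t; rewrite cfunZ cfunM !nrmM nrm_rc gtr0_norm ?invr_gt0// mulrC ler_pdivrMr// mul1r.
    apply: le_trans (ler_piMr _ (c1 t)) _; first by rewrite nrm_ge0.
    by have := pC t; lra.
  + by move=> t At; rewrite cfunZ cfunM cA0// !mulr0.
  + by move=> t At; rewrite cfunZ cfunM cU// !mulr0.
Qed.

Lemma nf_cut_norm p f (r : R) : 0 <= r -> (forall t, nrm (p t : F^o) <= r) ->
  nrm (nf_cut p f) <= nrm f * r.
Proof.
move=> r0 pr; apply: nf_lub => b b1; rewrite nf_cutE; apply: nf_ub => // t; rewrite cfunM nrmM.
by apply: le_trans (ler_piMr _ (b1 t)) (pr t); rewrite nrm_ge0.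
Qed.

Lemma nf_cut_ind_norm f A : nfpos f -> clopen A -> nrm (nf_cut (ind A) f) <= 2 * mass f A.
Proof.
move=> pf cA; apply: nf_lub => b b1; rewrite nf_cutE; apply: nfpos_bound => // t.
  rewrite cfunM nrmM; apply: le_trans (ler_piMl _ (nrm_ind R k t cA)) (b1 t).
  by rewrite nrm_ge0.
by move=> At; rewrite cfunM ind_out// mul0r.
Qed.

Lemma nf_cutDl p q f : nf_cut (p + q) f = nf_cut p f + nf_cut q f.
Proof. by apply: nf_eq => b; rewrite nf_addE !nf_cutE mulrDl nfD. Qed.
Lemma nf_cutZl (z : F) p f : nf_cut (z *: p) f = z *: nf_cut p f.
Proof. by apply: nf_eq => b; rewrite nf_scaleE !nf_cutE cfun_scaleAl nfZ. Qed.
Lemma nf_cut1 f : nf_cut 1 f = f.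
Proof. by apply: nf_eq => b; rewrite nf_cutE mul1r. Qed.

Section Functional.
Variable h : F -> R.
Hypotheses (hD : forall z w, h (z + w) = h z + h w) (hle : forall z, `|h z| <= nrm (z : F^o)).

(** Here [h] stands for the real or the imaginary part, so that both are treated at once. *)
Lemma nf_set_additive f : set_additive (fun A => h (f (ind A))).
Proof. by move=> A B cA cB AB; rewrite indU// nfD hD. Qed.

Lemma nf_set_normal f : set_normal (fun A => h (f (ind A))).
Proof.
move=> U e oU e0; have [_ _ nf] := nfP f; have [A [cA AU hA]] := nf U e oU e0.
exists A; split=> // B cB BU AB; apply: le_trans (hle _) _; apply: hA.
- by move=> t; exact: nrm_ind.
- by move=> t At; rewrite ind_out// => Bt; have : (A `&` B) t by []; rewrite AB.
- by move=> t Ut; rewrite ind_out// => /BU.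
Qed.
End Functional.

Lemma mass_additive f : set_additive (mass f).
Proof. exact: (nf_set_additive (@reD R k)). Qed.
Lemma mass_normal f : set_normal (mass f).
Proof. exact: (nf_set_normal (@nrm_re R k)). Qed.

Lemma set_normal_dom (nu la : set K -> R) (C : R) : 0 <= C -> set_normal la ->
  (forall A, clopen A -> `|nu A| <= C * la A) -> set_normal nu.
Proof.
move=> C0 nl dom U e oU e0; have C1 : 0 < C + 1 by lra.
have [A [cA AU hA]] := nl U _ oU (divr_gt0 e0 C1).
exists A; split=> // B cB BU AB; apply: le_trans (dom B cB) _.
have := hA B cB BU AB; rewrite ler_pdivlMr// => /(le_trans _); apply.
rewrite mulrC; apply: le_trans (ler_wpM2r C0 (ler_norm (la B))) _.
by rewrite ler_wpM2l//; lra.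
Qed.

(** The clopen sets of mass 0 are positive sets of the negated mass, so by [posset_closure] the
    closure of their union has mass 0 as well; S is its complement. *)
Lemma nf_carrier f : nfpos f -> exists S, [/\ clopen S, f (ind (~` S)) = 0 &
  forall B, clopen B -> B `<=` S -> mass f B <= 0 -> B = set0].
Proof.
move=> pf; pose N := [set D | clopen D /\ mass f D <= 0].
pose kap A := - mass f A.
have ak : set_additive kap by move=> A B cA cB AB; rewrite /kap mass_additive// opprD.
have nk : set_normal kap.
  move=> U e oU e0; have [A [cA AU hA]] := mass_normal f oU e0.
  by exists A; split=> // B cB BU AB; rewrite normrN; exact: hA.
have hN D : N D -> clopen D /\ posset kap D.
  move=> [cD mD]; split=> // B cB BD; rewrite oppr_ge0; apply: le_trans mD.
  rewrite (set_additive_split (mass_additive f) cD cB) (_ : D `&` B = B); last exact/setIidPr.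
  by rewrite lerDl mass_ge0//; exact: clopen_setD.
have oU : open (\bigcup_(D in N) D) by apply: bigcup_open => D [[]].
have cE := stonian_closure_clopen st oU.
exists (~` closure (\bigcup_(D in N) D)); split.
- exact: (clopenC set0 cE).
- rewrite setCK; have := posset_closure cK ak nk hN cE (@subset_refl _ _).
  rewrite oppr_ge0 => h; apply: reim_eq.
    by rewrite re0; apply/eqP; rewrite eq_le h mass_ge0.
  rewrite im0; apply: nfpos_real => // t; case: (pselect (closure (\bigcup_(D in N) D) t)) => Et.
    by rewrite ind_in// im1.
  by rewrite ind_out// im0.
- move=> B cB BS mB; apply/seteqP; split=> t // Bt; apply: (BS t Bt).
  by apply: subset_closure; exists B.
Qed.

(** On a clopen set B where a is within e / 2 of a t, both sides lie between a t - e / 2 and a t + e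
    / 2 times the mass of B, hence differ by at most e times that mass. This bound is additive, and
    compactness extends it to all of K. *)
Lemma rn_integral f (nu : set K -> R) (ar : K -> R) a : nfpos f -> set_additive nu ->
  (forall t, a t = rc k (ar t)) ->
  (forall A (r : R), clopen A -> (forall t, A t -> ar t <= r) -> nu A <= r * mass f A) ->
  (forall A (r : R), clopen A -> (forall t, A t -> r <= ar t) -> r * mass f A <= nu A) ->
  forall A, clopen A -> nu A = re (f (a * ind A)).
Proof.
move=> pf an aE hu hl A0 cA0.
pose th A := nu A - re (f (a * ind A)).
have ath : set_additive th.
  by move=> A B cA cB AB; rewrite /th an// indU// mulrDr nfD reD; lra.
have small (e : R) : 0 < e -> `|th A0| <= e * mass f A0.
  move=> e0.
  suff [D [cD TD hD]] : exists D, [/\ clopen D, setT `<=` D & forall B, clopen B -> B `<=` D ->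
    `|th B| <= e * mass f B] by apply: hD => // t _; exact: TD.
  apply: (compact_ind (Q := fun S => exists D, [/\ clopen D, S `<=` D & forall B, clopen B ->
    B `<=` D -> `|th B| <= e * mass f B]) cK).
  - exists set0; split=> [||B cB]; [exact: clopen0|by []|].
    rewrite subset0 => ->; rewrite !set_additive0 ?normr0 ?mulr0//; exact: mass_additive.
  - move=> S1 S2 [D1 [c1 SD1 h1]] [D2 [c2 SD2 h2]]; exists (D1 `|` D2); split.
    + exact: clopenU.
    + exact: setUSS.
    + move=> B cB BD; rewrite (set_additive_split ath cB c1).
      rewrite (set_additive_split (mass_additive f) cB c1) mulrDr.
      apply: le_trans (ler_normD _ _) _; apply: lerD.
        by apply: h1; [exact: clopenI|move=> t []].
      by apply: h2; [exact: clopen_setD|move=> t [/BD[]]].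
  - move=> S1 S2 S12 [D [cD SD hD]]; exists D; split=> //; exact: subset_trans S12 SD.
  - move=> t _; have /cts_nrmP h := cfun_cts a; have e2 : 0 < e / 2 by lra.
    have [D [cD Dt DW]] := zd_basis cK hK (stonian_zd hK st) (h t _ e2).
    exists D; first exact: open_nbhs_nbhs (conj cD.1 Dt).
    exists D; split=> // B cB BD.
    have hB s : B s -> ar t - e / 2 <= ar s <= ar t + e / 2.
      move=> /BD /DW; rewrite /= !aE.
      change (nrm (rc k (ar t) - rc k (ar s) : F^o) < e / 2 -> ar t - e / 2 <= ar s <= ar t + e / 2).
      by rewrite -rcB nrm_rc ltr_norml; lra.
    have i0 s : im ((a * ind B) s) = 0.
      rewrite cfunM aE im_rcM; case: (pselect (B s)) => Bs.
        by rewrite ind_in// im1 mulr0.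
      by rewrite ind_out// im0 mulr0.
    have bo s : ~ B s -> (a * ind B) s = 0 by move=> Bs; rewrite cfunM ind_out// mulr0.
    have bi s : B s -> re ((a * ind B) s) = ar s.
      by move=> Bs; rewrite cfunM ind_in// mulr1 aE reK.
    have u1 := hu B (ar t + e / 2) cB (fun s Bs => proj2 (andP (hB s Bs))).
    have u2 := hl B (ar t - e / 2) cB (fun s Bs => proj1 (andP (hB s Bs))).
    have u3 : re (f (a * ind B)) <= (ar t + e / 2) * mass f B.
      by apply: nfpos_le => // s Bs; rewrite bi//; have /andP[] := hB s Bs.
    have u4 : (ar t - e / 2) * mass f B <= re (f (a * ind B)).
      by apply: nfpos_ge => // s Bs; rewrite bi//; have /andP[] := hB s Bs.
    by rewrite /th ler_norml; lra.
apply/eqP; rewrite -subr_eq0 -/(th A0) -normr_le0; apply/ler_addgt0Pr => e e0; rewrite add0r.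
have m0 := mass_ge0 pf cA0; have m1 : 0 < mass f A0 + 1 by lra.
apply: le_trans (small _ (divr_gt0 e0 m1)) _.
by rewrite mulrAC ler_pdivrMr// ler_wpM2l ?ltW//; lra.
Qed.

(** Radon-Nikodym with a single pair and the bounds 0 and 1, which express 0 <= f <= g; the transfer
    condition is met by D itself. *)
Lemma nf_derivative f g : nfpos f -> nfpos g -> nfpos (g - f) ->
  exists p, (forall t, 0 <= p t <= 1) /\ forall b, f b = g (p * b).
Proof.
move=> pf pg pgf.
have [| |ar [a01 acts aup adown]] :=
  @radon_nikodym R K cK st unit (fun _ => mass f) (fun _ => mass g) 0 1
   (fun _ => mass_additive f) (fun _ => mass_normal f)
   (fun _ => mass_additive g) (fun _ => mass_normal g)
   (fun _ A cA => mass_ge0 pg cA) _ ler01 _.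
- move=> _ A cA; rewrite mul0r mul1r mass_ge0//=.
  by have := mass_ge0 pgf cA; rewrite /mass nf_subE reB subr_ge0.
- move=> r _ D cD pD kD; exists D; split=> //; apply/set0P/eqP => D0.
  by move: kD; rewrite D0 !(set_additive0 (mass_additive _)) mulr0 subrr ltxx.
pose p : CK := cf (fun t => rc k (ar t)).
have pE t : p t = rc k (ar t) by rewrite /p cfE//; exact: rc_fun_cts.
have p01 t : 0 <= p t <= 1.
  by have := a01 t; rewrite pE rc_ge0 -(rc1 R k) ler_rc.
exists p; split=> // b.
suff /eqP : f - nf_cut p g = 0 by rewrite subr_eq0 => /eqP ->; rewrite nf_cutE.
apply: nf_ind0 => A cA; rewrite nf_subE nf_cutE.
have h := rn_integral pf (mass_additive f) pE.
have e1 : re (f (ind A)) = re (g (p * ind A)).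
  by apply: (rn_integral pg (mass_additive f) pE) => // B r cB hB; [exact: (aup tt)|exact: (adown tt)].
have i1 t : im (ind A t) = 0.
  case: (pselect (A t)) => At; first by rewrite ind_in// im1.
  by rewrite ind_out// im0.
apply/eqP; rewrite subr_eq0; apply/eqP/reim_eq => //; rewrite (nfpos_real pf)// (nfpos_real pg)// => t.
by rewrite cfunM pE im_rcM i1 mulr0.
Qed.
End Positive.

(** * The dual of the normal functionals *)

Section Predual.
Context (R : realType) (k : scalar_kind) (K : topologicalType).
Hypotheses (cK : compact [set: K]) (hK : hausdorff_space K) (st : stonian K).
Local Notation F := (scalars R k).
Local Notation CK := (cfun K F).
Local Notation ind := (ind R k).
Local Notation NF := (@nfun R k K cK).
Implicit Types (b c p a : CK) (f g : NF) (A B D : set K).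

(* On [D] the functional [g] is approximated by [p f] with [p >= 0], the quotient
   of the derivatives of [g] and [f] with respect to [f + g]. *)
Lemma transfer_pos (h : F -> R) (psi : dual NF) (r : R) f g D :
  (forall z w, h (z + w) = h z + h w) -> (forall x z, h (rc k x * z) = x * h z) ->
  (forall z, `|h z| <= nrm (z : F^o)) -> nfpos f -> nfpos g -> clopen D ->
  (forall B, clopen B -> B `<=` D -> mass f B <= 0 -> B = set0) ->
  posset (fun A => h (psi (nf_cut (ind A) f)) - r * mass f A) D ->
  posset (fun A => h (psi (nf_cut (ind A) g)) - r * mass g A) D.
Proof.
move=> hD hZ hle pf pg cD fD pD B cB BD; apply/ler_addgt0Pr => e e0.
pose q g0 p := h (psi (nf_cut p g0)) - r * re (g0 p).
have qD g0 p p' : q g0 (p + p') = q g0 p + q g0 p'.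
  by rewrite /q nf_cutDl bopD hD nfD reD mulrDr; lra.
have qle g0 p (d : R) : 0 <= d -> (forall t, nrm (p t : F^o) <= d) ->
    `|q g0 p| <= (opn psi + `|r|) * nrm g0 * d.
  move=> d0 hp; apply: le_trans (ler_normB _ _) _; rewrite normrM !mulrDl; apply: lerD.
    apply: le_trans (hle _) _; apply: le_trans (opn_ub _ _) _.
    by rewrite -mulrA ler_wpM2l ?opn_ge0//; exact: nf_cut_norm.
  rewrite -mulrA ler_wpM2l//; apply: le_trans (nrm_re _) _; exact: nf_ub.
have [s [s01 fs]] : exists s : CK, (forall t, 0 <= s t <= 1) /\ forall b, f b = (f + g) (s * b).
  apply: nf_derivative => //; first by move=> b b0; rewrite nf_addE addr_ge0// ?pf ?pg.
  by rewrite addrAC subrr add0r.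
pose U := [set t | s t != 0].
have oU : open U by exact: open_cfun_neq0.
have cU := stonian_closure_clopen st oU.
have q_normal : set_normal (fun A => q g (ind A)).
  apply: set_normalB; last exact: mass_normal.
  apply: (@set_normal_dom R K _ (mass g) (opn psi * 2)); last 2 first.
  - exact: mass_normal.
  - move=> A cA; apply: le_trans (hle _) _; apply: le_trans (opn_ub _ _) _.
    by rewrite -mulrA ler_wpM2l ?opn_ge0//; exact: nf_cut_ind_norm.
  - by rewrite mulr_ge0// opn_ge0.
have [A [cA AU hA]] := q_normal U e oU e0.
(* Where s vanishes f vanishes too, whereas f charges every nonempty clopen part of D. *)
have BU : B `<=` closure U.
  suff B0 : B `\` closure U = set0.
    by move=> t Bt; apply: contrapT => nU; have : (B `\` closure U) t by []; rewrite B0.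
  apply: fD; [exact: clopen_setD|by move=> t [/BD]|].
  rewrite /mass fs (_ : s * _ = 0) ?nf0 ?re0//; apply: cfun_eq => t.
  rewrite cfunM cfun0; case: (pselect ((B `\` closure U) t)) => [[Bt nU]|nt].
    suff -> : s t = 0 by rewrite mul0r.
    by apply: contrapT => /eqP st0; apply/nU/subset_closure.
  by rewrite ind_out ?mulr0//; exact: clopen_setD.
have cE : clopen (B `&` A) by exact: clopenI.
have h2 : `|q g (ind (B `\` A))| <= e.
  apply: hA; [exact: clopen_setD|by move=> t [/BU]|].
  by apply/seteqP; split=> t // [At []].
have h1 : 0 <= q g (ind (B `&` A)).
  have sE t : (B `&` A) t -> s t != 0 by move=> [_ /AU].
  have [v [vi vo]] := inverse_on cE sE.
  pose p := (1 - s) * v.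
  have p0 t : 0 <= p t.
    have /andP[s0 s1] := s01 t.
    rewrite cfunM cfunB cfun1 mulr_ge0 ?subr_ge0//.
    case: (pselect ((B `&` A) t)) => Et; last by rewrite vo.
    by rewrite vi// invr_ge0.
  have cp : nf_cut (ind (B `&` A)) g = nf_cut p f.
    apply: nf_eq => b; rewrite !nf_cutE fs nf_addE.
    have -> : s * (p * b) = ind (B `&` A) * b - s * (ind (B `&` A) * b).
      apply: cfun_eq => t; rewrite !(cfunM, cfunB, cfunN, cfun1).
      case: (pselect ((B `&` A) t)) => Et.
        rewrite ind_in// vi//; have := sE t Et; move: (s t) (b t) => x y x0.
        by rewrite mul1r mulrA [x * _]mulrC divfK// mulrBl mul1r.
      by rewrite ind_out// vo//; ring.
    by rewrite -nf_addE nfB -fs nf_addE addrC addKr.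
  have -> : q g (ind (B `&` A)) = q f p.
    have e1 : g (ind (B `&` A)) = f p.
      by rewrite -[ind _]mulr1 -nf_cutE cp nf_cutE mulr1.
    by rewrite /q cp e1.
  have pE : p * ind D = p.
    apply: cfun_eq => t; rewrite cfunM; case: (pselect (D t)) => Dt.
      by rewrite ind_in// mulr1.
    by rewrite ind_out// mulr0 cfunM vo ?mulr0// => -[/BD].
  pose Q := (opn psi + `|r|) * nrm f.
  have Q0 : 0 <= Q by rewrite mulr_ge0 ?nrm_ge0// addr_ge0// opn_ge0.
  apply/ler_addgt0Pr => d d0; have Q1 : 0 < Q + 1 by lra.
  have dQ := divr_gt0 d0 Q1.
  (* For step functions with nonnegative coefficients the sign follows from positivity on clopen
     subsets of D. *)
  have [|x y hx hy C cC|x C cC hx C' cC'|t C cC C' cC'|x [Gx hx]] :=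
    @simple_approx R k K cK hK st (fun x => forall A, clopen A -> 0 <= q f (x * ind A * ind D)) p _ dQ.
  - by move=> C _; rewrite !mul0r; have := qD f 0 0; rewrite addr0; lra.
  - rewrite (mulrDl x y) (mulrDl (x * ind C)) qD; apply: addr_ge0; [exact: hx|exact: hy].
  - by rewrite -(mulrA x) ind_mul// hx//; exact: clopenI.
  - rewrite !cfun_scaleAl ind_mul// ind_mul//; last exact: clopenI.
    have /andP[re_p /eqP im_p] : (0 <= re (p t)) && (im (p t) == 0) by rewrite -ge0_re.
    have -> : p t = rc k (re (p t)) by exact: ge0_rc.
    rewrite /q nf_cutZl bopZ nfZ hZ re_rcM.
    have := pD (C `&` C' `&` D) (clopenI (clopenI cC cC') cD) (fun _ h => h.2).
    rewrite /mass => hh; rewrite mulrCA -mulrBr mulr_ge0//.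
  have := Gx setT clopenT; rewrite indT mulr1 => h3.
  have h4 : `|q f (p - x * ind D)| <= Q * (d / (Q + 1)).
    apply: qle; first exact: ltW.
    move=> t; rewrite -{1}pE cfunB !cfunM -mulrBl nrmM.
    apply: le_trans (ler_piMr (nrm_ge0 _) (nrm_ind R k t cD)) _; exact: hx.
  have h5 : Q * (d / (Q + 1)) <= d.
    by rewrite mulrCA ger_pMr// ler_pdivrMr// mul1r lerDl.
  have : q f p = q f (x * ind D) + q f (p - x * ind D) by rewrite -qD addrC subrK.
  by move: h4; rewrite ler_norml; lra.
have : q g (ind B) = q g (ind (B `&` A)) + q g (ind (B `\` A)).
  rewrite -qD -indU ?setUIDK//; first exact: clopen_setD.
  by apply/seteqP; split=> t // -[[_ ?] [_]].
rewrite /q /mass => ->; move: h1 h2; rewrite /q ler_norml; lra.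
Qed.

(** The family is indexed by all positive normal functionals, so that the density is a single
    function. For the transfer condition a set positive for f is cut down to the carrier of f, where
    [transfer_pos] moves positivity to any other functional. *)
Lemma nf_represent_re (h : F -> R) (psi : dual NF) :
  (forall z w, h (z + w) = h z + h w) -> (forall x z, h (rc k x * z) = x * h z) ->
  (forall z, `|h z| <= nrm (z : F^o)) ->
  exists a, (forall t, im (a t) = 0) /\ forall f, nfpos f -> h (psi f) = re (f a).
Proof.
move=> hD hZ hle.
pose I := {f : NF | nfpos f}.
pose nu (i : I) A := h (psi (nf_cut (ind A) (sval i))).
pose la (i : I) A := mass (sval i) A.
have C0 : 0 <= opn psi * 2 by rewrite mulr_ge0// opn_ge0.
have an i : set_additive (nu i).
  by move=> A B cA cB AB; rewrite /nu indU// nf_cutDl bopD hD.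
have dom i A : clopen A -> `|nu i A| <= opn psi * 2 * la i A.
  move=> cA; apply: le_trans (hle _) _; apply: le_trans (opn_ub _ _) _.
  by rewrite -mulrA ler_wpM2l ?opn_ge0//; apply: nf_cut_ind_norm => //; exact: svalP i.
have nn i : set_normal (nu i).
  by apply: set_normal_dom C0 _ (dom i); exact: mass_normal.
have [| | |ar [_ acts aup adown]] := @radon_nikodym R K cK st I nu la (- (opn psi * 2)) (opn psi * 2)
  an nn (fun i => mass_additive (sval i)) (fun i => mass_normal (sval i))
  (fun i A cA => mass_ge0 (svalP i) cA) _ _ _.
- by move=> i A cA; have := dom i A cA; rewrite ler_norml mulNr.
- lra.
- move=> r i D cD pD kD; have [S [cS fS hS]] := nf_carrier st (svalP i).
  have mS : mass (sval i) (D `\` S) = 0.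
    have m0 : mass (sval i) (~` S) = 0 by rewrite /mass fS re0.
    have cS' := clopenC set0 cS.
    have := set_additive_split (mass_additive (sval i)) cS' cD; rewrite m0.
    rewrite (_ : ~` S `&` D = D `\` S); last by rewrite setDE setIC.
    have := mass_ge0 (svalP i) (clopen_setD cD cS); have := mass_ge0 (svalP i) (clopen_setD cS' cD).
    lra.
  exists (D `&` S); split.
  + exact: clopenI.
  + by move=> t [].
  + apply/set0P/eqP => DS; move: kD.
    have -> : D = D `\` S.
      by apply/seteqP; split=> t; [move=> Dt; split=> // St; have : (D `&` S) t by []; rewrite DS|case].
    have := dom i _ (clopen_setD cD cS); rewrite /la mS !mulr0 normr_le0 => /eqP ->.
    by rewrite subrr ltxx.
  + move=> j; apply: (transfer_pos hD hZ hle (svalP i) (svalP j)).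
    * exact: clopenI.
    * by move=> B cB BD; apply: hS => // t /BD[].
    * by move=> B cB BD; apply: pD => // t /BD[].
pose a : CK := cf (fun t => rc k (ar t)).
have aE t : a t = rc k (ar t) by rewrite /a cfE//; exact: rc_fun_cts.
exists a; split=> [t|f pf]; first by rewrite aE im_rc.
have := @rn_integral R k K cK hK st f (nu (exist _ f pf)) ar a pf (an _) aE
  (fun A r => aup (exist _ f pf) A r) (fun A r => adown (exist _ f pf) A r) setT clopenT.
by rewrite /nu /= indT nf_cut1 mulr1.
Qed.

(** The scalar-linear functional that agrees with the composition of h and f on real functions; for
    h = [re] and [im] it is the real and the imaginary part of f. *)
Definition nf_part (h : F -> R) f : NF :=
  mknf cK (fun b => rc k (h (f (cre b))) + iu R k * rc k (h (f (cim b)))).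

Lemma nf_partE (h : F -> R) f b :
  (forall z w, h (z + w) = h z + h w) -> (forall x z, h (rc k x * z) = x * h z) ->
  (forall z, `|h z| <= nrm (z : F^o)) ->
  nf_part h f b = rc k (h (f (cre b))) + iu R k * rc k (h (f (cim b))).
Proof.
move=> hD hZ hle.
have hN z : h (- z) = - h z by rewrite -mulN1r -(rc1 R k) -rcN hZ mulN1r.
have bound c (r : R) : nrm (f (cre c) : F^o) <= r -> nrm (f (cim c) : F^o) <= r ->
    nrm (rc k (h (f (cre c))) + iu R k * rc k (h (f (cim c))) : F^o) <= 2 * r.
  move=> h1 h2; apply: le_trans (nrmD _ _) _; rewrite nrmM !nrm_rc.
  have h3 := le_trans (hle _) h1; have h4 := le_trans (hle _) h2.
  have := ler_wpM2r (normr_ge0 (h (f (cim c)))) (nrm_iu R k).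
  by move: h3 h4; set u := `|_|; set v := `|h (f (cim c))|; set w := nrm _; lra.
rewrite /nf_part (@mknfE R k K cK _ (2 * nrm f))//.
- move=> z x y; change (scalars R k) with F.
  set X := f (cre x); set X' := f (cim x); set Y := f (cre y); set Y' := f (cim y).
  rewrite creZD cimZD !nfD nfN !nfZ !hD hN !hZ -/X -/X' -/Y -/Y'.
  change (rc k (re z * h X - im z * h X' + h Y) + iu R k * rc k (re z * h X' + im z * h X + h Y')
    = z * (rc k (h X) + iu R k * rc k (h X')) + (rc k (h Y) + iu R k * rc k (h Y'))).
  have zi := im_iuM z.
  apply: reim_eq; rewrite !(reD, reM, imD, imM, reK, im_rc, re_iu).
    have -> : im z * h X' = im z * im (iu R k) * h X' by rewrite zi.
    by ring.
  have e : im (iu R k) * (im z * h X) = im z * h X by rewrite mulrA [im (iu R k) * _]mulrC zi.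
  by rewrite !(add0r, mul0r, mulr0, subr0) !mulrDr e; ring.
- move=> c c1; apply: bound; apply: nf_ub1 => t; first exact: le_trans (nrm_cre _ _) (c1 t).
  exact: le_trans (nrm_cim _ _) (c1 t).
- move=> U e oU e0; have [_ _ nf] := nfP f.
  have e2 : 0 < e / 2 by lra.
  have [A [cA AU hA]] := nf U _ oU e2; exists A; split=> // c c1 cA0 cU.
  rewrite (_ : e = 2 * (e / 2)); last by field.
  apply: bound; apply: hA => t.
  + exact: le_trans (nrm_cre _ _) (c1 t).
  + by move=> At; rewrite creE cA0// re0 rc0.
  + by move=> At; rewrite creE cU// re0 rc0.
  + exact: le_trans (nrm_cim _ _) (c1 t).
  + by move=> At; rewrite cimE cA0// im0 rc0.
  + by move=> At; rewrite cimE cU// im0 rc0.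
Qed.

(** f splits into its real and imaginary part, and each of these, by a Hahn decomposition P, into
    its restrictions to P and to the complement, of opposite signs. *)
Lemma nf_span (G : NF -> Prop) : (forall f, nfpos f -> G f) ->
  (forall z f g, G f -> G g -> G (z *: f + g)) -> forall f, G f.
Proof.
move=> Gp GZ f.
have ind_real A : clopen A -> forall t, im (ind A t) = 0.
  move=> cA t; case: (pselect (A t)) => At; first by rewrite ind_in// im1.
  by rewrite ind_out// im0.
have part (h : F -> R) : (forall z w, h (z + w) = h z + h w) ->
    (forall x z, h (rc k x * z) = x * h z) -> (forall z, `|h z| <= nrm (z : F^o)) -> G (nf_part h f).
  move=> hD hZ hle.
  have h0 : h 0 = 0 by rewrite -(mul0r 0) -(rc0 R k) hZ mul0r.
  have iE A : clopen A -> nf_part h f (ind A) = rc k (h (f (ind A))).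
    move=> cA; have [e1 e2] := cre_real (ind_real A cA).
    by rewrite nf_partE// e1 e2 nf0 h0 rc0 mulr0 addr0.
  have [P [cP hP hN]] := set_hahn_decomposition cK st (nf_set_additive hD f) (nf_set_normal hle f).
  have cP' := clopenC set0 cP.
  have -> : nf_part h f = -1 *: (- nf_cut (ind (~` P)) (nf_part h f)) + nf_cut (ind P) (nf_part h f).
    rewrite scaleN1r opprK -nf_cutDl addrC -indU ?setUv ?indT ?nf_cut1//.
    by rewrite setICr.
  apply: GZ; apply/Gp/nf_pos_ind => // A cA.
    rewrite nf_oppE nf_cutE ind_mul// iE ?oppr_ge0; last exact: clopenI.
    rewrite -(rc0 R k) ler_rc; apply: hN; first exact: clopenI.
    by apply/seteqP; split=> t // -[[]].
  rewrite nf_cutE ind_mul// iE ?rc_ge0; last exact: clopenI.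
  by apply: hP; [exact: clopenI|move=> t []].
have -> : f = iu R k *: nf_part (@im R k) f + nf_part (@re R k) f.
  apply/eqP; rewrite -subr_eq0; apply/eqP/(nf_ind0 hK st) => A cA.
  have [e1 e2] := cre_real (ind_real A cA).
  rewrite nf_subE nf_addE nf_scaleE !nf_partE; first last.
  - exact: nrm_im.
  - exact: im_rcM.
  - exact: imD.
  - exact: nrm_re.
  - exact: re_rcM.
  - exact: reD.
  rewrite e1 e2 !nf0 re0 im0 rc0 mulr0 !addr0.
  by rewrite [_ + rc k _]addrC -reim subrr.
apply: GZ; apply: part.
- exact: imD.
- exact: im_rcM.
- exact: nrm_im.
- exact: reD.
- exact: re_rcM.
- exact: nrm_re.
Qed.

Lemma nf_represent (psi : dual NF) : exists a, forall f, psi f = f a.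
Proof.
have [a1 [r1 h1]] := nf_represent_re psi (@reD R k) (@re_rcM R k) (@nrm_re R k).
have [a2 [r2 h2]] := nf_represent_re psi (@imD R k) (@im_rcM R k) (@nrm_im R k).
exists (a1 + iu R k *: a2); apply: nf_span => [f pf|z f g hf hg].
  rewrite nfD nfZ (reim (psi f)) h1// h2//.
  by rewrite [f a1 in RHS]reim [f a2 in RHS]reim !(nfpos_real pf)// !rc0 !mulr0 !addr0.
by rewrite bopD bopZ nf_addE nf_scaleE -hf -hg.
Qed.

Definition nf_eval a : dual NF := mkbop (fun f : NF => f a : F^o).
Lemma nf_evalE a f : nf_eval a f = f a.
Proof.
rewrite /nf_eval (@mkbopE _ _ _ _ _ (sn a))//= => g.
by rewrite mulrC; apply: nf_ub; [exact: sn_ge0|exact: sn_ub].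
Qed.

Lemma nf_eval_linear : linear nf_eval.
Proof.
move=> z a b; apply: bop_eq => f; rewrite nf_evalE.
change (f (z *: a + b) = z * nf_eval a f + nf_eval b f).
by rewrite !nf_evalE nfD nfZ.
Qed.

Lemma nf_eval_surj (psi : dual NF) : exists a, nf_eval a = psi.
Proof.
by have [a ha] := nf_represent psi; exists a; apply: bop_eq => f; rewrite nf_evalE ha.
Qed.

Context (X : completeNormedModType F) (m : CK -> bop X X).
Hypotheses (mm : banach_module m) (minj : injective m).
Hypothesis nm : forall U, open U -> bop_normal m U.

Definition vec_nf (f : dual X) (x : X) : NF := mknf cK (fun b => f (m b x)).
Lemma vec_nfE (f : dual X) x b : vec_nf f x b = f (m b x).
Proof.
rewrite /vec_nf (@mknfE R k K cK _ (opn f * (modC cK mm * nrm x)))//.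
- by move=> z a c; rewrite modD// modZ// bopD bopZ.
- by move=> c c1; apply: le_trans (opn_ub _ _) _; rewrite ler_wpM2l ?opn_ge0// mod_le1.
- move=> U e oU e0; have f1 : 0 < opn f + 1 by have := opn_ge0 f; lra.
  have [A [cA AU hA]] := nm oU x (divr_gt0 e0 f1); exists A; split=> // c c1 cA0 cU.
  apply: le_trans (opn_ub _ _) _; have := hA c c1 cA0 cU; rewrite ler_pdivlMr// mulrC.
  by apply: le_trans; rewrite ler_wpM2r ?nrm_ge0// lerDl.
Qed.

(** On a clopen A where |a| >= c > 0, injectivity of [m] and Hahn-Banach give a nonzero vector
    functional om supported by A. Dividing om by a costs at most a factor 1 / c in norm, and
    evaluating at a restores om; hence c is at most the norm of the evaluation. *)
Lemma nf_eval_isometry a : opnorm (nf_eval a) = supnorm (a : K -> F).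
Proof.
rewrite opnormE (supnormE cK); congr rc; apply/eqP; rewrite eq_le; apply/andP; split.
  apply: opn_le; first exact: sn_ge0.
  move=> f f1; rewrite nf_evalE; apply: le_trans (nf_ub f (sn_ge0 cK a) (sn_ub cK a)) _.
  by rewrite ler_piMl// sn_ge0.
apply: sn_le => //; first exact: opn_ge0.
move=> t; apply/ler_addgt0Pr => e e0.
case: (leP (nrm (a t : F^o)) e) => [h|ate]; first by have := opn_ge0 (nf_eval a); lra.
pose c := nrm (a t : F^o) - e; have c0 : 0 < c by rewrite /c; lra.
have /cts_nrmP hc := cfun_cts a.
have [A [cA At AW]] := zd_basis cK hK (stonian_zd hK st) (hc t e e0).
have aA s : A s -> c <= nrm (a s : F^o).
  by move=> /AW /= h; have := nrm_sub (a t : F^o) (a s); rewrite /c; lra.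
have aA0 s : A s -> a s != 0 by move=> /aA h; rewrite -(@nrm_gt0 R k F^o); lra.
have [p [pi po]] := inverse_on cA aA0.
have pa : a * p = ind A.
  apply: cfun_eq => s; rewrite cfunM; case: (pselect (A s)) => As.
    by rewrite pi// ind_in// mulfV// aA0.
  by rewrite po// ind_out// mulr0.
have [x mx] : exists x, m (ind A) x != 0.
  apply: contrapT => nx; have : ind A = 0.
    apply: minj; apply: bop_eq => x; rewrite mod0//; apply: contrapT => h.
    by apply: nx; exists x; apply/eqP.
  move=> /(congr1 (fun b : CK => b t)); rewrite ind_in// cfun0 => /eqP.
  by rewrite oner_eq0.
have [f fx] := dual_separates mx.
pose om := nf_cut (ind A) (vec_nf f x).
have om0 : 0 < nrm om.
  rewrite nrm_gt0; apply/eqP => /(congr1 (fun g : NF => g 1)).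
  by rewrite nf_cutE mulr1 vec_nfE => h; move: fx; rewrite h eqxx.
suff : nrm om <= opn (nf_eval a) * (nrm om * c^-1).
  rewrite mulrA ler_pdivlMr// [_ * c]mulrC ler_pM2r// /c; lra.
apply: nf_lub => b b1.
have -> : om b = nf_eval a (nf_cut b (nf_cut p om)).
  by rewrite nf_evalE /om !nf_cutE (mulrC b a) (mulrA p) (mulrC p a) pa mulrA ind_mul// setIid.
apply: le_trans (opn_ub _ _) _; rewrite ler_wpM2l ?opn_ge0//.
apply: le_trans (nf_cut_norm _ ler01 b1) _; rewrite mulr1.
apply: nf_cut_norm; first by rewrite invr_ge0 ltW.
move=> s; case: (pselect (A s)) => As.
  by rewrite pi// nrmV lef_pV2 ?posrE ?aA//; exact: lt_le_trans (aA _ As).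
by rewrite po// nrm0 invr_ge0 ltW.
Qed.

Definition nf_predual : predual K F :=
  Predual nf_eval_linear nf_eval_isometry nf_eval_surj.

(** Each map sending b to f (b x) is a normal functional, that is, an element of the predual. *)
Lemma normal_wstar : wstar_wot_continuous m nf_predual.
Proof.
move=> a; have PF : ProperFilter (nbhs (a : wstar nf_predual)) by exact: nbhs_pfilter.
apply/(initial_cvgP _ _ (fmap_filter _ _))/ptws_cvgP => -[x f].
have cid_a : (id : wstar nf_predual -> wstar nf_predual) @ a --> a by exact: cvg_id.
move/(initial_cvgP _ _ (fmap_filter _ _))/ptws_cvgP: cid_a => /(_ (vec_nf f x)).
have E (b : CK) : nf_eval b (vec_nf f x) = f (m b x) by rewrite nf_evalE vec_nfE.
move=> h; have : (fun b : wstar nf_predual => nf_eval b (vec_nf f x)) @ a --> nf_eval a (vec_nf f x).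
  exact: h.
by rewrite E (_ : (fun b : wstar nf_predual => _) = fun b => f (m b x)) //; apply/funext.
Qed.
End Predual.

(** * Consequences of weak-star continuity *)

Section WeakStar.
Context (R : realType) (k : scalar_kind).
Local Notation F := (scalars R k).

(** Weak-star compactness of a ball in the dual, in terms of ultrafilters: the pointwise limit is
    again linear with the same bound. *)
Lemma ultra_functional (V : normedModType F) (I : Type) (W : set_system I) (f : I -> dual V) (C : R) :
  UltraFilter W -> (forall i y, nrm (f i y) <= C * nrm y) ->
  exists g : dual V, forall y, (fun i => f i y : F^o) @ W --> (g y : F^o).
Proof.
move=> UW fC; have PW : ProperFilter W by exact: ultra_proper.
have lim y : exists l : F^o, (fun i => f i y : F^o) @ W --> l.
  apply: (@ultra_bounded_cvg R k _ (C * nrm y)); first exact: fmap_ultra.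
  change (W [set i | nrm (f i y : F^o) <= C * nrm y]).
  by apply: filterE => i; exact: fC.
pose L y := sval (cid (lim y)).
have LE y : (fun i => f i y : F^o) @ W --> (L y : F^o) by rewrite /L; case: cid.
have linL : linear (L : V -> F^o).
  move=> z x y.
  have h1 := LE (z *: x + y).
  have h2 : (fun i => f i (z *: x + y) : F^o) @ W --> (z *: (L x : F^o) + L y : F^o).
    rewrite (_ : (fun i => _) = fun i => z *: (f i x : F^o) + f i y); last first.
      by apply/funext => i; rewrite bopD bopZ.
    by apply: cvgD; [apply: cvgZl_tmp; exact: LE|exact: LE].
  exact: (cvg_unique _ h1 h2).
have bL x : nrm (L x : F^o) <= C * nrm x.
  rewrite -[L x]subr0; apply: (cvg_nrm_le (G := (fun i => f i x : F^o) @ W)) (LE x) _.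
  change (W [set i | nrm (f i x - 0 : F^o) <= C * nrm x]).
  by apply: filterE => i; rewrite /= subr0; exact: fC.
exists (mkbop (L : V -> F^o)) => y; rewrite (mkbopE linL bL).
exact: LE.
Qed.

Context (K : topologicalType).
Hypotheses (cK : compact [set: K]) (hK : hausdorff_space K).
Local Notation CK := (cfun K F).
Local Notation ind := (ind R k).
Context (X : completeNormedModType F) (m : CK -> bop X X).
Hypotheses (mm : banach_module m) (minj : injective m).
Variable P : predual K F.
Hypothesis wc : wstar_wot_continuous m P.

(* Banach-Alaoglu in the dual of the predual, read through [m]. *)
Lemma wstar_limit (I : Type) (W : set_system I) (b : I -> CK) (C : R) : UltraFilter W ->
  0 <= C -> (forall i t, nrm (b i t : F^o) <= C) ->
  exists c : CK, forall x (f : dual X), (fun i => f (m (b i) x) : F^o) @ W --> (f (m c x) : F^o).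
Proof.
move=> UW C0 bC; have PW : ProperFilter W by exact: ultra_proper.
have Jb i y : nrm (predual_map P (b i) y) <= C * nrm y.
  apply: le_trans (opn_ub _ _) _; rewrite ler_wpM2r ?nrm_ge0//.
  rewrite /opn predual_isometry -/(sn (b i)); exact: sn_le.
have [g gE] := ultra_functional UW Jb.
have [c cg] := predual_surj g; exists c => x f.
have h1 : (b : I -> wstar P) @ W --> (c : wstar P).
  by apply/(initial_cvgP _ _ (fmap_filter _ _))/ptws_cvgP => y; rewrite cg; exact: gE.
have h2 : (fun i => m (b i) : wot X) @ W --> (m c : wot X).
  by apply: (cvg_comp (b : I -> wstar P) (m : wstar P -> wot X) h1); exact: wc.
by move/(initial_cvgP _ _ (fmap_filter _ _))/ptws_cvgP: h2 => /(_ (x, f)).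
Qed.

(** Along an ultrafilter finer than the tails of the family N, the characteristic functions have a
    weak-star limit c. Products identify c as 1 on the members of N and 0 off the closure of their
    union, so c is the characteristic function of this closure; it annihilates x because the members
    of N do. *)
Lemma wstar_carrier x : stonian K -> exists e, carrier_projection m x e.
Proof.
move=> st; apply: carrier_of_null => // N NP N0 NU.
pose I := {A : set K | N A}.
pose le (A B : I) := sval A `<=` sval B.
have dir : directed le.
  split; first by split; exists set0.
  - by move=> A.
  - by move=> A B D; exact: subset_trans.
  - move=> [A NA] [B NB]; exists (exist _ (A `|` B) (NU _ _ NA NB)).
    by split=> t /= ht; [left|right].
have PT := tails_filter dir.
have [W [UW TW]] := ultraFilterLemma PT; have PW : ProperFilter W by exact: ultra_proper.
pose b (i : I) := ind (sval i).
have cl (i : I) : clopen (sval i) by have [] := NP _ (svalP i).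
have [c hc] := wstar_limit UW ler01 (fun i t => nrm_ind R k t (cl i)).
set U := \bigcup_(A in N) A.
have oU : open U by apply: bigcup_open => A /NP[[]].
have cE := stonian_closure_clopen st oU.
(* Multiplication by a fixed a passes to the limit, since f composed with [m a] is again a bounded
   functional. *)
have key (a : CK) (a' : CK) : W [set i | a * b i = a'] -> a * c = a'.
  move=> Wa; apply: minj; apply: bop_eq => y; apply/eqP; rewrite -subr_eq0; apply/negPn/negP => ne.
  have [f] := dual_separates ne; rewrite bopB modM// => /eqP; apply; apply/eqP; rewrite subr_eq0; apply/eqP.
  have [C C0 fC] := bop_bounded f.
  have [C' C'0 aC] := bop_bounded (m a).
  have bfa (y' : X) : nrm (f (m a y') : F^o) <= (C * C') * nrm y'.
    by apply: le_trans (fC _) _; rewrite -mulrA ler_wpM2l.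
  have lfa : linear (fun y' => f (m a y') : F^o).
    by move=> z u v; rewrite !bopD !bopZ.
  pose fa : dual X := mkbop (fun y' => f (m a y') : F^o).
  have faE y' : fa y' = f (m a y') by rewrite /fa (mkbopE lfa bfa).
  have h1 := hc y fa; rewrite faE in h1.
  have h2 : (fun i => fa (m (b i) y) : F^o) @ W --> (f (m a' y) : F^o).
    apply: cvg_trans (near_eq_cvg _) (cvg_cst _); apply: filterS Wa => i /= <-.
    by rewrite faE modM.
  exact: (cvg_unique _ h1 h2).
have c1 t : U t -> c t = 1.
  move=> [A NA At].
  have : ind A * c = ind A.
    apply: key; apply: TW; exists (exist _ A NA) => // -[B NB] /= AB.
    have [cA _] := NP _ NA; have [cB _] := NP _ NB.
    by rewrite /b ind_mul//= (_ : A `&` B = A)//; apply/setIidPl.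
  move=> /(congr1 (fun a : CK => a t)); have [cA _] := NP _ NA.
  by rewrite cfunM ind_in// mul1r.
have c0 : (1 - ind (closure U)) * c = 0.
  apply: key; apply: filterE => i; have [cA _] := NP _ (svalP i).
  rewrite /= mulrBl mul1r /b ind_mul// (_ : closure U `&` _ = sval i) ?subrr//.
  by apply/setIidPr => t At; apply: subset_closure; exists (sval i) => //; exact: svalP.
have -> : ind (closure U) = c.
  apply: cfun_eq => t; case: (pselect (closure U t)) => Ut.
    rewrite ind_in//; symmetry; rewrite -(cfun1 R k t); move: t Ut.
    by apply: cfun_eq_closure => t /c1 ->; rewrite cfun1.
  rewrite ind_out//; move: c0 => /(congr1 (fun a : CK => a t)).
  by rewrite cfunM cfunB cfun1 ind_out// subr0 mul1r cfun0 => ->.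
apply/eqP/negPn/negP => /dual_separates[f /eqP]; apply.
have h1 := hc x f.
have h2 : (fun i => f (m (b i) x) : F^o) @ W --> (0 : F^o).
  apply: cvg_trans (near_eq_cvg _) (cvg_cst _); apply: filterE => i /=.
  by have [_ ->] := NP _ (svalP i); rewrite bop0.
exact: (cvg_unique _ h1 h2).
Qed.

Lemma same_floor (x y e : R) : 0 < e -> Num.floor (x / e) = Num.floor (y / e) -> `|x - y| <= e.
Proof.
move=> e0 h; have := floor_itv (x / e); have := floor_itv (y / e); rewrite h intrD.
rewrite !ler_pdivlMr// !ltr_pdivrMr// mulrDl mul1r.
by set z := _ * e => h1 h2; rewrite ler_norml; lra.
Qed.

(* Quantize the values of the first [p] functionals. *)
Lemma countable_approx (mu : nat -> CK -> F) : exists D : nat -> CK,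
  (forall j t, nrm (D j t : F^o) <= 1) /\
  forall (a : CK) p (e : R), (forall t, nrm (a t : F^o) <= 1) -> 0 < e ->
    exists j, forall n, (n < p)%N -> nrm (mu n (D j) - mu n a : F^o) <= e.
Proof.
pose code p N (a : CK) : seq (int * int) :=
  [seq (Num.floor (re (mu n a) / N.+1%:R^-1), Num.floor (im (mu n a) / N.+1%:R^-1)) | n <- iota 0 p].
pose good (q : nat * nat * seq (int * int)) (a : CK) :=
  (forall t, nrm (a t : F^o) <= 1) /\ code q.1.1 q.1.2 a = q.2.
pose rep q : CK := if pselect (exists a, good q a) is left h then sval (cid h) else 0.
have rep1 q t : nrm (rep q t : F^o) <= 1.
  rewrite /rep; case: pselect => [h|_]; last by rewrite cfun0 nrm0.
  by case: cid => a [].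
exists (fun j => if unpickle j is Some q then rep q else 0); split.
  by move=> j t; case: unpickle => [q|] //; rewrite cfun0 nrm0.
move=> a p e a1 e0.
have [N hN] : exists N : nat, (N.+1%:R^-1 : R) <= e / 2.
  have e2 : 0 < e / 2 by lra.
  have [N _ hN] := near_infty_natSinv_lt (PosNum e2).
  by exists N; apply/ltW/hN => /=.
pose q := (p, N, code p N a).
have [_ rq] : good q (rep q).
  rewrite /rep; case: pselect => [h|]; first by case: cid.
  by case; exists a.
exists (pickle q); rewrite pickleK => n np.
have /eq_in_map/(_ n) : code p N (rep q) = code p N a by [].
rewrite mem_iota/= np => /(_ isT) [h1 h2].
have d0 : 0 < (N.+1%:R^-1 : R) by rewrite invr_gt0.
have := nrm_reim (mu n (rep q) - mu n a); rewrite reB imB.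
have := same_floor d0 h1; have := same_floor d0 h2; move: hN; set d := _^-1; lra.
Qed.

(* Hahn-Banach extends the coordinates on l^oo to functionals f_n on X. Along a
   subsequence they converge on [D j x_i] for the countable family [D] above, and
   by weak-star compactness these limits determine all others; but the limits
   along the even and the odd terms differ at a sequence of zeros and ones. *)
Lemma wstar_no_linfty : finitely_generated m -> ~ contains_linfty [set: X].
Proof.
move=> [N [x xd]] [T [S [[linT TK cT _ cS] _]]].
have T0 : T 0 = 0 by have := linT (-1) 0 0; rewrite scaler0 addr0 scaleN1r addNr.
have TZ z s : T (z *: s) = z *: T s by have := linT z s 0; rewrite addr0 T0 addr0.
have [C C0 hC] : exists2 C : R, 0 <= C & forall s, nrm s <= C * nrm (T s).
  move: cS => /subspace_continuousP /(_ (T 0)) h0.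
  have /cvg_nrmP/(_ 1 ltr01) := h0 (ex_intro2 _ _ 0 I erefl) => hw.
  have {hw} : nbhs (T 0) (fun y => range T y -> nrm (S (T 0) - S y) < 1) by exact: hw.
  rewrite TK => /nbhs_nrmP [d d0 hd].
  exists (2 / d); first by rewrite divr_ge0 ?ltW//; lra.
  move=> s; have [s0|s0] := eqVneq (nrm (T s)) 0.
    have -> : s = 0 by rewrite -(TK s) (nrm0_eq0 s0) -T0 TK.
    by rewrite nrm0 mulr_ge0 ?nrm_ge0// divr_ge0 ?ltW//; lra.
  have Ts : 0 < nrm (T s) by rewrite lt_neqAle eq_sym s0 nrm_ge0.
  pose r := d / 2 / nrm (T s).
  have r0 : 0 < r by rewrite !divr_gt0.
  have near0 : nrm (T 0 - T (rc k r *: s)) < d.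
    rewrite T0 sub0r nrmN TZ nrmZ nrm_rc gtr0_norm// /r divfK//; lra.
  have := ltW (hd _ near0 (ex_intro2 _ _ (rc k r *: s) I erefl)).
  rewrite TK sub0r nrmN nrmZ nrm_rc gtr0_norm// /r mulrAC ler_pdivrMr// mul1r => h.
  rewrite mulrAC ler_pdivlMr//; move: h; set u := nrm s; set v := nrm (T s); nra.
have [f fT fC] : exists2 f : nat -> dual X, forall n s, f n (T s) = s n &
    forall n y, nrm (f n y : F^o) <= C * nrm y.
  have hb n : exists f : dual X, (forall y, range T y -> f y = S y n) /\
      forall y, nrm (f y : F^o) <= C * nrm y.
    apply: (hahn_banach (Y := range T) (g := fun y => S y n)) => //.
    - by exists 0.
    - by move=> z _ _ [s _ <-] [s' _ <-]; exists (z *: s + s') => //; exact: linT.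
    - by move=> z _ _ [s _ <-] [s' _ <-]; rewrite -linT !TK.
    - by move=> _ [s _ <-]; rewrite TK; apply: le_trans (linfty_ub _ _) (hC s).
  exists (fun n => sval (cid (hb n))) => n; case: cid => g [g1 g2] //= s.
  by rewrite g1 ?TK//; exists s.
(* All functionals sending a to f n (a x_i) in one sequence, coded by the pairs (n, i). *)
pose mu (j : nat) (a : CK) : F :=
  if unpickle j is Some q then f q.1 (m a (x q.2)) else 0.
have [D [D1 Dap]] := countable_approx mu.
have [W [UW TW]] := ultraFilterLemma (_ : ProperFilter \oo).
have PW : ProperFilter W by exact: ultra_proper.
have tail M : W [set n | (M <= n)%N] by apply: TW; exists M.
have L_ex j i : exists l : F^o, (fun n => f n (m (D j) (x i)) : F^o) @ W --> l.
  apply: (@ultra_bounded_cvg R k _ (C * nrm (m (D j) (x i)))); first exact: fmap_ultra.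
  change (W [set n | nrm (f n (m (D j) (x i)) : F^o) <= C * nrm (m (D j) (x i))]).
  by apply: filterE => n /=; exact: fC.
pose L j i : F := sval (cid (L_ex j i)).
have LE j i : (fun n => f n (m (D j) (x i)) : F^o) @ W --> (L j i : F^o).
  by rewrite /L; case: cid.
have pick_ex M p : exists n, (M < n)%N /\ forall j i, (j < p)%N ->
    nrm (L j i - f n (m (D j) (x i)) : F^o) < p.+1%:R^-1.
  have h (q : 'I_p * 'I_N) : W [set n | nrm (L q.1 q.2 - f n (m (D q.1) (x q.2)) : F^o) < p.+1%:R^-1].
    have p0 : 0 < (p.+1%:R^-1 : R) by rewrite invr_gt0.
    by move/cvg_nrmP: (LE q.1 q.2) => /(_ _ p0).
  have [n [/= h1 h2]] := filter_ex (filterI (tail M.+1) (filter_forall PW h)).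
  by exists n; split=> // j i jp; exact: (h2 (Ordinal jp, i)).
pose nx M p := sval (cid (pick_ex M p)).
(* The diagonal subsequence: at stage p it is within 1 / (p + 1) of the limits L for all j < p. *)
pose nk := fix nk p := if p is p'.+1 then nx (nk p') p else nx 0%N 0%N.
have nk_mono : {homo nk : a b / (a < b)%N}.
  apply: homo_ltn; first exact: ltn_trans.
  by move=> p /=; rewrite /nx; case: cid => n [].
have nk_inj : injective nk.
  by move=> a b ab; case: (ltngtP a b) => // /nk_mono; rewrite ab ltnn.
have nkE p j i : (j < p)%N -> nrm (L j i - f (nk p) (m (D j) (x i)) : F^o) < p.+1%:R^-1.
  by case: p => // p jp; have [_ h] := svalP (cid (pick_ex (nk p) p.+1)); exact: h.
(* Limits along different subsequences of nk still take the same values L on the vectors D j x_i. *)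
have sub_lim (h : nat -> nat) : (forall p, (p <= h p)%N) -> exists g : dual X,
    (forall y, (fun p => f (nk (h p)) y : F^o) @ W --> (g y : F^o)) /\
    forall j i, g (m (D j) (x i)) = L j i.
  move=> hp; have [g gE] := ultra_functional (f := fun p => f (nk (h p))) UW (fun p y => fC _ y).
  exists g; split=> // j i; apply: (cvg_unique _ (gE _)); first exact: norm_hausdorff.
  apply/cvg_nrmP => e e0.
  have [M _ hM] := near_infty_natSinv_lt (PosNum e0).
  change (W [set p | nrm (L j i - f (nk (h p)) (m (D j) (x i)) : F^o) < e]).
  apply: filterS2 (tail M) (tail j.+1) => p /= Mp jp.
  apply: lt_trans (nkE _ _ _ (leq_trans jp (hp p))) _.
  by apply: hM => /=; exact: leq_trans Mp (hp p).
have [|g [gE gL]] := sub_lim double; first by move=> p; rewrite -addnn leq_addr.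
have [|g' [g'E g'L]] := sub_lim (fun p => p.*2.+1); first by move=> p; rewrite ltnW// ltnS -addnn leq_addr.
have inv0 p : 0 < (p.+1%:R^-1 : R) by rewrite invr_gt0.
(* Members of D that match a better and better under all f n have a weak-star limit c. Then f n (c
   x_i) = f n (a x_i) for every n, so g and g' take the same values at c x_i as at a x_i; and they
   agree at c x_i, being equal on the members of D. *)
have eq1 (a : CK) i : (forall t, nrm (a t : F^o) <= 1) -> g (m a (x i)) = g' (m a (x i)).
  move=> a1.
  have ap p := Dap a p _ a1 (inv0 p).
  pose d p := D (sval (cid (ap p))).
  have dP p n : (n < p)%N -> nrm (mu n (d p) - mu n a : F^o) <= p.+1%:R^-1.
    by rewrite /d; case: cid => j hj /hj.
  have [c hc] := wstar_limit UW ler01 (fun p t => D1 (sval (cid (ap p))) t).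
  have ca n : f n (m c (x i)) = f n (m a (x i)).
    apply: (cvg_unique _ (hc (x i) (f n))); first exact: norm_hausdorff.
    apply/cvg_nrmP => e e0.
    have [M _ hM] := near_infty_natSinv_lt (PosNum e0).
    change (W [set p | nrm (f n (m a (x i)) - f n (m (d p) (x i)) : F^o) < e]).
    apply: filterS2 (tail M) (tail (pickle (n, i)).+1) => p /= Mp np.
    have := dP p _ np; rewrite /mu pickleK /= nrmC => /le_lt_trans; apply.
    exact: hM.
  have gc (h : dual X) (s : nat -> nat) : (forall y, (fun p => f (s p) y : F^o) @ W --> (h y : F^o)) ->
      h (m c (x i)) = h (m a (x i)).
    move=> hE; apply: (cvg_unique _ (hE _)); first exact: norm_hausdorff.
    rewrite (_ : (fun p => _) = fun p => f (s p) (m a (x i))); first exact: hE.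
    by apply/funext => p; rewrite ca.
  rewrite -(gc _ _ gE) -(gc _ _ g'E).
  apply: (cvg_unique _ (hc (x i) g)); first exact: norm_hausdorff.
  rewrite (_ : (fun p => _) = fun p => g' (m (d p) (x i))); first exact: hc.
  by apply/funext => p; rewrite /d gL g'L.
pose E := [set y | g y = g' y].
have EZ z y y' : E y -> E y' -> E (z *: y + y').
  by rewrite /E /= !bopD !bopZ => -> ->.
have E0 : E 0 by rewrite /E /= !bop0.
have Ecl : closed E.
  move=> y /closure_nrmP hy; apply/eqP; rewrite -subr_eq0; apply/eqP/(@nrm_small R k F^o) => e e0.
  have [B B0 gB] := bop_bounded (g - g').
  have B1 : 0 < B + 1 by lra.
  have [w Ew yw] := hy _ (divr_gt0 e0 B1).
  have -> : g y - g' y = (g - g') (y - w).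
    by change (g y - g' y = g (y - w) - g' (y - w)); rewrite !bopB Ew opprB addrA subrK.
  apply: le_trans (gB _) _; move: yw; rewrite ltr_pdivlMr// mulrC => /ltW; apply: le_trans.
  by rewrite ler_wpM2r ?nrm_ge0// lerDl.
have ET y : E y.
  apply: contrapT => nEy.
  have oE : open (~` E) by rewrite openC.
  have [w [nw []]] := xd _ (ex_intro _ y nEy) oE.
  move=> n [z [u [hu wE]]]; apply: nw; rewrite wE.
  have {}hu i : E (u i).
    have [i' _] := hu i; move: (u i); apply: closure_sub_closed => // _ [a _ <-].
    have [r r0 ar] := cfun_bounded a cK.
    have r1 : 0 < r + 1 by lra.
    have -> : a = rc k (r + 1) *: (rc k (r + 1)^-1 *: a).
      by rewrite scalerA -rcM divff ?rc1 ?scale1r// gt_eqF.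
    rewrite modZ// -[_ *: _]addr0; apply: EZ => //.
    apply: eq1 => t; rewrite cfunZ nrmM nrm_rc gtr0_norm ?invr_gt0// mulrC ler_pdivrMr// mul1r.
    by have := ar t; lra.
  elim/big_ind: _ => //.
    by move=> u1 u2 h1 h2; rewrite -[u1]scale1r; exact: EZ.
  by move=> i _; rewrite -[_ *: _]addr0; exact: EZ.
(* The sequence that is 1 at the even terms of nk and 0 elsewhere tells g from g'. *)
pose s := mklinf (fun n => if `[< exists p, n = nk p.*2 >] then 1 else 0 : F).
have sE n : s n = if `[< exists p, n = nk p.*2 >] then 1 else 0.
  rewrite /s (@mklinfE R k _ 1)// => i; case: asboolP => _; rewrite ?nrm1 ?nrm0 ?ler01//.
have := ET (T s); rewrite /E /=.
have -> : g (T s) = 1.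
  apply: (cvg_unique _ (gE _)); first exact: norm_hausdorff.
  rewrite (_ : (fun p => _) = fun=> 1); first exact: cvg_cst.
  by apply/funext => p; rewrite fT sE; case: asboolP => // -[]; exists p.
have -> : g' (T s) = 0.
  apply: (cvg_unique _ (g'E _)); first exact: norm_hausdorff.
  rewrite (_ : (fun p => _) = fun=> 0); first exact: cvg_cst.
  apply/funext => p; rewrite fT sE; case: asboolP => // -[q /nk_inj].
  by move=> /(congr1 odd); rewrite /= !odd_double.
by move=> /eqP; rewrite oner_eq0.
Qed.
End WeakStar.

(** * The cycle of implications *)

Lemma contains_linfty_sub (R : realType) (k : scalar_kind) (X : normedModType (scalars R k))
  (E G : set X) : E `<=` G -> contains_linfty E -> contains_linfty G.
Proof. by move=> EG [T [S [h TE]]]; exists T, S; split=> //; exact: subset_trans TE EG. Qed.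

Theorem theorem4p7 (R : realType) (k : scalar_kind) (K : topologicalType)
    (X : completeNormedModType (scalars R k))
    (m : cfun K (scalars R k) -> bop X X)
    (K_compact : compact [set: K]) (K_hausdorff : hausdorff_space K)
    (m_module : banach_module m) (m_inj : injective m)
    (m_closed : closed (range m : set (wot X)))
    (X_fg : finitely_generated m) :
  [<->
    (* (1) *) [/\ totally_disconnected [set: K], veksler m
                & forall x, ~ contains_linfty (cyclic_subspace m x)];
    (* (2) *) [/\ stonian K, kaplansky m
                & forall x, ~ contains_linfty (cyclic_subspace m x)];
    (* (3) *) forall x, order_continuous_norm m x;
    (* (4) *) stonian K /\ bade_complete m;
    (* (5) *) hyperstonian K (scalars R k) /\
              exists P : predual K (scalars R k), wstar_wot_continuous m P;
    (* (1A) *) [/\ totally_disconnected [set: K], veksler m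
                 & ~ contains_linfty [set: X]];
    (* (2A) *) [/\ stonian K, kaplansky m & ~ contains_linfty [set: X]]].
Proof.
have cyc (x : X) : ~ contains_linfty [set: X] -> ~ contains_linfty (cyclic_subspace m x).
  by move=> nol h; apply: nol; exact: contains_linfty_sub h.
have td : stonian K -> totally_disconnected [set: K].
  by move=> st; exact: zero_dimension_totally_disconnected (stonian_zd K_hausdorff st).
have carr : kaplansky m -> forall x, x != 0 -> exists e, carrier_projection m x e.
  by move=> kap x _; apply: kaplansky_carrier => //; exact: kap.1.
(* Serves the step from (1) to (2) and the one from (1A) to (2A), where the condition on X is first
   restricted to cyclic subspaces. *)
have one_two : totally_disconnected [set: K] -> veksler m ->
    (forall x, ~ contains_linfty (cyclic_subspace m x)) -> stonian K /\ kaplansky m.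
  move=> tdK [_ vek] nol.
  have [st nm] := veksler_normal K_compact K_hausdorff m_module
    (td_zero_dim R K_compact K_hausdorff tdK) vek nol m_inj m_closed.
  by split=> //; exact: normal_kaplansky.
tfae.
- by move=> [tdK vek nol]; have [st kap] := one_two tdK vek nol.
- move=> [st kap nol].
  have [_ nm] := veksler_normal K_compact K_hausdorff m_module
    (stonian_zd K_hausdorff st) (carr kap) nol m_inj m_closed.
  exact: normal_oc.
- by move=> oc; have [st nm] := oc_normal K_compact K_hausdorff m_module oc m_inj m_closed;
    split=> //; exact: normal_bade.
- move=> [st bc].
  have nm := bade_normal K_compact K_hausdorff m_module st bc.
  pose P := nf_predual K_compact K_hausdorff st m_module m_inj nm.
  by split; [split|exists P; exact: normal_wstar].
- move=> [[st _] [P wc]]; split; first exact: td.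
    by split=> [|x _]; [exact: td|exact: wstar_carrier wc _ st].
  (* Finite generation enters here: two functionals that agree on the cyclic subspaces of finitely
     many generators agree on X. *)
  exact: wstar_no_linfty wc _.
- move=> [tdK vek nol]; have [st kap] := one_two tdK vek (fun x => cyc x nol); by [].
- move=> [st kap nol]; split; [exact: td|split; [exact: td|exact: carr]|by move=> x; exact: cyc].
Qed.
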